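(* Let $(I,\mathcal{B}(I),\mathcal{L})$ be a standard probability space without atoms, let $d\ge 1$ be an integer, let $K=\mathbf{T}^d=(\mathbb{R}/\mathbb{Z})^d$, and let $f:I\to K$ be a measurable map. The following are equivalent. (1) The map $f$ is asynchronous. (2) The closure in $\mathcal{M}_{\mathcal{L}}$ of the set $\{\mathcal{D}_{nf} : n\in\mathbb{Z}\}$ contains $\lambda$. (3) The convolution action of $\mathcal{D}_f$ on $\mathcal{M}_{\mathcal{L}}$, i.e. the map $\mu\mapsto \mathcal{D}_f*\mu$, is uniquely ergodic. If these are true, the only invariant probability measure on $\mathcal{M}_{\mathcal{L}}$ for the map $\mu\mapsto \mathcal{D}_f*\mu$ is the Dirac measure $\delta_\lambda$.
   Context: Definitions. $f:I\to K$ is asynchronous if the image measure $f_*\mathcal{L}$ gives zero mass to every translate of every proper closed subgroup of $K$ (equivalently, for every non-trivial character $\chi\in\hat K$, the measure $(\chi\circ f)_*\mathcal{L}$ has no atoms). $\mathcal{M}_{\mathcal{L}}$ is the set of probability measures on $I\times K$ whose projection to $I$ is $\mathcal{L}$. It is endowed with the weak-* topology: fix a compact metrizable topology on $I$ whose Borel $\sigma$-algebra is $\mathcal{B}(I)$ (for example, identify $(I,\mathcal{L})$ with $[0,1]$ with Lebesgue measure), and take the topology generated by the maps $\mu\mapsto\int F\,d\mu$, $F:I\times K\to\mathbb{C}$ continuous. The resulting topology on $\mathcal{M}_{\mathcal{L}}$ is compact metrizable and does not depend on the choice of topology on $I$. For a measurable map $g:I\to K$, the graph measure $\mathcal{D}_g\in\mathcal{M}_{\mathcal{L}}$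 is the pushforward of $\mathcal{L}$ by $x\mapsto (x,g(x))$. For $n\in\mathbb{Z}$, $nf$ is the map $x\mapsto nf(x)$. Each $\mu\in\mathcal{M}_{\mathcal{L}}$ has a disintegration $(\mu^x)_{x\in I}$ along $\mathcal{L}$, with $\mu^x$ probability measures on $K$ and $\int F\,d\mu=\int_I\int_K F(x,y)\,d\mu^x(y)\,d\mathcal{L}(x)$. The fiberwise convolution $\mu*\nu\in\mathcal{M}_{\mathcal{L}}$ is defined by $(\mu*\nu)^x=\mu^x*\nu^x$ (usual convolution on $K$) for $\mathcal{L}$-a.e. $x$. $\lambda=\mathcal{L}\otimes \mathrm{Haar}_K\in\mathcal{M}_{\mathcal{L}}$, with $\mathrm{Haar}_K$ the Haar probability measure on $K$. Uniquely ergodic means that there is exactly one invariant Borel probability measure on $\mathcal{M}_{\mathcal{L}}$. *)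

(* Defs.v *)
From HB Require Import structures.
From mathcomp Require Import all_boot all_order all_algebra.
From mathcomp Require Import generic_quotient ring_quotient.
From mathcomp Require Import all_classical all_reals all_analysis.
From mathcomp Require Import measurable_realfun.
From mathcomp Require Import complex.

Set Implicit Arguments.
Unset Strict Implicit.
Unset Printing Implicit Defensive.
Import Order.TTheory GRing.Theory Num.Theory.
Import numFieldNormedType.Exports.

Local Open Scope classical_set_scope.
Local Open Scope ring_scope.
Local Open Scope quotient_scope.

Section Torus.
Variable R : realType.

Definition integers : zmodClosed R :=
  GRing.ZmodClosed.clone R Num.int_num_subdef _.

Definition circle : Type := quotient_topology {ideal_quot integers}.

HB.instance Definition _ := PointedTopological.on circle.
HB.instance Definition _ := @GRing.isZmodule.Build circle _ _ _
  (@Quotient.addqA R integers) (@Quotient.addqC R integers)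
  (@Quotient.add0q R integers) (@Quotient.addNq R integers).

(* Carries the pointwise group law, the product topology and the Borel
   sigma-algebra of the latter. *)
Definition torus (d : nat) : Type := 'I_d -> circle.

HB.instance Definition _ d := GRing.Zmodule.on (torus d).
HB.instance Definition _ d :=
  Topological.copy (torus d) (prod_topology (fun _ : 'I_d => circle)).
HB.instance Definition _ d := Pointed.on (torus d).
HB.instance Definition _ d :=
  Measurable.copy (torus d) (g_sigma_algebraType (@open (torus d))).

End Torus.

Section TorusTheory.
Variable R : realType.

Let proj_torus_continuous d (i : 'I_d) :
  continuous (fun x : torus R d => x i).
Proof. exact: (@proj_continuous _ (fun _ : 'I_d => circle R)). Qed.

Let circle_mulz_continuous (n : int) :
  continuous ((fun x => x *~ n) : circle R -> circle R).
Proof.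
pose Q := {ideal_quot (integers R)}; pose p := \pi_(quotient_topology Q).
apply/(@quotient_continuous R Q).
have -> : ((fun x => x *~ n) : circle R -> circle R) \o p =
          p \o ( *%R (n%:~R : R)).
  apply/funext => x /=; rewrite mulrzl.
  exact/esym/(raddfMz (\pi_Q : {additive R -> Q})).
move=> x; apply: continuous_comp; first exact: mulrl_continuous.
exact: pi_continuous.
Qed.

Lemma torus_mulz_continuous d (n : int) :
  continuous ((fun x => x *~ n) : torus R d -> torus R d).
Proof.
have fE (x : torus R d) i : (x *~ n) i = x i *~ n.
  have nE (y : torus R d) (k : nat) : (y *+ k) i = y i *+ k.
    by elim: k => [|k IH]; rewrite ?mulr0n// !mulrS -IH.
  by case: n => k; rewrite ?NegzE ?mulrNz -?pmulrn -nE.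
move=> x; apply/cvg_sup; first exact/fmap_filter/(nbhs_filter (x : torus R d)).
move=> i U.
have /= -> := @nbhsE (initial_topology (fun y : torus R d => y i)) (x *~ n).
case=> B [[V oV <-] /= Vx] /filterS; apply.
  exact/fmap_filter/(nbhs_filter (x : torus R d)).
have gc : {for x, continuous (fun y : torus R d => y i *~ n)}.
  apply: (@continuous_comp _ _ _ (fun y : torus R d => y i)
    ((fun c => c *~ n) : circle R -> circle R) x).
    exact: proj_torus_continuous.
  exact: circle_mulz_continuous.
have nV : nbhs (x i *~ n) V by apply: open_nbhs_nbhs; split; rewrite -?fE.
have h : nbhs (x : torus R d) (fun y : torus R d => V (y i *~ n)) := gc _ nV.
have VE : (fun y : torus R d => V (y i *~ n)) =
    (fun y : torus R d => V ((y *~ n) i)) by apply/funext => y; rewrite fE.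
by rewrite VE in h.
Qed.

Lemma measurable_torus_mulz d (n : int) :
  measurable_fun setT ((fun x => x *~ n) : torus R d -> torus R d).
Proof.
apply: (@measurability _ _ _ _ setT _ (@open (torus R d))) => //.
move=> _ [B oB <-]; rewrite setTI; apply: sub_sigma_algebra.
by have /continuousP/(_ _ oB) := @torus_mulz_continuous d n.
Qed.

End TorusTheory.

Section StandardSpace.

(* Topologies as data on a fixed carrier, so that a topology can be put on the
   underlying set of a measurable space. *)
Record topology_on (T : Type) := TopologyOn {
  topology_open : set (set T) ;
  topology_openT : topology_open setT ;
  topology_openI : setI_closed topology_open ;
  topology_open_bigU : forall (J : Type) (f : J -> set T),
    (forall j, topology_open (f j)) -> topology_open (\bigcup_j f j) }.

Definition topologized (T : Type) (tau : topology_on T) : Type := T.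

HB.instance Definition _ (T : choiceType) (tau : topology_on T) :=
  Choice.on (topologized tau).
HB.instance Definition _ (T : choiceType) (tau : topology_on T) :=
  isOpenTopological.Build (topologized tau)
    (topology_openT tau) (@topology_openI T tau) (@topology_open_bigU T tau).

Definition homeomorphism (S T : topologicalType) (h : S -> T) :=
  continuous h /\
  exists g : T -> S, [/\ continuous g, cancel h g & cancel g h].

Definition compact_metrizable (R : realType) (T : topologicalType) :=
  compact [set: T] /\
  exists (M : metricType R) (h : T -> M), homeomorphism h.

Definition polish (R : realType) (T : topologicalType) :=
  (exists2 D : set T, countable D & dense D) /\
  exists (M : metricType R) (h : T -> M), homeomorphism h /\
    forall F : set_system M, ProperFilter F -> cauchy F ->
      exists x : M, F --> x.

Definition borel_topology d (T : measurableType d) (tau : topology_on T) :=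
  @measurable d T = <<s @open (topologized tau) >>.

(* The metrics are valued in R, which is no restriction as any two realTypes are
   isomorphic. *)
Definition standard_borel (R : realType) d (T : measurableType d) :=
  exists tau : topology_on T, borel_topology tau /\ polish R (topologized tau).

Definition atomless d (T : measurableType d) (R : realType)
    (P : probability T R) :=
  ~ exists A : set T, [/\ measurable A, (0 < P A)%E &
      forall B, measurable B -> B `<=` A -> P B = 0%E \/ P B = P A].

End StandardSpace.

Section TorusGroup.
Variables (R : realType) (d : nat).
Local Notation K := (torus R d).

Definition subgroup (H : set K) := H 0 /\ forall x y, H x -> H y -> H (x - y).

Definition translate (a : K) (A : set K) : set K := [set a + x | x in A].

Definition is_haar (m : probability K R) :=
  forall (a : K) (A : set K), measurable A -> m (translate a A) = m A.

Definition torus_conv (m1 m2 : set K -> \bar R) : set K -> \bar R :=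
  pushforward (m1 \x m2)%E (fun z : K * K => z.1 + z.2).

Definition asynchronous dI (I : measurableType dI) (L : probability I R)
    (f : I -> K) :=
  forall H : set K, closed H -> subgroup H -> H != setT ->
  forall a : K, pushforward L f (translate a H) = 0%E.

End TorusGroup.

(* A measure in the library is a function on all subsets, with arbitrary values
   on non-measurable ones. Setting these values to 0 does not affect the
   underlying measure, and makes Leibniz equality of measures coincide with
   equality on measurable sets. *)
Section Truncation.
Context dT (T : measurableType dT) (R : realType).
Local Open Scope ereal_scope.

Definition mtrunc (mu : set T -> \bar R) (A : set T) : \bar R :=
  if `[< measurable A >] then mu A else 0.

Lemma mtruncE (mu : set T -> \bar R) A : measurable A -> mtrunc mu A = mu A.
Proof. by rewrite /mtrunc; case: asboolP. Qed.

Variable mu : probability T R.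

Let mtrunc0 : mtrunc mu set0 = 0.
Proof. by rewrite mtruncE// measure0. Qed.

Let mtrunc_ge0 A : 0 <= mtrunc mu A.
Proof. by rewrite /mtrunc; case: ifP. Qed.

Let mtrunc_sigma_additive : semi_sigma_additive (mtrunc mu).
Proof.
move=> F mF tF mUF; rewrite mtruncE//.
under eq_fun do under eq_bigr do rewrite mtruncE//.
exact: measure_semi_sigma_additive.
Qed.

HB.instance Definition _ := isMeasure.Build _ _ _ (mtrunc mu)
  mtrunc0 mtrunc_ge0 mtrunc_sigma_additive.

Let mtrunc_setT : mtrunc mu setT = 1.
Proof. by rewrite mtruncE// probability_setT. Qed.

HB.instance Definition _ := Measure_isProbability.Build _ _ _ (mtrunc mu)
  mtrunc_setT.

End Truncation.

Section FiberedMeasures.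
Context (R : realType) dI (I : measurableType dI) (L : probability I R)
  (d : nat).
Local Notation K := (torus R d).

(* The set of probability measures on I * K with first marginal L, each
   represented by its truncation. *)
Record fibered := Fibered {
  fibered_prob :> probability (I * K)%type R ;
  fibered_marginal : forall A : set I, measurable A ->
    pushforward fibered_prob fst A = L A ;
  fibered_nonmeasurable : forall A : set (I * K), ~ measurable A ->
    fibered_prob A = 0%E }.

HB.instance Definition _ := gen_eqMixin fibered.
HB.instance Definition _ := gen_choiceMixin fibered.

Let fibered_of_marginal (m : probability (I * K)%type R)
    (mL : forall A : set I, measurable A -> pushforward m fst A = L A) A :
  measurable A -> pushforward (mtrunc m) fst A = L A.
Proof.
move=> mA; rewrite -mL// /pushforward mtruncE//.
by rewrite -[X in measurable X]setTI; exact: measurable_fst.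
Qed.

Let fibered_of_nonmeasurable (m : probability (I * K)%type R) A :
  ~ measurable A -> mtrunc m A = 0%E.
Proof. by rewrite /mtrunc; case: asboolP. Qed.

Definition fibered_of (m : probability (I * K)%type R)
    (mL : forall A : set I, measurable A -> pushforward m fst A = L A) :
    fibered :=
  @Fibered (mtrunc m) (fibered_of_marginal mL)
    (@fibered_of_nonmeasurable m).

Definition graph_map (g : I -> K) (x : I) : I * K := (x, g x).

Lemma measurable_graph_map (g : {mfun I >-> K}) :
  measurable_fun setT (graph_map g).
Proof. by apply: measurable_fun_pair. Qed.

HB.instance Definition _ (g : {mfun I >-> K}) :=
  isMeasurableFun.Build _ _ _ _ (graph_map g) (measurable_graph_map g).

Lemma graph_marginal (g : {mfun I >-> K}) (A : set I) : measurable A ->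
  pushforward (distribution L (graph_map g)) fst A = L A.
Proof. by []. Qed.

Definition graph_measure (g : {mfun I >-> K}) : fibered :=
  fibered_of (graph_marginal g).

HB.instance Definition _ := isPointed.Build fibered (graph_measure (cst 0)).

Definition torus_mulz (n : int) (g : I -> K) (x : I) : K := g x *~ n.

Let measurable_mulz (n : int) (g : {mfun I >-> K}) :
  measurable_fun setT (torus_mulz n g).
Proof.
exact: measurableT_comp (@measurable_torus_mulz R d n) (measurable_funPT g).
Qed.

HB.instance Definition _ (n : int) (g : {mfun I >-> K}) :=
  isMeasurableFun.Build _ _ _ _ (torus_mulz n g) (measurable_mulz n g).

Let product_setT (m : probability K R) : (L \x m)%E setT = 1%E.
Proof. by rewrite -setXTT product_measure1E//= !probability_setT mule1. Qed.

HB.instance Definition _ (m : probability K R) :=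
  Measure_isProbability.Build _ _ _ (L \x m)%E (product_setT m).

Lemma product_marginal (m : probability K R) (A : set I) : measurable A ->
  pushforward (L \x m)%E fst A = L A.
Proof.
move=> mA; rewrite /pushforward -setXT product_measure1E//=.
by rewrite probability_setT mule1.
Qed.

Definition product_fibered (m : probability K R) : fibered :=
  fibered_of (product_marginal m).

Definition disintegration (mu : fibered) (k : R.-pker I ~> K) :=
  forall F : I * K -> \bar R,
    measurable_fun setT F -> (forall z, (0 <= F z)%E) ->
    (\int[mu]_z F z = \int[L]_x \int[k x]_y F (x, y))%E.

Definition is_fiberwise_conv (mu nu rho : fibered) :=
  exists kmu knu krho : R.-pker I ~> K,
    [/\ disintegration mu kmu, disintegration nu knu,
        disintegration rho krho &
        {ae L, forall x, forall A : set K, measurable A ->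
           krho x A = torus_conv (kmu x) (knu x) A}].

(* By the disintegration theorem, for I standard Borel there is exactly one such
   rho for all mu and nu, so that the default value of xget is never used. *)
Definition fiberwise_conv (mu nu : fibered) : fibered :=
  xget point [set rho | is_fiberwise_conv mu nu rho].

Section WeakTopology.
Variable tau : topology_on I.

Definition integralC (mu : fibered) (F : I * K -> R[i]) : R[i] :=
  ((\int[mu]_(z in setT) complex.Re (F z)) +i*
   (\int[mu]_(z in setT) complex.Im (F z)))%C.

(* The initial topology of mu |-> (integral of F)_F, with values in a product
   indexed by all continuous F, is the topology generated by the maps
   mu |-> integral of F. *)
Definition weak_eval (mu : fibered) :
    prod_topology (fun _ : continuousType (topologized tau * K)%type R[i]^o =>
      R[i]^o) :=
  fun F => integralC mu F.

Definition weak_fibered : Type := initial_topology weak_eval.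

HB.instance Definition _ := PointedTopological.on weak_fibered.
HB.instance Definition _ :=
  Measurable.copy weak_fibered (g_sigma_algebraType (@open weak_fibered)).

End WeakTopology.

End FiberedMeasures.

Section UniqueErgodicity.
Context dX (X : measurableType dX) (R : realType) (T : X -> X).

Definition invariant_probability (P : probability X R) :=
  forall A, measurable A -> pushforward P T A = P A.

Definition uniquely_ergodic :=
  exists P : probability X R, invariant_probability P /\
    forall Q : probability X R, invariant_probability Q ->
      forall A, measurable A -> Q A = P A.

End UniqueErgodicity.

(* Main.v *)
Require Import Defs.
From HB Require Import structures.
From mathcomp Require Import all_boot all_order all_algebra.
From mathcomp Require Import generic_quotient ring_quotient.
From mathcomp Require Import all_classical all_reals all_analysis.
From mathcomp Require Import measurable_realfun.
From mathcomp Require Import complex.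
From mathcomp Require Import zify ring lra.

(** The convolution with the graph measure of [f] is concrete. The conditional
laws of a graph measure are Dirac masses, so if fiberwise convolutions exist, it
sends [mu] to its image under [(x, y) |-> (x, y + f x)] ([fiberwise_conv_graph]).
Existence requires disintegrations; they are obtained by drawing the coordinates
of the torus one by one with conditional quantiles ([quantile_transform],
[torus_transfer]). The translation is continuous for the weak topology although
[f] is only measurable, because the marginal on the base is prescribed and the
means of continuous functions on the base times waves on the torus determine
everything ([trig_sum_dense], [trig_cvg_weak], [shift_continuous]).

Suppose that [f] is asynchronous. The level sets of a non-trivial character are
cosets of a proper closed subgroup, so the phase of this character at [f] has a
law without atoms modulo 2 pi. By Wiener's lemma ([wiener]) every Fourier
coefficient of non-zero frequency of the iterates of a fibered measure tends to
0 in quadratic mean. This gives the two implications from asynchrony.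

- The iterates of the graph of 0 are the graphs of the multiples of [f]. Their
  coefficients tend to those of the product measure along the filter of the sets
  of integers of density one, hence so do the graph measures
  ([asynchronous_closure]).
- Under an invariant probability, the mean square of the n-th coefficient does
  not depend on n, and its averages tend to 0: it vanishes. Countably many
  coefficients determine a fibered measure, so an invariant probability is the
  Dirac mass at the product measure ([invariant_fourier],
  [asynchronous_invariant]).

Suppose now that [f] maps a set [A] of positive measure to a coset [a + H] of a
proper closed subgroup.

- For [chi] continuous and zero on [H], the mean of [chi (y - y')] over pairs of
  points above [A] is a continuous function of the fibered measure. It is 0 at
  every graph measure of a multiple of [f], and positive at the product measure
  if [chi] is a bump function off [H] ([closure_asynchronous]).
- Above [A] put a law that is invariant under [H] and is not Haar measure,
  translated by [Z]; elsewhere put Haar measure. The action replaces [Z] by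
  [Z + a], so when [Z] is Haar distributed the law of this fibered measure is
  invariant. It is not the Dirac mass at the product measure, which is invariant
  too ([uniquely_ergodic_asynchronous]). *)

Set Implicit Arguments.
Unset Strict Implicit.
Unset Printing Implicit Defensive.
Import Order.TTheory GRing.Theory Num.Theory.
Import numFieldNormedType.Exports.

Local Open Scope classical_set_scope.
Local Open Scope ring_scope.

(** * Continuous real functions *)

Section ContinuousAlgebra.
Variables (R : realType) (T : topologicalType).
Implicit Types f g : T -> R.

Lemma continuous_add f g : continuous f -> continuous g ->
  continuous (fun x => f x + g x).
Proof. by move=> cf cg x; exact: (cvgD (cf x) (cg x)). Qed.

Lemma continuous_opp f : continuous f -> continuous (fun x => - f x).
Proof. by move=> cf x; exact: (cvgN (cf x)). Qed.

Lemma continuous_mul f g : continuous f -> continuous g ->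
  continuous (fun x => f x * g x).
Proof. by move=> cf cg x; exact: (cvgM (cf x) (cg x)). Qed.

Lemma continuous_abs f : continuous f -> continuous (fun x => `|f x|).
Proof. by move=> cf x; exact: (cvg_norm (cf x)). Qed.

Lemma continuous_min f g : continuous f -> continuous g ->
  continuous (fun x => Num.min (f x) (g x)).
Proof.
move=> cf cg; under eq_fun do rewrite minr_absE.
apply: continuous_mul; last exact: cst_continuous.
apply: continuous_add; first exact: continuous_add.
apply: continuous_opp; apply: continuous_abs.
by apply: continuous_add => //; exact: continuous_opp.
Qed.

Lemma continuous_sum (I : Type) (r : seq I) (F : I -> T -> R) :
  (forall i, continuous (F i)) -> continuous (fun x => \sum_(i <- r) F i x).
Proof.
move=> cF; elim: r => [|i r IH].
  by under eq_fun do rewrite big_nil; exact: cst_continuous.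
by under eq_fun do rewrite big_cons; exact: continuous_add.
Qed.

End ContinuousAlgebra.

(** * The circle and the torus *)

Definition to_circle (R : realType) (t : R) : circle R :=
  \pi_(quotient_topology {ideal_quot (integers R)})%qT t.

Lemma to_circle_is_zmod_morphism (R : realType) :
  zmod_morphism (@to_circle R).
Proof. exact: (@pi_is_zmod_morphism _ _ _ {ideal_quot (integers R)}). Qed.

HB.instance Definition _ (R : realType) :=
  GRing.isZmodMorphism.Build R (circle R) (@to_circle R)
    (@to_circle_is_zmod_morphism R).

Section Circle.
Variable R : realType.
Implicit Types (c : circle R) (s t : R).
Local Notation twopi := (pi *+ 2 : R).

Lemma to_circle_continuous : continuous (@to_circle R).
Proof. exact: pi_continuous. Qed.

Lemma circle_continuous (Z : topologicalType) (f : circle R -> Z) :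
  continuous (f \o @to_circle R) -> continuous f.
Proof. exact: (@quotient_continuous _ {ideal_quot (integers R)} _ _).2. Qed.

Lemma to_circle_eqP s t :
  to_circle s = to_circle t <-> exists z : int, s = t + z%:~R.
Proof.
have E := Quotient.idealrBE (integers R) s t.
split => [st|[z stz]].
  have /intrP[z stz] : s - t \is a Num.int by rewrite E; exact/eqP.
  by exists z; rewrite -stz addrC subrK.
have : s - t \in integers R by rewrite stz addrC addKr; apply/intrP; exists z.
by rewrite E => /eqP.
Qed.

(** In turns, not in radians; it jumps at 0. *)
Definition angle c : R := repr c - (Num.floor (repr c))%:~R.

Lemma angleK : cancel angle (@to_circle R).
Proof.
move=> c; transitivity (to_circle (repr c)); last exact: reprK.
by apply/to_circle_eqP; exists (- Num.floor (repr c)); rewrite mulrNz.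
Qed.

Lemma angle_ge0 c : 0 <= angle c.
Proof. by rewrite subr_ge0 floor_le. Qed.

Lemma angle_lt1 c : angle c < 1.
Proof.
by rewrite ltrBlDr addrC -intrD1 (andP (floor_itv _)).2.
Qed.

Lemma to_circleK t : exists z : int, angle (to_circle t) = t + z%:~R.
Proof. by apply/to_circle_eqP; rewrite angleK. Qed.

Lemma angle_to_circle t : 0 <= t < 1 -> angle (to_circle t) = t.
Proof.
move=> /andP[t0 t1]; have [z tz] := to_circleK t.
suff z0 : z = 0 by rewrite tz z0 addr0.
have := angle_ge0 (to_circle t); have := angle_lt1 (to_circle t).
rewrite tz => h1 h2.
have : (z%:~R : R) < 1%:~R by lra.
have : ((-1)%:~R : R) < z%:~R by rewrite mulrNz; lra.
rewrite !ltr_int; lia.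
Qed.

Lemma cosDint (x : R) (z : int) : cos (x + twopi * z%:~R) = cos x.
Proof.
case: z => n.
  by rewrite -pmulrn mulr_natr periodicn//; exact: cosD2pi.
rewrite NegzE mulrNz mulrN -pmulrn mulr_natr.
rewrite -[in RHS](subrK (twopi *+ n.+1) x) (@periodicn _ _ cos twopi)//.
exact: cosD2pi.
Qed.

Lemma cos_twopi_eq1 t : 0 <= t < 1 -> cos (twopi * t) = 1 -> t = 0.
Proof.
move=> /andP[t0 t1]; rewrite mulrnAl cos_mulr2n.
have := cos2Dsin2 (pi * t); move=> h1 h2.
have s0 : sin (pi * t) = 0.
  by apply/eqP; rewrite -sqrf_eq0; apply/eqP; lra.
have [//|tn0] := eqVneq t 0.
suff : 0 < sin (pi * t) by rewrite s0 ltxx.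
have p0 := @pi_gt0 R.
have : 0 < pi * (1 - t) by rewrite mulr_gt0// subr_gt0.
rewrite mulrBr mulr1 subr_gt0 => ptp.
by apply: sin_gt0_pi; rewrite ptp mulr_gt0// lt_neqAle eq_sym tn0.
Qed.

(** Away from 0, the set of points of angle below [t] is open since its
preimage under the quotient map is a union of open intervals; at 0 the angle
jumps. *)
Lemma open_angle_lt t : t <= 1 -> open [set c : circle R | 0 < angle c < t].
Proof.
move=> t1; change (open (@to_circle R @^-1` [set c : circle R | 0 < angle c < t])).
rewrite (_ : _ @^-1` _ = \bigcup_(z : int) `]z%:~R : R, z%:~R + t[%classic).
  by apply: bigcup_open => z _; exact: itv_open.
apply/seteqP; split => [s /= h|s [z _] /=].
  have [z zs] := to_circleK s; exists (- z) => //=.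
  by move: h; rewrite zs in_itv/= mulrNz; lra.
rewrite in_itv/= => h.
suff -> : angle (to_circle s) = s - z%:~R by lra.
rewrite -(@angle_to_circle (s - z%:~R)); last lra.
by congr angle; apply/to_circle_eqP; exists z; rewrite subrK.
Qed.

Lemma cos_angle_continuous (n : int) (th : R) :
  continuous (fun c : circle R => cos (twopi * (n%:~R * angle c) + th)).
Proof.
apply: circle_continuous => t.
rewrite (_ : _ \o _ = fun s : R => cos (twopi * (n%:~R * s) + th)).
  apply: (@continuous_comp _ _ _ (fun s : R => twopi * (n%:~R * s) + th)).
    by apply: cvgD; [apply: cvgMr; apply: cvgMr|exact: cvg_cst].
  exact: continuous_cos.
apply/funext => s /=; have [z ->] := to_circleK s.
by rewrite mulrDr mulrDr -intrM addrAC cosDint.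
Qed.

Lemma compact_circle : compact [set: circle R].
Proof.
rewrite (_ : setT = @to_circle R @` `[0, 1]%classic).
  apply: continuous_compact; last exact: segment_compact.
  exact/continuous_subspaceT/to_circle_continuous.
apply/seteqP; split => // c _; exists (angle c); last exact: angleK.
by rewrite /= in_itv/= angle_ge0 ltW// angle_lt1.
Qed.

End Circle.

Section Torus.
Variables (R : realType) (d : nat).
Local Notation twopi := (pi *+ 2 : R).
Local Notation K := (torus R d).
Implicit Types (x y z : K) (k : 'I_d -> int).

Lemma coord_continuous (i : 'I_d) : continuous (fun y : K => y i).
Proof. exact: (@proj_continuous _ (fun _ : 'I_d => circle R)). Qed.

Lemma compact_torus : compact [set: K].
Proof.
rewrite (_ : setT = [set y : K | forall i : 'I_d, [set: circle R] (y i)]).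
    exact: (@tychonoff 'I_d (fun _ => circle R) (fun _ => setT) (fun _ => @compact_circle R)).
by apply/seteqP; split.
Qed.

(** The argument of the character of frequency [k]; only its class modulo
2 pi matters. *)
Definition phase k y : R := twopi * \sum_i (k i)%:~R * angle (y i).

Definition eq2pi (a b : R) := exists z : int, a = b + twopi * z%:~R.

Lemma cos_eq2pi a b c : eq2pi a b -> cos (a + c) = cos (b + c).
Proof. by move=> [z ->]; rewrite addrAC cosDint. Qed.

Lemma eq2pi_sum k (a b : 'I_d -> R) :
    (forall i, to_circle (a i) = to_circle (b i)) ->
  eq2pi (twopi * \sum_i (k i)%:~R * a i) (twopi * \sum_i (k i)%:~R * b i).
Proof.
move=> ab; have /choice[z zP] : forall i, exists z : int, a i = b i + z%:~R.
  by move=> i; exact/to_circle_eqP.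
exists (\sum_i k i * z i); rewrite -mulrDr; congr (_ * _).
rewrite rmorph_sum/= -big_split/=; apply: eq_bigr => i _.
by rewrite zP mulrDr intrM.
Qed.

Lemma phaseD k x y : eq2pi (phase k (x + y)) (phase k x + phase k y).
Proof.
rewrite /phase -mulrDr -big_split/=.
under [X in eq2pi _ (_ * X)]eq_bigr do rewrite -mulrDr.
by apply: eq2pi_sum => i; rewrite angleK (raddfD (@to_circle R))/= !angleK.
Qed.

Lemma phase_to_circle k (t : 'I_d -> R) :
  eq2pi (phase k (fun i => to_circle (t i))) (twopi * \sum_i (k i)%:~R * t i).
Proof. by apply: eq2pi_sum => i; rewrite angleK. Qed.

(** The real part of a rotated character; the waves span the real-valued
trigonometric polynomials. *)
Definition wave k (th : R) y := cos (phase k y + th).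

Lemma waveD k th x y : wave k th (x + y) = wave k (phase k x + th) y.
Proof.
rewrite /wave (cos_eq2pi _ (phaseD k x y)).
by rewrite (addrC (phase k x)) -addrA.
Qed.

Lemma wave_continuous k th : continuous (wave k th).
Proof.
pose S (r : seq 'I_d) y := twopi * \sum_(i <- r) (k i)%:~R * angle (y i).
suff : forall r th', continuous (fun y => cos (S r y + th')) by apply.
elim=> [|i r IH] th'.
  rewrite [X in continuous X](_ : _ = cst (cos th')); first exact: cst_continuous.
  by apply/funext => y; rewrite /S big_nil mulr0 add0r.
rewrite [X in continuous X](_ : _ = fun y =>
   cos (twopi * ((k i)%:~R * angle (y i)) + th') * cos (S r y + 0) +
   cos (twopi * ((k i)%:~R * angle (y i)) + (th' - pi / 2)) *
   cos (S r y + pi / 2)); last first.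
  apply/funext => y; rewrite /S big_cons mulrDr addr0 addrA cosBpihalf cosDpihalf.
  by rewrite mulrN -cosD; congr cos; ring.
have coordc th1 : continuous (fun y : K =>
    cos (twopi * ((k i)%:~R * angle (y i)) + th1)).
  move=> y; apply: (@continuous_comp _ _ _ (fun y : K => y i) (fun c =>
    cos (twopi * ((k i)%:~R * angle c) + th1))); first exact: coord_continuous.
  exact: cos_angle_continuous.
by apply: continuous_add; apply: continuous_mul.
Qed.

Definition gauge y : R := \sum_i (1 - cos (twopi * angle (y i))).

Lemma gauge_ge0 y : 0 <= gauge y.
Proof. by apply: sumr_ge0 => i _; rewrite subr_ge0 cos_le1. Qed.

Lemma gauge0 : gauge 0 = 0.
Proof.
rewrite /gauge big1// => i _.
suff -> : angle ((0 : K) i) = 0 by rewrite mulr0 cos0 subrr.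
by rewrite -[X in angle X](raddf0 (@to_circle R)) angle_to_circle// lexx ltr01.
Qed.

Lemma gauge_eq0 y : gauge y = 0 -> y = 0.
Proof.
move=> /eqP; rewrite psumr_eq0 => [/allP y0|i _]; last first.
  by rewrite subr_ge0 cos_le1.
apply/funext => i; have := y0 i (mem_index_enum _); rewrite /= subr_eq0 => /eqP.
move=> /esym/cos_twopi_eq1 yi; rewrite -[LHS]angleK yi ?raddf0//.
by rewrite angle_ge0 angle_lt1.
Qed.

Lemma cos_angleD x y i : cos (twopi * angle ((x + y) i)) =
  cos (twopi * angle (x i) + twopi * angle (y i)).
Proof.
have /to_circle_eqP[z ->] :
    to_circle (angle ((x + y) i)) = to_circle (angle (x i) + angle (y i)).
  by rewrite angleK (raddfD (@to_circle R))/= !angleK.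
by rewrite mulrDr cosDint mulrDr.
Qed.

Lemma cos_angleN y i : cos (twopi * angle ((- y) i)) = cos (twopi * angle (y i)).
Proof.
have /to_circle_eqP[z ->] :
    to_circle (angle ((- y) i)) = to_circle (- angle (y i)).
  by rewrite angleK (raddfN (@to_circle R))/= !angleK.
by rewrite mulrDr cosDint mulrN cosN.
Qed.

Lemma gaugeN y : gauge (- y) = gauge y.
Proof. by apply: eq_bigr => i _; rewrite cos_angleN. Qed.

(** The gauge is the squared Euclidean distance from 0 of the image of the
torus in the product of the unit circles, halved; the triangle inequality
survives squaring at the price of a factor 2. *)
Lemma gaugeD x y : gauge (x + y) <= 2 * gauge x + 2 * gauge y.
Proof.
rewrite /gauge !mulr_sumr -big_split/=; apply: ler_sum => i _.
rewrite cos_angleD cosD.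
have := cos2Dsin2 (twopi * angle (x i)); have := cos2Dsin2 (twopi * angle (y i)).
move: (cos _) (sin _) (cos (_ * angle (y i))) (sin (_ * angle (y i))).
move=> a b a' b' h' h.
(* with z = a + ib and w = a' + ib', twice the difference is |1 - 2z + zw|^2 *)
have : 0 <= (1 - 2 * a + (a * a' - b * b')) ^+ 2 +
            (- 2 * b + (a * b' + b * a')) ^+ 2.
  by rewrite addr_ge0// sqr_ge0.
have -> : (1 - 2 * a + (a * a' - b * b')) ^+ 2 +
    (- 2 * b + (a * b' + b * a')) ^+ 2 = 1 + 4 * (a ^+ 2 + b ^+ 2) +
    (a ^+ 2 + b ^+ 2) * (a' ^+ 2 + b' ^+ 2) - 4 * a +
    2 * (a * a' - b * b') - 4 * a' * (a ^+ 2 + b ^+ 2) by ring.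
by rewrite h h'; lra.
Qed.

Lemma gauge_continuous z : continuous (fun y => gauge (y - z)).
Proof.
apply: continuous_sum => i.
apply: continuous_add; first exact: cst_continuous.
apply: continuous_opp.
rewrite [X in continuous X](_ : _ = fun y =>
    cos (twopi * (1%:~R * angle (y i)) + twopi * angle ((- z) i))).
  move=> y; apply: (@continuous_comp _ _ _ (fun y : K => y i) (fun c =>
    cos (twopi * (1%:~R * angle c) + twopi * angle ((- z) i)))).
    exact: coord_continuous.
  exact: cos_angle_continuous.
by apply/funext => y; rewrite cos_angleD mul1r.
Qed.

(** The gauge is continuous and vanishes only at 0, so by compactness its
translates define the topology. *)
Lemma nbhs_torusP z (U : set K) :
  nbhs z U <-> exists2 e : R, 0 < e & forall y, gauge (y - z) < e -> U y.
Proof.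
split => [/nbhs_interior zU|[e e0 zU]].
  have cC : compact (~` U°).
    apply: (subclosed_compact _ compact_torus) => //.
    by apply: open_closedC; exact: open_interior.
  have [C0|/set0P Cn0] := eqVneq (~` U°) set0.
    exists 1 => // y _; apply: interior_subset; apply: contrapT => Uy.
    by have : (~` U°) y by []; rewrite C0.
  have [|c cU cmin] := @compact_EVT_min _ _ (fun y => gauge (y - z)) _ Cn0 cC.
    by apply: continuous_subspaceT; exact: gauge_continuous.
  exists (gauge (c - z)).
    rewrite lt_neqAle gauge_ge0 andbT eq_sym; apply/eqP => /gauge_eq0/eqP.
    rewrite subr_eq0 => /eqP cz; move: cU; rewrite inE/= cz; apply.
    exact: nbhs_singleton zU.
  move=> y yc; apply: interior_subset; apply: contrapT => Uy.
  by have := cmin y; rewrite inE => /(_ Uy); rewrite leNgt yc.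
have : \forall y \near z, gauge (y - z) < e.
  have zz : gauge (z - z) < e by rewrite subrr gauge0.
  exact: (@gauge_continuous z z _ (open_nbhs_nbhs (conj (@open_lt _ e) zz))).
by apply: filterS.
Qed.

Lemma open_gauge_lt z e : open [set y | gauge (y - z) < e].
Proof.
apply: (@open_comp _ _ (fun y => gauge (y - z)) [set t : R | t < e]).
  by move=> y _; exact: gauge_continuous.
exact: open_lt.
Qed.

Definition rational_point (q : {ffun 'I_d -> rat}) : K :=
  fun i => to_circle (ratr (q i)).

Lemma rational_point_dense z (e : R) : 0 < e ->
  exists q, gauge (z - rational_point q) < e.
Proof.
move=> e0; have [D D0 Dcos] : exists2 D : R, 0 < D &
    forall t, `|t| < D -> 1 - cos (twopi * t) < e / d.+1%:R.
  have c : continuous (fun t : R => 1 - cos (twopi * t)).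
    apply: continuous_add; first exact: cst_continuous.
    apply: continuous_opp => t; apply: (@continuous_comp _ _ _ ( *%R twopi)).
      exact: mulrl_continuous.
    exact: continuous_cos.
  have c0 : 1 - cos (twopi * 0) < e / d.+1%:R.
    by rewrite mulr0 cos0 subrr divr_gt0.
  have /nbhs_ballP[D /= D0 DP] :=
    c 0 _ (open_nbhs_nbhs (conj (@open_lt _ (e / d.+1%:R)) c0)).
  by exists D => // t tD; apply: DP; rewrite /ball/= sub0r normrN.
have /choice[q qP] : forall i, exists q : rat, `|angle (z i) - ratr q| < D.
  move=> i; have [|q] := @rat_in_itvoo _ (angle (z i) - D) (angle (z i) + D).
    by lra.
  rewrite in_itv/= => qP; exists q; rewrite ltr_norml; lra.
exists [ffun i => q i].
apply: (@le_lt_trans _ _ (\sum_(i < d) e / d.+1%:R)).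
  apply: ler_sum => i _; rewrite ltW//; apply: le_lt_trans (Dcos _ (qP i)).
  rewrite lerD2l lerN2.
  have /to_circle_eqP[m ->] : to_circle (angle ((z - rational_point [ffun i => q i]) i)) =
      to_circle (angle (z i) - ratr (q i)).
    rewrite angleK (raddfB (@to_circle R))/= angleK.
    by congr (_ - _); rewrite /rational_point ffunE.
  by rewrite [X in _ <= cos X]mulrDr cosDint.
rewrite sumr_const card_ord -[X in X < _]mulr_natr mulrAC ltr_pdivrMr//.
by rewrite ltr_pM2l// ltr_nat.
Qed.

(** The torus being second countable, the measurability of a map into it is a
matter of preimages of gauge balls. *)
Lemma open_torusE (V : set K) : open V -> V =
  \bigcup_(p in [set p : {ffun 'I_d -> rat} * nat |
     [set y | gauge (y - rational_point p.1) < p.2.+1%:R^-1] `<=` V])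
    [set y | gauge (y - rational_point p.1) < p.2.+1%:R^-1].
Proof.
move=> oV; apply/seteqP; split => [z Vz|z [p /= pV pz]]; last exact: pV.
have /nbhs_torusP[e e0 eV] : nbhs z V by exact: open_nbhs_nbhs.
have e40 : 0 < e / 4 by rewrite divr_gt0.
have [n ne] : exists n : nat, n.+1%:R^-1 < e / 4.
  have [n _ nP] := near_infty_natSinv_lt (PosNum e40).
  by exists n; exact: (nP n (leqnn n)).
have n0 : 0 < n.+1%:R^-1 :> R by rewrite invr_gt0.
have [q zq] := rational_point_dense z n0.
exists (q, n) => //= y /= yq; apply: eV.
rewrite -(subrKA (rational_point q)); apply: (le_lt_trans (gaugeD _ _)).
rewrite -gaugeN opprB in zq.
by have h1 := lt_trans yq ne; have h2 := lt_trans zq ne; lra.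
Qed.

End Torus.

Section TorusMeasurable.
Variables (R : realType) (d : nat).
Local Notation twopi := (pi *+ 2 : R).
Local Notation K := (torus R d).
Implicit Types (x y z : K) (k : 'I_d -> int).

Lemma open_measurable_torus (V : set K) : open V -> measurable V.
Proof. exact: sub_sigma_algebra. Qed.

Lemma closed_measurable_torus (V : set K) : closed V -> measurable V.
Proof.
by move=> cV; rewrite -(setCK V); apply: measurableC;
   apply: open_measurable_torus; exact: closed_openC.
Qed.

Lemma measurable_fun_lower dX (X : measurableType dX) (f : X -> R) :
  (forall t, measurable [set x | t < f x]) -> measurable_fun setT f.
Proof.
move=> mf; apply: (measurability _ (RGenOInfty.measurableE R)).
move=> _ [_ [t ->] <-]; rewrite setTI.
rewrite (_ : _ @^-1` _ = [set x | t < f x])//.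
by apply/seteqP; split => w /=; rewrite in_itv/= andbT.
Qed.

Lemma continuous_measurable_torus (f : K -> R) :
  continuous f -> measurable_fun setT f.
Proof.
move=> cf; apply: measurable_fun_lower => t; apply: open_measurable_torus.
by apply: (@open_comp _ _ f [set s : R | t < s]) => [y _|]; [exact: cf|exact: open_gt].
Qed.

Lemma measurable_wave k th : measurable_fun setT (@wave R d k th).
Proof. by apply: continuous_measurable_torus; exact: wave_continuous. Qed.

Lemma measurable_bigcup_countable (J : countType) dX (X : measurableType dX)
    (D : set J) (F : J -> set X) : (forall j, D j -> measurable (F j)) ->
  measurable (\bigcup_(j in D) F j).
Proof.
move=> mF; have [->|/set0P[j0 Dj0]] := eqVneq D set0.
  by rewrite bigcup_set0.
rewrite (_ : \bigcup_(j in D) F j = \bigcup_(n : nat)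
    (if unpickle n is Some j then (if j \in D then F j else set0) else set0)).
  apply: bigcup_measurable => n _; case: unpickle => // j.
  by case: ifPn => //; rewrite inE => /mF.
apply/seteqP; split => [w [j Dj Fjw]|w [n _]].
  by exists (pickle j) => //; rewrite pickleK mem_set.
by case: unpickle => // j; case: ifPn => // /set_mem Dj Fjw; exists j.
Qed.

(** A gauge ball is defined by a sum of cosines of coordinates. *)
Lemma measurable_fun_torus dX (X : measurableType dX) (g : X -> K) :
    (forall i th, measurable_fun setT
      (fun w => cos (twopi * angle (g w i) + th))) ->
  measurable_fun setT g.
Proof.
move=> mg; apply: (@measurability _ _ _ _ setT g (@open K)) => //.
move=> _ [V oV <-]; rewrite setTI (open_torusE oV) preimage_bigcup.
apply: measurable_bigcup_countable => -[q n] /= _.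
rewrite [X in measurable X](_ : _ = setT `&` [set w |
    gauge (g w - rational_point R q) < n.+1%:R^-1]); last by rewrite setTI.
apply: measurable_fun_ltr => //.
rewrite /gauge; apply: measurable_sum => i.
apply: measurable_funB => //.
under eq_fun do rewrite cos_angleD.
exact: mg.
Qed.

(** The angle is not continuous, but its sublevel sets are open away from the
points where it vanishes. *)
Lemma measurable_angle i : measurable_fun setT (fun y : K => angle (y i)).
Proof.
have m t : t <= 1 -> measurable [set y : K | 0 < angle (y i) < t].
  move=> t1; apply: open_measurable_torus.
  apply: (@open_comp _ _ (fun y : K => y i) [set c | 0 < angle c < t]).
    by move=> y _; exact: coord_continuous.
  exact: open_angle_lt.
have m0 : measurable [set y : K | angle (y i) <= 0].
  rewrite [X in measurable X](_ : _ = ~` [set y : K | 0 < angle (y i) < 1]).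
    by apply: measurableC; exact: m.
  apply/seteqP; split => y /=; rewrite angle_lt1 andbT leNgt; first by move/negP.
  by move/negP.
apply: measurable_fun_lower => t.
have [t1|t1] := leP 1 t.
  rewrite [X in measurable X](_ : _ = set0)//; apply/seteqP; split => // y /=.
  by rewrite ltNge (le_trans _ t1)// ltW// angle_lt1.
have [t0|t0] := ltP t 0.
  rewrite [X in measurable X](_ : _ = setT)//; apply/seteqP; split => // y _ /=.
  exact: lt_le_trans (angle_ge0 _).
rewrite [X in measurable X](_ : _ = ~` [set y : K | angle (y i) <= t]); last first.
  by apply/seteqP; split => y /=; rewrite ltNge => /negP.
apply: measurableC.
rewrite [X in measurable X](_ : _ = [set y : K | angle (y i) <= 0] `|`
   \bigcap_(n : nat) [set y : K | 0 < angle (y i) < Num.min 1 (t + n.+1%:R^-1)]).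
  apply: measurableU => //; apply: bigcap_measurable => // n _.
  by apply: m; rewrite ge_min lexx.
apply/seteqP; split => y /=.
  move=> yt; have [y0|y0] := leP (angle (y i)) 0; first by left.
  right => n _ /=; rewrite y0 lt_min angle_lt1/= (le_lt_trans yt)//.
  by rewrite ltrDl invr_gt0.
move=> [y0|yt]; first exact: le_trans t0.
rewrite leNgt; apply/negP => ty.
have ty0 : 0 < angle (y i) - t by rewrite subr_gt0.
have [n _ nP] := near_infty_natSinv_lt (PosNum ty0).
have := nP n (leqnn n); have := yt n I; rewrite /= lt_min => /and3P[_ _].
by rewrite ltrBrDl => /lt_trans h /h; rewrite ltxx.
Qed.

Lemma measurable_to_circle dX (X : measurableType dX) (t : 'I_d -> X -> R) :
    (forall i, measurable_fun setT (t i)) ->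
  measurable_fun setT (fun w => (fun i => to_circle (t i w)) : K).
Proof.
move=> mt; apply: measurable_fun_torus => i th.
rewrite [X in measurable_fun _ X](_ : _ = fun w => cos (twopi * t i w + th)).
  apply: (measurableT_comp (f := cos)).
    by apply: continuous_measurable_fun; exact: continuous_cos.
  by apply: measurable_funD => //; apply: measurable_funM.
apply/funext => w; have [z ->] := to_circleK (t i w).
by rewrite mulrDr addrAC cosDint.
Qed.

Lemma measurable_torus_add dX (X : measurableType dX) (g h : X -> K) :
  measurable_fun setT g -> measurable_fun setT h ->
  measurable_fun setT (fun w => g w + h w).
Proof.
move=> mg mh; rewrite (_ : (fun w => _) =
    fun w => (fun i => to_circle (angle (g w i) + angle (h w i))) : K).
  apply: measurable_to_circle => i; apply: measurable_funD.
    exact: measurableT_comp (measurable_angle i) mg.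
  exact: measurableT_comp (measurable_angle i) mh.
by apply/funext => w; apply/funext => i; rewrite (raddfD (@to_circle R))/= !angleK.
Qed.

Lemma measurable_torus_opp dX (X : measurableType dX) (g : X -> K) :
  measurable_fun setT g -> measurable_fun setT (fun w => - g w).
Proof.
move=> mg; rewrite (_ : (fun w => _) =
    fun w => (fun i => to_circle (- angle (g w i))) : K).
  apply: measurable_to_circle => i; apply: measurable_funN.
  exact: measurableT_comp (measurable_angle i) mg.
by apply/funext => w; apply/funext => i; rewrite (raddfN (@to_circle R))/= !angleK.
Qed.

Lemma measurable_gauge : measurable_fun setT (@gauge R d).
Proof.
apply: continuous_measurable_torus; have := @gauge_continuous R d 0.
by under eq_fun do rewrite subr0.
Qed.

Lemma measurable_eq_torus dX (X : measurableType dX) (g h : X -> K) :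
  measurable_fun setT g -> measurable_fun setT h ->
  measurable [set w | g w = h w].
Proof.
move=> mg mh; rewrite [X in measurable X](_ : _ =
    setT `&` (fun w => gauge (g w - h w)) @^-1` [set 0]); last first.
  rewrite setTI; apply/seteqP; split => w /=.
    by move=> ->; rewrite subrr gauge0.
  by move=> /gauge_eq0/eqP; rewrite subr_eq0 => /eqP.
have mgh : measurable_fun setT (fun w => gauge (g w - h w)).
  apply: (measurableT_comp measurable_gauge).
  by apply: measurable_torus_add => //; exact: measurable_torus_opp.
exact: mgh.
Qed.

End TorusMeasurable.

(** * The Stone-Weierstrass theorem *)

(** Compactness as an induction principle. If the property failed for the whole
space, the complements of the sets that have it would form a proper filter
without cluster point. *)
Lemma compact_local_global (T : topologicalType) (Q : set T -> Prop) :
  compact [set: T] -> (forall A B, B `<=` A -> Q A -> Q B) -> Q set0 ->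
  (forall A B, Q A -> Q B -> Q (A `|` B)) ->
  (forall x : T, exists2 U, nbhs x U & Q U) -> Q setT.
Proof.
move=> cT Qsub Q0 QU Qloc; apply: contrapT => nQT.
pose F : set_system T := fun S => Q (~` S).
have FF : ProperFilter F.
  apply: Build_ProperFilter_ex.
    move=> S FS; apply: contrapT => /forallNP S0; apply: nQT.
    by apply: Qsub FS => x _ /=; exact: S0.
  split; first by rewrite /F setCT.
    by move=> P S FP FS; rewrite /F setCI; exact: QU.
  by move=> P S PS; rewrite /F; apply: Qsub; exact: subsetC.
have [|x [_ xF]] := cT F FF; first by rewrite /F setCT.
have [U xU QUx] := Qloc x.
have FU : F (~` U) by rewrite /F setCK.
by have [y [/= nUy Uy]] := xF _ _ FU xU.
Qed.

Lemma compact_bounded_fun (R : realType) (T : topologicalType) (f : T -> R) :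
  compact [set: T] -> continuous f -> exists B, forall x, `|f x| <= B.
Proof.
move=> cT cf.
suff [B fB] : exists B, forall x, setT x -> `|f x| <= B by exists B => x; exact: fB.
apply: (@compact_local_global T (fun S => exists B, forall x, S x -> `|f x| <= B)) => //.
- by move=> A B BA [b bA]; exists b => x /BA; exact: bA.
- by exists 0.
- move=> A B [a aA] [b bB]; exists (Num.max a b) => x [/aA|/bB] h.
    by rewrite le_max h.
  by rewrite le_max h orbT.
- move=> x; exists [set y | `|f y| < `|f x| + 1]; last first.
    by exists (`|f x| + 1) => y /= /ltW.
  have h : `|f x| < `|f x| + 1 by rewrite ltrDl.
  exact: (@continuous_abs _ _ f cf x _ (open_nbhs_nbhs (conj (@open_lt _ _) h))).
Qed.

Section StoneWeierstrass.
Variables (R : realType) (T : topologicalType) (cT : compact [set: T]).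
Variable A : set (T -> R).
Hypothesis A_continuous : forall f, A f -> continuous f.
Hypothesis A_cst : forall c, A (cst c).
Hypothesis A_add : forall f g, A f -> A g -> A (fun x => f x + g x).
Hypothesis A_mul : forall f g, A f -> A g -> A (fun x => f x * g x).
Hypothesis A_sep : forall x y, x != y -> exists2 f, A f & f x != f y.

(** Iterating [p <- p + (t ^ 2 - p ^ 2) / 2] from 0 gives polynomials in [t]
that increase to |t| on [-1, 1], uniformly. *)
Fixpoint abs_approx (n : nat) (t : R) : R :=
  if n is m.+1 then
    abs_approx m t + (t ^+ 2 - abs_approx m t ^+ 2) / 2 else 0.

(** The last bound is an invariant of the iteration that makes the error at most
2 / n. *)
Lemma abs_approxP n t : `|t| <= 1 ->
  [/\ 0 <= abs_approx n t, abs_approx n t <= `|t| &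
      (`|t| - abs_approx n t) * (2 + n%:R * `|t|) <= 2 * `|t|].
Proof.
move=> t1; have t0 : 0 <= `|t| by [].
have tE : t ^+ 2 = `|t| ^+ 2 by rewrite real_normK// num_real.
elim: n => [|n [p0 pt pr]] /=.
  by rewrite subr0 mul0r addr0 mulrC; split.
move: tE t0 t1 p0 pt pr; move: (abs_approx n t) `|t| (t ^+ 2) => p x _ ->.
move=> x0 x1 p0 px; have n0 : 0 <= n%:R :> R by [].
have -> : n.+1%:R = n%:R + 1 :> R by rewrite natr1.
move: (n%:R : R) n0 => m m0 pr.
have E : x - (p + (x ^+ 2 - p ^+ 2) / 2) = (x - p) * (1 - (x + p) / 2).
  by field.
split.
- by rewrite addr_ge0// divr_ge0// subr_ge0 ler_sqr.
- by rewrite -subr_ge0 E mulr_ge0//; lra.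
rewrite E; apply: le_trans pr; rewrite -mulrA ler_wpM2l ?subr_ge0//.
have h1 : (1 - (x + p) / 2) * (2 + (m + 1) * x) <= (1 - x / 2) * (2 + (m + 1) * x).
  by rewrite ler_wpM2r//; nra.
apply: (le_trans h1); nra.
Qed.

Lemma abs_approx_closed n f : A f -> A (fun x => abs_approx n (f x)).
Proof.
move=> Af; elim: n => [|n IH] /=; first exact: A_cst.
apply: A_add => //; apply: A_mul; last exact: A_cst.
apply: A_add; first exact: A_mul.
rewrite (_ : (fun x => _) = fun x =>
  (cst (-1) x : R) * (abs_approx n (f x) * abs_approx n (f x))).
  by apply: A_mul; [exact: A_cst|exact: A_mul].
by apply/funext => x /=; rewrite mulN1r.
Qed.

Lemma approx_abs f (e : R) : A f -> 0 < e ->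
  exists2 g, A g & forall x, `|g x - `|f x| | < e.
Proof.
move=> Af e0; have [B0 B0P] := compact_bounded_fun cT (A_continuous Af).
pose B : R := `|B0| + 1.
have B_gt0 : 0 < B by rewrite /B ltr_pwDr.
have BP x : `|f x / B| <= 1.
  rewrite normrM normfV (gtr0_norm B_gt0) ler_pdivrMr// mul1r.
  by rewrite (le_trans (B0P x))// (le_trans (ler_norm _))// lerDl.
have [n nP] : exists n : nat, 2 * B < e * n%:R.
  exists (Num.bound (2 * B / e)).
  by rewrite [e * _]mulrC -ltr_pdivrMr// archi_boundP// divr_ge0 ?mulr_ge0// ltW.
exists (fun x => cst B x * abs_approx n (f x * B^-1)).
  apply: A_mul; first exact: A_cst.
  by apply: (abs_approx_closed n (f := fun x => f x * B^-1)); apply: A_mul => //; exact: A_cst.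
move=> x /=; have [p0 px pr] := abs_approxP n (BP x).
have -> : `|f x| = B * `|f x / B|.
  by rewrite normrM normfV (gtr0_norm B_gt0) mulrCA divff ?mulr1// gt_eqF.
rewrite -mulrBr normrM (gtr0_norm B_gt0) distrC ger0_norm ?subr_ge0//.
move: p0 px pr; move: (abs_approx _ _) `|f x / B| (normr_ge0 (f x / B)) => p t t0 p0 pt pr.
have [tz|tn0] := eqVneq t 0; first by rewrite (_ : t - p = 0) ?mulr0//; lra.
have tgt0 : 0 < t by rewrite lt_neqAle eq_sym tn0.
have h : (t - p) * n%:R <= 2.
  have : (t - p) * n%:R * t <= 2 * t.
    apply: le_trans pr; rewrite -mulrA ler_wpM2l ?subr_ge0//; lra.
  by rewrite ler_pM2r.
have n0 : 0 < n%:R :> R.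
  have : 0 < e * n%:R by apply: lt_trans nP; rewrite mulr_gt0.
  by rewrite pmulr_rgt0.
rewrite -(ltr_pM2r n0); apply: le_lt_trans nP; rewrite -mulrA mulrC.
by rewrite ler_pM2r.
Qed.

Lemma approx_max f g (e : R) : A f -> A g -> 0 < e ->
  exists2 h, A h & forall x, `|h x - Num.max (f x) (g x)| < e.
Proof.
move=> Af Ag e0; have Afg : A (fun x => f x + (cst (-1) x * g x)).
  by apply: A_add => //; apply: A_mul => //; exact: A_cst.
have [h Ah hP] := approx_abs Afg e0.
exists (fun x => (f x + g x + h x) * cst 2^-1 x).
  by apply: A_mul; [apply: A_add => //; exact: A_add|exact: A_cst].
move=> x /=; have := hP x; rewrite /= mulN1r !ltr_norml.
have [fg|fg] := leP (f x) (g x).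
  by rewrite ler0_norm ?subr_le0//; lra.
by rewrite gtr0_norm ?subr_gt0//; lra.
Qed.

Lemma approx_min f g (e : R) : A f -> A g -> 0 < e ->
  exists2 h, A h & forall x, `|h x - Num.min (f x) (g x)| < e.
Proof.
move=> Af Ag e0.
have AN f' : A f' -> A (fun x => cst (-1) x * f' x).
  by move=> Af'; apply: A_mul => //; exact: A_cst.
have [h Ah hP] := approx_max (AN _ Af) (AN _ Ag) e0.
exists (fun x => cst (-1) x * h x); first exact: AN.
move=> x; have := hP x; rewrite /= !mulN1r -oppr_min opprK -normrN.
by rewrite opprD.
Qed.

Lemma interpolation x y a b : x != y ->
  exists2 g, A g & g x = a /\ g y = b.
Proof.
move=> /A_sep[f Af fxy]; have fxy0 : f x - f y != 0 by rewrite subr_eq0.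
exists (fun z => cst (f x - f y)^-1 z *
  ((f z + cst (- f y) z) * cst a z + (cst (f x) z + cst (-1) z * f z) * cst b z)).
  apply: A_mul; first exact: A_cst.
  apply: A_add; apply: A_mul; (try exact: A_cst); apply: A_add => //; (try exact: A_cst).
  by apply: A_mul => //; exact: A_cst.
by split => /=; rewrite mulN1r subrr ?mul0r ?addr0 ?add0r mulrA mulVf// mul1r.
Qed.

Let closure_A h := forall e : R, 0 < e ->
  exists2 g, A g & forall x, `|g x - h x| < e.

Let closure_A_sub g : A g -> closure_A g.
Proof. by move=> Ag e e0; exists g => // x; rewrite subrr normr0. Qed.

Let closure_A_max h1 h2 : closure_A h1 -> closure_A h2 ->
  closure_A (fun x => Num.max (h1 x) (h2 x)).
Proof.
move=> c1 c2 e e0; have e20 : 0 < e / 2 by rewrite divr_gt0.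
have [g1 A1 P1] := c1 _ e20; have [g2 A2 P2] := c2 _ e20.
have [g Ag gP] := approx_max A1 A2 e20; exists g => // x.
have := P1 x; have := P2 x; have := gP x; rewrite !ltr_norml.
by have [?|?] := leP (g1 x) (g2 x); have [?|?] := leP (h1 x) (h2 x); lra.
Qed.

Let closure_A_min h1 h2 : closure_A h1 -> closure_A h2 ->
  closure_A (fun x => Num.min (h1 x) (h2 x)).
Proof.
move=> c1 c2 e e0; have e20 : 0 < e / 2 by rewrite divr_gt0.
have [g1 A1 P1] := c1 _ e20; have [g2 A2 P2] := c2 _ e20.
have [g Ag gP] := approx_min A1 A2 e20; exists g => // x.
have := P1 x; have := P2 x; have := gP x; rewrite !ltr_norml.
by have [?|?] := leP (g1 x) (g2 x); have [?|?] := leP (h1 x) (h2 x); lra.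
Qed.

(** Compactness is used twice: finitely many interpolating functions have a
maximum above [f - e] that agrees with [f] at a given point, and finitely many
of these maxima have a minimum close to [f]. *)
Theorem stone_weierstrass (f : T -> R) (e : R) : continuous f -> 0 < e ->
  exists2 g, A g & forall x, `|g x - f x| < e.
Proof.
move=> cf; have near_lt (u v : T -> R) (x : T) : continuous u -> continuous v -> u x < v x ->
    nbhs x [set y | u y < v y].
  move=> cu cv uv; have h : 0 < v x - u x by rewrite subr_gt0.
  have cvu := continuous_add cv (continuous_opp cu).
  have H : nbhs x [set y | 0 < v y - u y].
    exact: (cvu x _ (open_nbhs_nbhs (conj (@open_gt _ 0) h))).
  by apply: filterS H => y /=; rewrite subr_gt0.
have cD (u : T -> R) c : continuous u -> continuous (fun y => u y + c : R).
  by move=> cu; apply: continuous_add => //; exact: cst_continuous.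
(* a function above f - e everywhere and below f + e near x *)
have above x (e0 : R) : 0 < e0 ->
    exists2 g, A g & g x < f x + e0 /\ forall y, f y - e0 < g y.
  move=> e00; have e20 : 0 < e0 / 2 by rewrite divr_gt0.
  pose Q S := exists2 h, closure_A h &
    h x = f x /\ forall y, S y -> f y - e0 / 2 < h y.
  have [h Ah [hx hP]] : Q setT.
    apply: compact_local_global => //.
    - move=> B C CB [g Ag [gx gP]]; exists g => //; split => // y /CB.
      exact: gP.
    - by exists (cst (f x)); [exact/closure_A_sub/A_cst|].
    - move=> B C [g Ag [gx gP]] [h Ah [hx hP]].
      exists (fun y => Num.max (g y) (h y)); first exact: closure_A_max.
      split => [|y]; first by rewrite gx hx maxxx.
      by rewrite lt_max => -[/gP|/hP] ->//; rewrite orbT.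
    - move=> y; have [g Ag [gx gy]] : exists2 g, A g & g x = f x /\ g y = f y.
        have [<-|xy] := eqVneq x y; last exact: interpolation.
        by exists (cst (f x)); [exact: A_cst|].
      exists [set z | f z - e0 / 2 < g z].
        by apply: near_lt; [exact: cD|exact: A_continuous|rewrite gy ltrBlDr ltrDl].
      by exists g; [exact: closure_A_sub|].
  have [g Ag gP] := Ah _ e20; exists g => //; split => [|y].
    by have := gP x; rewrite ltr_norml hx; lra.
  by have := gP y; have := hP y I; rewrite ltr_norml; lra.
move=> e0; have e20 : 0 < e / 2 by rewrite divr_gt0.
have [h Ah [hP hP']] : exists2 h, closure_A h & (forall y, f y - e / 2 < h y) /\
    forall y, setT y -> h y < f y + e / 2.
  apply: (@compact_local_global T (fun S => exists2 h, closure_A h &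
      (forall y, f y - e / 2 < h y) /\ forall y, S y -> h y < f y + e / 2)) => //.
  - move=> B C CB [g Ag [gx gP]]; exists g => //; split => // y /CB.
    exact: gP.
  - have [B BP] := compact_bounded_fun cT cf.
    exists (cst B); first exact/closure_A_sub/A_cst.
    by split => // y /=; rewrite ltrBlDr (le_lt_trans (ler_norm _))// (le_lt_trans (BP y))// ltrDl.
  - move=> B C [g Ag [gx gP]] [h Ah [hx hP]].
    exists (fun y => Num.min (g y) (h y)); first exact: closure_A_min.
    split => [y|y]; first by rewrite lt_min gx hx.
    by rewrite gt_min => -[/gP|/hP] ->//; rewrite orbT.
  - move=> x; have [g Ag [gx gP]] := above x _ e20.
    exists [set z | g z < f z + e / 2].
      by apply: near_lt => //; [exact: A_continuous|exact: cD].
    by exists g; [exact: closure_A_sub|].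
have [g Ag gP] := Ah _ e20; exists g => // y.
by have := gP y; have := hP y; have := hP' y I; rewrite !ltr_norml; lra.
Qed.

End StoneWeierstrass.

(** * Conditional laws *)

Definition mfun_of dX (X : measurableType dX) dY (Y : measurableType dY)
    (f : X -> Y) (mf : measurable_fun setT f) : {mfun X >-> Y} :=
  HB.pack f (isMeasurableFun.Build _ _ _ _ f mf).

Lemma setX_preimage (X Y : Type) (A : set X) (B : set Y) :
  A `*` B = fst @^-1` A `&` snd @^-1` B.
Proof. by apply/seteqP; split => -[x y]. Qed.

Lemma measurable_fst_preimage dX (X : measurableType dX) dY
    (Y : measurableType dY) (A : set X) :
  measurable A -> measurable ((fst : X * Y -> X) @^-1` A).
Proof.
move=> mA; rewrite -[X in measurable X]setTI.
exact: (@measurable_fst _ _ X Y measurableT A mA).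
Qed.

Lemma measurable_snd_preimage dX (X : measurableType dX) dY
    (Y : measurableType dY) (A : set Y) :
  measurable A -> measurable ((snd : X * Y -> Y) @^-1` A).
Proof.
move=> mA; rewrite -[X in measurable X]setTI.
exact: (@measurable_snd _ _ X Y measurableT A mA).
Qed.

Lemma eq_rectangles dX (X : measurableType dX) dY (Y : measurableType dY)
    (R : realType) (m1 m2 : {measure set (X * Y) -> \bar R}) :
  (m1 setT < +oo)%E ->
  (forall A B, measurable A -> measurable B -> m1 (A `*` B) = m2 (A `*` B)) ->
  forall C, measurable C -> m1 C = m2 C.
Proof.
move=> m1y m12; apply: (measure_unique
  [set A `*` B | A in measurable & B in measurable] (fun=> setT)).
- exact: measurable_prod_measurableType.
- move=> _ _ [A mA [B mB <-]] [A' mA' [B' mB' <-]].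
  exists (A `&` A'); first exact: measurableI.
  by exists (B `&` B'); [exact: measurableI|rewrite setXI].
- by move=> _; exists setT => //; exists setT => //; rewrite setXTT.
- by rewrite bigcup_const.
- by move=> _ [A mA [B mB <-]]; exact: m12.
- by [].
Qed.

Lemma eq_half_line_rectangles dX (X : measurableType dX) (R : realType)
    (m1 m2 : {measure set (X * R) -> \bar R}) :
  (m1 setT < +oo)%E ->
  (forall A t, measurable A ->
    m1 (A `*` `]-oo, t[%classic) = m2 (A `*` `]-oo, t[%classic)) ->
  forall C, measurable C -> m1 C = m2 C.
Proof.
move=> m1y m12; apply: eq_rectangles => // A B mA mB.
have mA1 := @measurable_fst_preimage _ X _ R _ mA.
have ms := @measurable_snd _ _ X R.
rewrite setX_preimage setIC.
pose M1 : {measure set R -> \bar R} := pushforward (mrestr m1 mA1) snd.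
pose M2 : {measure set R -> \bar R} := pushforward (mrestr m2 mA1) snd.
suff : M1 ms B = M2 ms B by [].
apply: (measure_unique (@RGenInftyO.G R) (fun n => `]-oo, n%:R[%classic)) mB.
- exact: RGenInftyO.measurableE.
- move=> _ _ [a ->] [b ->]; exists (Num.min a b).
  by apply/seteqP; split => y /=; rewrite !in_itv/= lt_min => /andP.
- by move=> n; exists n%:R.
- apply/seteqP; split => // y _; exists (Num.bound `|y|) => //=.
  by rewrite in_itv/= (le_lt_trans (ler_norm _))// archi_boundP.
- by move=> _ [t ->]; have := m12 A t mA; rewrite setX_preimage setIC.
- move=> n; apply: le_lt_trans m1y; apply: le_measure; rewrite ?inE//.
  by apply: measurableI => //; exact: measurable_snd_preimage.
Qed.

Section Slice.
Context dX (X : measurableType dX) dY (Y : measurableType dY) (R : realType).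
Variables (nu : probability (X * Y)%type R) (B : set Y) (mB : measurable B).

Definition slice of measurable B := fun A : set X => nu (A `*` B).

Let slice0 : slice mB set0 = 0%E.
Proof. by rewrite /slice set0X measure0. Qed.

Let slice_ge0 A : (0 <= slice mB A)%E.
Proof. exact: measure_ge0. Qed.

Let slice_sigma_additive : semi_sigma_additive (slice mB).
Proof.
move=> F mF tF mUF; rewrite /slice.
have -> : (\bigcup_n F n) `*` B = \bigcup_n (F n `*` B).
  apply/seteqP; split => [[x y] [/= [n _ Fn] By]|[x y] [n _ [/= Fn By]]].
    by exists n.
  by split => //; exists n.
apply: (@measure_semi_sigma_additive _ _ _ nu (fun n => F n `*` B)).
- by move=> n; exact: measurableX.
- move=> m n _ _ [[x y] [[/= Fm _] [/= Fn _]]].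
  by apply: tF => //; exists x.
- by apply: bigcup_measurable => n _; exact: measurableX.
Qed.

HB.instance Definition _ := isMeasure.Build _ _ _ (slice mB)
  slice0 slice_ge0 slice_sigma_additive.

Let slice_finite : fin_num_fun (slice mB).
Proof.
move=> A mA; apply: fin_num_measure.
exact: measurableX.
Qed.

HB.instance Definition _ := Measure_isFinite.Build _ _ _ (slice mB) slice_finite.

End Slice.

Section Density.
Context dX (X : measurableType dX) (R : realType) (N : probability X R).
Local Open Scope ereal_scope.

Lemma ae_le_of_integral (g1 g2 : X -> R) :
  N.-integrable setT (EFin \o g1) -> N.-integrable setT (EFin \o g2) ->
  (forall B, measurable B ->
    \int[N]_(x in B) (g1 x)%:E <= \int[N]_(x in B) (g2 x)%:E) ->
  {ae N, forall x, (g1 x <= g2 x)%R}.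
Proof.
move=> i1 i2 h; pose B := [set x | (g2 x < g1 x)%R].
have m1 : measurable_fun setT g1 by apply/measurable_EFinP; exact: measurable_int i1.
have m2 : measurable_fun setT g2 by apply/measurable_EFinP; exact: measurable_int i2.
have mB : measurable B.
  by rewrite -[B]setTI; exact: (measurable_fun_ltr m2 m1 measurableT (Y := [set true])).
have iB1 := integrableS measurableT mB (@subsetT _ B) i1.
have iB2 := integrableS measurableT mB (@subsetT _ B) i2.
have : \int[N]_(x in B) abse (g1 x - g2 x)%:E = 0.
  apply/eqP; rewrite eq_le integral_ge0// andbT.
  rewrite (eq_integral (fun x => (g1 x)%:E - (g2 x)%:E)); last first.
    by move=> x; rewrite inE /B/= => Bx; rewrite ger0_norm// subr_ge0 ltW.
  rewrite (integralB mB iB1 iB2) sube_le0; exact: h.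
have mB12 : measurable_fun B (fun x => (g1 x - g2 x)%:E).
  apply/measurable_EFinP; apply: measurable_funTS.
  exact: measurable_funB.
move=> /(ae_eq_integral_abs _ mB mB12); apply: filterS => x xB.
rewrite leNgt; apply/negP => gx.
by have := xB gx; move=> [] /eqP; rewrite subr_eq0 => /eqP gx'; rewrite gx' ltxx in gx.
Qed.

(** Conditional probabilities: the Radon-Nikodym derivative of a measure
dominated by [N] setwise, taken with values in [0, 1]. *)
Lemma density_exists (nu : {finite_measure set X -> \bar R}) :
  (forall A, measurable A -> nu A <= N A) ->
  exists g : X -> R, [/\ measurable_fun setT g, (forall x, 0 <= g x <= 1)%R &
    forall A, measurable A -> nu A = \int[N]_(x in A) (g x)%:E].
Proof.
move=> nuN.
have dom : nu `<< N.
  apply/null_content_dominatesP => A mA NA0; apply/eqP.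
  by rewrite eq_le measure_ge0 andbT -NA0; exact: nuN.
pose h := Radon_Nikodym_SigmaFinite.f nu N.
have h0 := Radon_Nikodym_SigmaFinite.f_ge0 dom.
have hfin := Radon_Nikodym_SigmaFinite.f_fin_num dom.
have hint := Radon_Nikodym_SigmaFinite.f_integrable dom.
have hI := Radon_Nikodym_SigmaFinite.f_integral dom.
pose g x := fine (h x).
have hE x : h x = (g x)%:E by rewrite /g fineK// hfin.
have hEf : h = EFin \o g by apply/funext => x; exact: hE.
have ig : N.-integrable setT (EFin \o g) by rewrite -hEf.
have mg : measurable_fun setT g by apply/measurable_EFinP; exact: measurable_int ig.
have g0 x : (0 <= g x)%R by rewrite -lee_fin -hE.
have i1 : N.-integrable setT (EFin \o (cst 1%R : X -> R)).
  exact: finite_measure_integrable_cst.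
have g1 : {ae N, forall x, (g x <= 1)%R}.
  apply: (@ae_le_of_integral g (cst 1%R)) => // B mB.
  rewrite (_ : \int[N]_(x in B) _ = nu B); last first.
    by rewrite hI//; apply: eq_integral => x _; rewrite -hE.
  rewrite (_ : \int[N]_(x in B) _ = N B); first exact: nuN.
  by rewrite -[RHS]mul1e -integral_cst.
pose g' x := Num.min (g x) 1%R.
have mg' : measurable_fun setT g' by exact: measurable_minr.
exists g'; split => [//|x|A mA]; first by rewrite /g' le_min g0 ler01 ge_min lexx orbT.
rewrite hI//; apply: ge0_ae_eq_integral => //.
- by rewrite -/h hEf; apply/measurable_EFinP; exact: measurable_funTS.
- by apply/measurable_EFinP; exact: measurable_funTS.
- by move=> x _; rewrite lee_fin /g' le_min g0 ler01.
apply: filterS g1 => x gx _.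
by rewrite -/h hE /g' min_l.
Qed.

End Density.

Lemma measurable_idR (R : realType) :
  @measurable_fun _ _ (measurableTypeR R) R setT idfun.
Proof. by move=> _ Y mY; rewrite setTI. Qed.

(** The uniform law on [0, 1], as a law on the real line with its default
measurable structure. *)
Definition unit_law (R : realType) : probability R R :=
  distribution (uniform_prob (@ltr01 R))
    (mfun_of (@measurable_idR R)).

Section QuantileTransform.
Context dX (X : measurableType dX) (R : realType) (N : probability X R).
Variable nu : probability (X * R)%type R.
Hypothesis nuN : forall A, measurable A -> nu (A `*` setT) = N A.
Hypothesis nu01 : nu (setT `*` ~` `[0, 1[%classic) = 0%E.
Local Notation U := (unit_law R).

Lemma uniform_half_line (s : R) : 0 <= s <= 1 -> U `]-oo, s]%classic = s%:E.
Proof.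
move=> /andP[s0 s1]; rewrite [LHS]integral_uniform_pdf.
rewrite (_ : _ `&` _ = `[0, s]%classic); last first.
  apply/seteqP; split => u /=; rewrite !in_itv/=.
    by move=> [us /andP[u0 _]]; rewrite u0.
  by move=> /andP[u0 us]; rewrite u0 us (le_trans us).
rewrite (eq_integral (cst 1%E)); last first.
  move=> u; rewrite inE/= in_itv/= => /andP[u0 us].
  by rewrite /uniform_pdf u0 (le_trans us)//= subr0 invr1.
rewrite integral_cst//= mul1e lebesgue_measure_itv/= lte_fin.
case: ltP => [_|s0']; first by rewrite -EFinB subr0.
by congr EFin; apply/eqP; rewrite eq_le s0 s0'.
Qed.

Let q (n : nat) : R :=
  Num.min 1 (Num.max 0 (ratr (odflt 0 (unpickle n)))).

Let q01 n : 0 <= q n <= 1.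
Proof. by rewrite /q le_min ler01 le_max lexx ge_min lexx. Qed.

Let q_dense s t : 0 <= s -> s < t -> t <= 1 -> exists n, s < q n < t.
Proof.
move=> s0 st t1; have [r] := rat_in_itvoo st; rewrite in_itv/= => /andP[sr rt].
exists (pickle r); rewrite /q pickleK/= max_r ?(le_trans s0)// ?ltW//.
by rewrite min_r ?sr// ltW// (lt_le_trans rt).
Qed.

Let slice_le (B : set R) (mB : measurable B) A : measurable A ->
  (slice nu mB A <= N A)%E.
Proof.
move=> mA; rewrite /slice -nuN//; apply: le_measure; rewrite ?inE.
- exact: measurableX.
- exact: measurableX.
- by move=> [x y] [].
Qed.

(** If [G n x] is the conditional probability of ]-oo, q n] given [x], the
quantile [Q (x, u)] is the infimum of the thresholds [q n] with [u <= G n x].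
With countably many thresholds, conditional probabilities can be chosen one by
one and compared up to a null set. *)
Lemma quantile_transform : exists Q : X * R -> R, measurable_fun setT Q /\
  forall C, measurable C ->
    (N \x U)%E ((fun w => (w.1, Q w)) @^-1` C) = nu C.
Proof.
have mle (t : R) : measurable `]-oo, t]%classic by [].
have mlt (t : R) : measurable `]-oo, t[%classic by [].
have /choice[G GP] n := density_exists (slice_le (mle (q n))).
have /choice[H HP] t := density_exists (slice_le (mlt t)).
(* thresholds are at most 1, so the value 1 leaves the infimum unchanged *)
pose v n (w : X * R) := if w.2 <= G n w.1 then q n else 1.
pose Q w := inf (range (v ^~ w)).
have v0 n w : 0 <= v n w by rewrite /v; case: ifP => // _; case/andP: (q01 n).
have QltP w t : t <= 1 -> Q w < t <-> exists2 n, q n < t & w.2 <= G n w.1.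
  move=> t1; split.
    move=> /inf_lt[|_ [n _ <-]]; first by exists (v 0 w); exists 0%N.
    rewrite /v; case: ifP => [wn qt|_]; first by exists n.
    by rewrite ltNge t1.
  move=> [n qt wn]; apply: le_lt_trans qt.
  apply: ge_inf; first by exists 0 => _ [m _ <-].
  by exists n => //; rewrite /v wn.
have Q1 w : Q w <= 1.
  apply: (@le_trans _ _ (v 0 w)).
    by apply: ge_inf; [exists 0 => _ [m _ <-]|exists 0%N].
  by rewrite /v; case: ifP => // _; case/andP: (q01 0).
have mGn n : measurable [set w : X * R | w.2 <= G n w.1].
  rewrite -[X in measurable X]setTI.
  apply: (measurable_fun_ler _ _ measurableT (Y := [set true])) => //.
  by have [mG _ _] := GP n; exact: (measurableT_comp mG).
have mQt t : measurable [set w | Q w < t].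
  have [t1|t1] := leP t 1; last first.
    rewrite [X in measurable X](_ : _ = setT)//; apply/seteqP; split => // w _.
    exact: le_lt_trans (Q1 w) t1.
  rewrite [X in measurable X](_ : _ = \bigcup_(n in [set n | q n < t])
      [set w : X * R | w.2 <= G n w.1]).
    exact: bigcup_measurable.
  apply/seteqP; split => w /=.
    by move=> /(QltP _ _ t1)[n qt wn]; exists n.
  by move=> [n qt wn]; apply/(QltP _ _ t1); exists n.
have mQ : measurable_fun setT Q.
  apply: (measurability _ (RGenInftyO.measurableE R)).
  move=> _ [_ [t ->] <-]; rewrite setTI.
  by rewrite (_ : _ @^-1` _ = [set w | Q w < t]).
exists Q; split => //.
have mrect A : measurable A -> measurable (A `*` [set: R]).
  by move=> mA; exact: measurableX.
have Pfull A : measurable A -> (N \x U)%E (A `*` [set: R]) = N A.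
  move=> mA; transitivity (N A * U setT)%E; first exact: product_measure1E.
  have -> : U setT = 1%E by exact: probability_setT.
  by rewrite mule1.
have mgraph (g : X -> R) A : measurable A -> measurable_fun setT g ->
    measurable ((A `*` setT) `&` [set w : X * R | w.2 <= g w.1]).
  move=> mA mg; apply: measurableI; first exact: mrect.
  rewrite -[X in measurable X]setTI.
  apply: (measurable_fun_ler _ _ measurableT (Y := [set true])) => //.
  exact: (measurableT_comp mg).
have Pgraph (g : X -> R) A : measurable A -> measurable_fun setT g ->
    (forall x, 0 <= g x <= 1) ->
    (N \x U)%E ((A `*` setT) `&` [set w : X * R | w.2 <= g w.1]) =
    (\int[N]_(x in A) (g x)%:E)%E.
  move=> mA mg g01; rewrite /product_measure1 [RHS]integral_mkcond.
  apply: eq_integral => x _ /=; rewrite patchE.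
  case: ifPn => [|] xA.
    rewrite -[RHS](uniform_half_line (g01 x)) /=; congr (uniform_prob _ _).
    apply/seteqP; split => u /=; rewrite in_itv/= /xsection/= inE/=.
      by move=> [].
    by move=> ug; split => //; split => //; exact: set_mem.
  rewrite (_ : xsection _ _ = set0) ?preimage_set0 ?measure0//.
  apply/seteqP; split => // u; rewrite /xsection/= inE/= => -[[/= Ax]].
  by rewrite (mem_set Ax) in xA.
have mPlt A t : measurable A -> measurable ((A `*` setT) `&` [set w | Q w < t]).
  by move=> mA; apply: measurableI => //; exact: mrect.
have nu_out A (B : set R) : measurable A -> measurable B ->
    B `<=` ~` `[0, 1[%classic -> nu (A `*` B) = 0%E.
  move=> mA mB B01; apply/eqP; rewrite eq_le measure_ge0 andbT -nu01.
  apply: le_measure; rewrite ?inE.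
  - exact: measurableX.
  - by apply: measurableX => //; exact: measurableC.
  - by move=> [x y] [_ /B01].
have Plt A t : measurable A ->
    (N \x U)%E ((A `*` setT) `&` [set w | Q w < t]) = nu (A `*` `]-oo, t[%classic).
  move=> mA; have [t1|t1] := leP t 1; last first.
    rewrite (_ : [set w | Q w < t] = setT); last first.
      by apply/seteqP; split => // w _; exact: le_lt_trans (Q1 w) t1.
    rewrite setIT Pfull//.
    transitivity (nu (A `*` setT)); first by rewrite nuN.
    have -> : A `*` [set: R] = (A `*` `]-oo, t[%classic) `|` (A `*` `[t, +oo[%classic).
      apply/seteqP; split => -[x y] /=; rewrite !in_itv/=.
        by move=> [Ax _]; have [yt|yt] := ltP y t; [left|right].
      by move=> [[]|[]].
    rewrite measureU0//; first exact: measurableX.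
      exact: measurableX.
    apply: nu_out => // y /=; rewrite !in_itv/= andbT => ty /andP[_ y1].
    by have := lt_trans (lt_le_trans t1 ty) y1; rewrite ltxx.
  have [mH H01 HE] := HP t.
  apply/eqP; rewrite eq_le; apply/andP; split.
    (* where a version of a smaller conditional probability exceeds that of a
       larger one *)
    pose Z n := if q n < t then [set x | H t x < G n x] else set0.
    have mZ n : measurable (Z n).
      rewrite /Z; case: ifP => // _; rewrite -[X in measurable X]setTI.
      have [mG _ _] := GP n.
      exact: (measurable_fun_ltr mH mG measurableT (Y := [set true])).
    have Z0 n : N (Z n) = 0%E.
      rewrite /Z; case: ifPn => [qt|_]; last exact: measure0.
      apply: measure_negligible; first by have := mZ n; rewrite /Z qt.
      have [mG G01 GE] := GP n.
      have int01 (g : X -> R) : measurable_fun setT g ->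
          (forall x, 0 <= g x <= 1) -> N.-integrable setT (EFin \o g).
        move=> mg g01; apply: (@le_integrable _ _ _ N setT _ _ (EFin \o cst 1)) => //.
        - exact/measurable_EFinP.
        - move=> x _ /=; rewrite lee_fin normr1 ger0_norm; by case/andP: (g01 x).
        - exact: finite_measure_integrable_cst.
      have : {ae N, forall x, G n x <= H t x}.
        apply: ae_le_of_integral; [exact: int01|exact: int01|move=> B mB].
        rewrite -GE// -HE//; apply: le_measure; rewrite ?inE.
        - exact: measurableX.
        - exact: measurableX.
        - by move=> [x y] [/= Bx]; rewrite !in_itv/= => /le_lt_trans yt; split => //; exact: yt.
      apply: negligibleS => x /=; rewrite ltNge => /negP.
      by [].
    have sub : (A `*` setT) `&` [set w | Q w < t] `<=`
        ((A `*` setT) `&` [set w : X * R | w.2 <= H t w.1]) `|`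
        ((\bigcup_n Z n) `*` setT).
      move=> [x u] [[/= Ax _] /(QltP _ _ t1)[n qt /= un]].
      have [GH|HG] := leP (G n x) (H t x).
        by left; split => //=; exact: le_trans GH.
      by right; split => //; exists n => //; rewrite /Z qt.
    have mUZ : measurable (\bigcup_n Z n) by exact: bigcup_measurable.
    apply: (@le_trans _ _ ((N \x U)%E (((A `*` setT) `&`
        [set w : X * R | w.2 <= H t w.1]) `|` ((\bigcup_n Z n) `*` setT)))).
      apply: le_measure => //; rewrite inE; first exact: mPlt.
      by apply: measurableU; [exact: mgraph|exact: mrect].
    rewrite measureU0; [|exact: mgraph|exact: mrect|].
      rewrite [leLHS](_ : _ = \int[N]_(x in A) (H t x)%:E)%E; last exact: Pgraph.
      by rewrite -HE.
    rewrite [LHS](_ : _ = N (\bigcup_n Z n)); last exact: Pfull.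
    apply: measure_negligible => //; apply: negligible_bigcup => n.
    by exists (Z n); split => //; exact: Z0.
  have lower n : q n < t -> (nu (A `*` `]-oo, q n]%classic) <=
      (N \x U)%E ((A `*` setT) `&` [set w | (Q w < t)%R]))%E.
    move=> qt; have [mG G01 GE] := GP n.
    rewrite [leLHS](_ : _ = (N \x U)%E
        ((A `*` setT) `&` [set w : X * R | (w.2 <= G n w.1)%R])); last first.
      by apply: etrans (esym (Pgraph _ _ mA mG G01)); exact: GE.
    apply: le_measure; rewrite ?inE; [exact: mgraph|exact: mPlt|].
    move=> [x u] [/= Ax ug]; split => //=; apply/(QltP _ _ t1); by exists n.
  have [t0|t0] := leP t 0.
    rewrite nu_out// => y /=; rewrite !in_itv/= => yt /andP[y0 _].
    by have := lt_le_trans yt (le_trans t0 y0); rewrite ltxx.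
  pose F (m : nat) := A `*` `]-oo, t - m.+1%:R^-1]%classic.
  have mF m : measurable (F m) by exact: measurableX.
  have UF : A `*` `]-oo, t[%classic = \bigcup_m F m.
    apply/seteqP; split => [[x y] [/= Ax]|[x y] [m _ [/= Ax]]]; rewrite in_itv/= => yt.
      have h : 0 < t - y by rewrite subr_gt0.
      have [m _ mP] := near_infty_natSinv_lt (PosNum h).
      exists m => //; split => //=; rewrite in_itv/= lerBrDr -lerBrDl.
      exact: ltW (mP m (leqnn m)).
    by split => //=; rewrite in_itv/= (le_lt_trans yt)// ltrBlDr ltrDl invr_gt0.
  rewrite UF.
  have cvgF : nu (F m) @[m --> \oo] --> nu (\bigcup_m F m).
    apply: nondecreasing_cvg_mu => //; first exact: bigcup_measurable.
    move=> m m' mm'; apply/subsetPset => -[x y] [/= Ax]; rewrite in_itv/= => yt.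
    split => //=; rewrite in_itv/= (le_trans yt)// lerD2l lerN2.
    by rewrite lef_pV2 ?posrE// ler_nat.
  rewrite -(cvg_lim _ cvgF)//; apply: lime_le; first by apply/cvg_ex; eexists; exact: cvgF.
  apply: nearW => m.
  have [|||n /andP[sq qt]] := @q_dense (Num.max 0 (t - m.+1%:R^-1)) t.
  - by rewrite le_max lexx.
  - by rewrite gt_max t0/= ltrBlDr ltrDl invr_gt0.
  - exact: t1.
  apply: le_trans (lower n qt); apply: le_measure; rewrite ?inE.
  - exact: mF.
  - exact: measurableX.
  move=> [x y] [/= Ax]; rewrite in_itv/= => yt; split => //=; rewrite in_itv/=.
  by rewrite (le_trans yt)// ltW// (le_lt_trans _ sq)// le_max lexx orbT.
have mphi : measurable_fun setT (fun w : X * R => (w.1, Q w)).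
  by apply: measurable_fun_pair.
pose phi := mfun_of mphi.
pose P : {measure set (X * R) -> \bar R} := (N \x U)%E.
move=> C mC; rewrite -/(pushforward P phi C).
apply: eq_half_line_rectangles mC.
  change (P setT < +oo)%E.
  by rewrite -setXTT [ltLHS]Pfull// (le_lt_trans (probability_le1 _ _))// ltry.
move=> A t mA; apply: etrans (Plt A t mA); congr (P _).
by apply/seteqP; split => -[x u] /=; rewrite in_itv/=; tauto.
Qed.

End QuantileTransform.

Section ProbabilityProduct.
Context dX (X : measurableType dX) dY (Y : measurableType dY) (R : realType).
Variables (P1 : probability X R) (P2 : probability Y R).

Let prod_law_setT : (P1 \x P2)%E setT = 1%E.
Proof. by rewrite -setXTT product_measure1E//= !probability_setT mule1. Qed.

HB.instance Definition _ :=
  Measure_isProbability.Build _ _ _ (P1 \x P2)%E prod_law_setT.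

End ProbabilityProduct.

Lemma eq_law_integral dX (X : measurableType dX) (R : realType)
    (m1 m2 : {measure set X -> \bar R}) (f : X -> \bar R) :
  (forall A, measurable A -> m1 A = m2 A) ->
  (\int[m1]_x f x = \int[m2]_x f x)%E.
Proof. by move=> m12; apply: eq_measure_integral => A mA _; exact: m12. Qed.

Section TorusTransfer.
Context (R : realType) dI (I : measurableType dI) (L : probability I R).
Variable d : nat.
Local Notation K := (torus R d).
Variable mu : probability (I * K)%type R.
Hypothesis muL : forall A, measurable A -> mu (A `*` setT) = L A.

(** Coordinates that are not drawn yet are set to 0. *)
Let trunc (m : nat) (y : K) : K := fun i => if (i < m)%N then y i else 0.

Let update (m : nat) (y : K) (t : R) : K :=
  fun i => if i == m :> nat then to_circle t else y i.

Let measurable_trunc m : measurable_fun setT (trunc m).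
Proof.
rewrite (_ : trunc m = fun y => fun i =>
    to_circle (if (i < m)%N then angle (y i) else 0)).
  apply: measurable_to_circle => i.
  by case: (i < m)%N; [exact: measurable_angle|exact: measurable_cst].
by apply/funext => y; apply/funext => i; rewrite /trunc; case: ifP; rewrite ?angleK ?raddf0.
Qed.

Let measurable_update m : measurable_fun setT (fun w : K * R => update m w.1 w.2).
Proof.
rewrite (_ : (fun w => _) = fun w : K * R => fun i : 'I_d =>
    to_circle (if i == m :> nat then w.2 else angle (w.1 i))).
  apply: measurable_to_circle => i.
  case: (i == m :> nat); first exact: measurable_snd.
  exact: (measurableT_comp (measurable_angle i) measurable_fst).
by apply/funext => w; apply/funext => i; rewrite /update; case: ifP; rewrite ?angleK.
Qed.

(** The coordinates are drawn one after the other, each by the quantile transform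
given the base point and the previous coordinates, from a fresh uniform
variable. *)
Let transfer_upto m : exists (dW : measure_display) (W : measurableType dW)
  (P : probability W R) (Q : I * W -> K), measurable_fun setT Q /\
  forall C, measurable C ->
    (L \x P)%E ((fun w => (w.1, Q w)) @^-1` C) =
    mu ((fun w => (w.1, trunc m w.2)) @^-1` C).
Proof.
elim: m => [|m [dW [W [P [Q [mQ QE]]]]]].
  exists _, R, (unit_law R), (cst 0); split; first exact: measurable_cst.
  move=> C mC; pose B := [set x : I | C (x, 0 : K)].
  have mB : measurable B.
    rewrite -[B]setTI; have : measurable_fun setT (fun x : I => (x, 0 : K)).
      by apply: measurable_fun_pair.
    by move=> /(_ measurableT C mC).
  transitivity ((L \x unit_law R)%E (B `*` setT)).
    by congr (_ _); apply/seteqP; split => -[x u] //= -[].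
  transitivity (L B * unit_law R setT)%E; first exact: product_measure1E.
  rewrite probability_setT mule1 -muL//; congr (mu _).
  by apply/seteqP; split => -[x y] /=; [move=> []|].
have mphi : measurable_fun setT (fun w : I * W => (w.1, Q w)).
  by apply: measurable_fun_pair.
have mtr : measurable_fun setT (fun w : I * K => (w.1, trunc m w.2)).
  by apply: measurable_fun_pair => //; exact: measurableT_comp (measurable_trunc m) measurable_snd.
have mjoint : measurable_fun setT (fun w : I * K =>
    ((w.1, trunc m w.2), if insub m is Some i then angle (w.2 i) else 0 : R)).
  apply: measurable_fun_pair => //; case: insub => [i|]; last exact: measurable_cst.
  exact: (measurableT_comp (measurable_angle i) measurable_snd).
pose N : probability _ R := distribution mu (mfun_of mtr).
pose nu : probability _ R := distribution mu (mfun_of mjoint).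
have nuN A : measurable A -> nu (A `*` setT) = N A.
  move=> mA; congr (mu _); by apply/seteqP; split => -[x y] //= [].
have nu01 : nu (setT `*` ~` `[0, 1[%classic) = 0%E.
  rewrite -[RHS](measure0 mu); congr (mu _).
  apply/seteqP; split => // -[x y] /= [_]; rewrite in_itv/=.
  case: insub => [i|]; last by rewrite lexx ltr01.
  by rewrite angle_ge0 angle_lt1.
have [q [mq qE]] := quantile_transform nuN nu01.
pose Q' (w : I * (W * R)) := update m (Q (w.1, w.2.1)) (q ((w.1, Q (w.1, w.2.1)), w.2.2)).
have mQ1 : measurable_fun setT (fun w : I * (W * R) => Q (w.1, w.2.1)).
  apply: (measurableT_comp mQ); apply: measurable_fun_pair => //.
  exact: (measurableT_comp measurable_fst measurable_snd).
exists _, (W * R)%type, (P \x unit_law R)%E, Q'; split.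
  apply: (measurableT_comp (measurable_update m)
    (g := fun w => (Q (w.1, w.2.1), q ((w.1, Q (w.1, w.2.1)), w.2.2)))).
  apply: measurable_fun_pair => //; apply: (measurableT_comp mq).
  apply: measurable_fun_pair; first exact: measurable_fun_pair.
  exact: (measurableT_comp measurable_snd measurable_snd).
move=> C mC.
pose Psi (v : (I * K) * R) := (v.1.1, update m v.1.2 v.2).
have mPsi : measurable_fun setT Psi.
  apply: measurable_fun_pair; first exact: (measurableT_comp measurable_fst measurable_fst).
  apply: (measurableT_comp (measurable_update m) (g := fun v => (v.1.2, v.2))).
  by apply: measurable_fun_pair => //; exact: (measurableT_comp measurable_snd measurable_fst).
have updateE (y : K) : update m (trunc m y)
    (if insub m is Some i then angle (y i) else 0) = trunc m.+1 y.
  apply/funext => i; rewrite /update /trunc ltnS.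
  case: ltngtP => // im; rewrite -im (_ : insub _ = Some i) ?angleK//.
  exact: valK.
have mE : measurable ((fun v => (v.1, q v)) @^-1` (Psi @^-1` C)).
  have mq' : measurable_fun setT (fun v : (I * K) * R => (v.1, q v)).
    by apply: measurable_fun_pair.
  rewrite -[X in measurable X]setTI; apply: mq' => //.
  by rewrite -[X in measurable X]setTI; exact: mPsi.
transitivity (nu (Psi @^-1` C)); last first.
  congr (mu _); by apply/seteqP; split => -[x y] /=; rewrite /Psi/= updateE.
have mC' : measurable (Psi @^-1` C).
  by rewrite -[X in measurable X]setTI; exact: mPsi.
apply: etrans (qE _ mC'); rewrite /product_measure1.
pose g v := unit_law R (xsection ((fun v => (v.1, q v)) @^-1` (Psi @^-1` C)) v).
have mg : measurable_fun setT g.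
  exact: (measurable_fun_xsection (unit_law R) mE).
transitivity (\int[N]_v g v)%E; last by [].
transitivity (\int[distribution (L \x P)%E (mfun_of mphi)]_v g v)%E; last first.
  by apply: eq_law_integral => A mA; rewrite -[RHS]QE.
have g0 v : (0 <= g v)%E by exact: measure_ge0.
rewrite ge0_integral_pushforward//.
have FT := @fubini_tonelli1 _ _ _ _ _ L P (g \o (fun w => (w.1, Q w)))
  (measurableT_comp mg mphi) (fun w => g0 _).
rewrite preimage_setT [RHS]FT; apply: eq_integral => x _.
apply: eq_integral => w _; rewrite /g [LHS]/=.
congr (unit_law R _); apply/seteqP; split => u; rewrite /xsection/= !inE.
  by rewrite /xsection/= inE.
by rewrite /xsection/= inE.
Qed.

(** Fibers become laws of functions of an auxiliary random variable, so that
operations on fibers are operations on functions. *)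
Lemma torus_transfer : exists (dW : measure_display) (W : measurableType dW)
  (P : probability W R) (Q : I * W -> K), measurable_fun setT Q /\
  forall C, measurable C ->
    (L \x P)%E ((fun w => (w.1, Q w)) @^-1` C) = mu C.
Proof.
have [dW [W [P [Q [mQ QE]]]]] := transfer_upto d.
exists dW, W, P, Q; split => // C mC; rewrite QE//; congr (mu _).
have tE y : trunc d y = y by apply/funext => i; rewrite /trunc ltn_ord.
by apply/seteqP; split => -[x y] /=; rewrite tE.
Qed.

End TorusTransfer.

Section TransferKernel.
Context (R : realType) dI (I : measurableType dI) dW (W : measurableType dW)
  dY (Y : measurableType dY).
Variables (P : probability W R) (Q : I * W -> Y) (mQ : measurable_fun setT Q).

Let measurable_section x : measurable_fun setT (fun o => Q (x, o)).
Proof. exact: (measurableT_comp mQ (measurable_pair1 x)). Qed.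

Definition transfer_kernel (x : I) : {measure set Y -> \bar R} :=
  distribution P (mfun_of (measurable_section x)).

Let measurable_transfer_kernel U :
  measurable U -> measurable_fun setT (transfer_kernel ^~ U).
Proof.
move=> mU; have mQU : measurable (Q @^-1` U).
  by rewrite -[X in measurable X]setTI; exact: mQ.
rewrite (_ : (fun x => _) = P \o xsection (Q @^-1` U)).
  exact: measurable_fun_xsection.
apply/funext => x /=; congr (P _).
by apply/seteqP; split => o /=; rewrite /xsection/= inE.
Qed.

HB.instance Definition _ := isKernel.Build _ _ _ _ _ transfer_kernel
  measurable_transfer_kernel.

Let transfer_kernel_setT x : transfer_kernel x setT = 1%E.
Proof. exact: probability_setT. Qed.

HB.instance Definition _ := Kernel_isProbability.Build _ _ _ _ _
  transfer_kernel transfer_kernel_setT.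

End TransferKernel.

Section FiberedDisintegration.
Context (R : realType) dI (I : measurableType dI) (L : probability I R)
  (d : nat).
Local Notation K := (torus R d).

Lemma fibered_rect (mu : fibered L d) A :
  measurable A -> mu (A `*` setT) = L A.
Proof.
move=> mA; rewrite -(fibered_marginal mu mA); congr (fibered_prob mu _).
by apply/seteqP; split => -[x y] //= [].
Qed.

Lemma transfer_disintegration (mu : fibered L d) dW (W : measurableType dW)
    (P : probability W R) (Q : I * W -> K) (mQ : measurable_fun setT Q) :
  (forall C, measurable C ->
    (L \x P)%E ((fun w => (w.1, Q w)) @^-1` C) = mu C) ->
  disintegration mu (transfer_kernel P mQ).
Proof.
move=> QE F mF F0.
have mphi : measurable_fun setT (fun w : I * W => (w.1, Q w)).
  by apply: measurable_fun_pair.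
transitivity (\int[distribution (L \x P)%E (mfun_of mphi)]_z F z)%E.
  by apply: eq_law_integral => A mA; rewrite -[LHS]QE.
rewrite ge0_integral_pushforward// preimage_setT fubini_tonelli1//; last 2 first.
- exact: measurableT_comp mF mphi.
- by move=> w; exact: F0.
apply: eq_integral => x _; rewrite /fubini_F.
rewrite ge0_integral_pushforward//.
exact: measurableT_comp mF (measurable_pair1 x).
Qed.

End FiberedDisintegration.

(** * Fiberwise translation *)

(** All the fields of the structure are propositions. *)
Lemma probability_ext dT (T : measurableType dT) (R : realType)
    (P Q : probability T R) :
  (P : set T -> \bar R) = Q -> P = Q.
Proof.
move: P Q => [p cp] [q cq] /= pq; move: cq; rewrite -pq => cq {pq q}.
congr Probability.Pack.
case: cp cq => -[a1 a2] [a3] [a4] [a5] [a6] [a7] [a8].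
move=> [[b1 b2] [b3] [b4] [b5] [b6] [b7] [b8]].
have ? := Prop_irrelevance a1 b1; have ? := Prop_irrelevance a2 b2; subst b1 b2.
have ? := Prop_irrelevance a3 b3; have ? := Prop_irrelevance a4 b4.
have ? := Prop_irrelevance a5 b5; have ? := Prop_irrelevance a6 b6.
have ? := Prop_irrelevance a7 b7; have ? := Prop_irrelevance a8 b8.
by subst b3 b4 b5 b6 b7 b8.
Qed.

Section KernelLaw.
Context dX (X : measurableType dX) dY (Y : measurableType dY) (R : realType).
Variables (k : R.-pker X ~> Y) (x : X).

(** The value of a probability kernel is a measure only; this adds its mass. *)
Definition kernel_law : set Y -> \bar R := k x.

HB.instance Definition _ := Measure.on kernel_law.

Let kernel_law_setT : kernel_law setT = 1%E.
Proof. exact: prob_kernel. Qed.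

HB.instance Definition _ := Measure_isProbability.Build _ _ _ kernel_law
  kernel_law_setT.

End KernelLaw.

Section FiberwiseTranslation.
Context (R : realType) dI (I : measurableType dI) (L : probability I R)
  (d : nat).
Local Notation K := (torus R d).
Implicit Types mu nu rho : fibered L d.

Lemma fibered_ext mu nu :
  (forall C, measurable C -> mu C = nu C) -> mu = nu.
Proof.
move: mu nu => [m mM mN] [n nM nN] /= mn.
have ? : m = n.
  apply: probability_ext; apply/funext => C.
  by have [mC|nC] := pselect (measurable C); [exact: mn|rewrite mN// nN].
subst n; congr Fibered; exact: Prop_irrelevance.
Qed.

Lemma disintegrationE mu (k : R.-pker I ~> K) C : disintegration mu k ->
  measurable C -> mu C = (\int[L]_x k x (xsection C x))%E.
Proof.
move=> muk mC; have := muk (EFin \o \1_C).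
rewrite (_ : (\int[mu]_z (EFin \o \1_C) z)%E = mu C); last first.
  by rewrite integral_indic// setIT.
move=> ->; last 2 first.
- by apply/measurable_EFinP; exact: measurable_indic.
- by move=> z; rewrite lee_fin.
apply: eq_integral => x _.
rewrite -[X in k x X]setIT -integral_indic//; last exact: measurable_xsection.
by apply: eq_integral => y _; rewrite /= !indicE mem_xsection.
Qed.

Lemma integral_concentrated (m : {measure set K -> \bar R}) (a : K)
    (g : K -> \bar R) : m setT = 1%E ->
  m (~` [set a]) = 0%E -> measurable_fun setT g -> (forall y, 0 <= g y)%E ->
  (\int[m]_y g y = g a)%E.
Proof.
move=> mT ma mg g0; have m1 : measurable [set a].
  rewrite (_ : [set a] = [set y | idfun y = cst a y])//.
  by apply: measurable_eq_torus; [exact: measurable_id|exact: measurable_cst].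
rewrite (@ge0_ae_eq_integral _ _ _ m setT g (cst (g a)))//.
  by rewrite integral_cst//= mT mule1.
  by move=> y _; exact: g0.
exists (~` [set a]); split => //; first exact: measurableC.
by move=> y /= h ya; apply: h => _; rewrite ya.
Qed.

Variable f : {mfun I >-> K}.

Definition shift (z : I * K) : I * K := (z.1, z.2 + f z.1).

Lemma measurable_shift : measurable_fun setT shift.
Proof.
apply: measurable_fun_pair => //; apply: measurable_torus_add => //.
exact: measurableT_comp (measurable_funPT f) measurable_fst.
Qed.

(** A conditional law of a graph measure is almost surely the Dirac mass at the
value of the function, so the fiberwise convolution, if defined, translates
each fiber. *)
Lemma is_fiberwise_conv_graph mu rho C :
  is_fiberwise_conv (graph_measure L f) mu rho -> measurable C ->
  rho C = mu (shift @^-1` C).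
Proof.
move=> [kf [k [kr [kfP kP krP krE]]]] mC.
have mS : measurable (shift @^-1` C).
  by rewrite -[X in measurable X]setTI; exact: measurable_shift.
rewrite (disintegrationE krP mC) (disintegrationE kP mS).
pose G := [set z : I * K | z.2 = f z.1].
have mG : measurable G.
  apply: measurable_eq_torus => //.
  exact: measurableT_comp (measurable_funPT f) measurable_fst.
have kfG : {ae L, forall x, kf x (~` [set f x]) = 0%E}.
  have h : graph_measure L f (~` G) = 0%E.
    rewrite /graph_measure/= mtruncE; last exact: measurableC.
    rewrite /distribution /pushforward (_ : _ @^-1` _ = set0) ?measure0//.
    by apply/seteqP; split => // x /=; apply.
  have mk : measurable_fun setT (fun x => kf x (xsection (~` G) x)).
    by apply: measurable_fun_xsection_finite_kernel; apply: mem_set; exact: measurableC.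
  have : (\int[L]_x `|kf x (xsection (~` G) x)| = 0)%E.
    rewrite -[RHS]h (disintegrationE kfP (measurableC mG)).
    by apply: eq_integral => x _; rewrite gee0_abs.
  move=> /(ae_eq_integral_abs _ measurableT mk); apply: filterS => x /(_ Logic.I) /= <-.
  by congr (kf x _); apply/seteqP; split => y; rewrite /xsection/= inE.
apply: ge0_ae_eq_integral => //.
- exact/measurable_fun_xsection_finite_kernel/mem_set.
- exact/measurable_fun_xsection_finite_kernel/mem_set.
apply: filterS2 kfG krE => x kfx krx _.
rewrite krx; last exact: measurable_xsection.
rewrite /torus_conv /pushforward /product_measure1.
have mE : measurable ((fun z : K * K => z.1 + z.2) @^-1` xsection C x).
  rewrite -[X in measurable X]setTI.
  apply: (measurable_torus_add (measurable_fst) (measurable_snd)) => //.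
  exact: measurable_xsection.
rewrite (@integral_concentrated (kf x) (f x))//.
- congr (k x _); apply/seteqP; split => v; rewrite /xsection/= !inE/= /xsection/= inE.
    by rewrite addrC.
  by rewrite addrC.
- exact: prob_kernel.
- exact: (measurable_fun_xsection (kernel_law k x)).
Qed.

Let shift_law_marginal mu (A : set I) : measurable A ->
  pushforward (distribution mu (mfun_of measurable_shift)) fst A = L A.
Proof. by move=> mA; rewrite -(fibered_marginal mu mA). Qed.

Definition shift_fibered mu : fibered L d := fibered_of (@shift_law_marginal mu).

Lemma shift_fiberedE mu C : measurable C ->
  shift_fibered mu C = mu (shift @^-1` C).
Proof. by move=> mC; rewrite /shift_fibered/= mtruncE. Qed.

(** The fibers of [mu] are the laws of some [Q (x, w)] with [w] random, and those
of its translate are the laws of [Q (x, w) + f x]. *)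
Lemma is_fiberwise_conv_shift mu :
  is_fiberwise_conv (graph_measure L f) mu (shift_fibered mu).
Proof.
have [dW [W [P [Q [mQ QE]]]]] := torus_transfer (@fibered_rect _ _ _ _ _ mu).
have mf2 : measurable_fun setT (fun w : I * W => f w.1).
  exact: measurableT_comp (measurable_funPT f) measurable_fst.
have mQf := measurable_torus_add mQ mf2.
exists (transfer_kernel P mf2), (transfer_kernel P mQ), (transfer_kernel P mQf).
split.
- apply: transfer_disintegration => C mC.
  have mphi : measurable_fun setT (fun x : I => (x, f x)) by exact: measurable_fun_pair.
  have mC' : measurable ((fun x : I => (x, f x)) @^-1` C).
    by rewrite -[X in measurable X]setTI; exact: mphi.
  transitivity ((L \x P)%E (((fun x : I => (x, f x)) @^-1` C) `*` setT)).
    by congr (_ _); apply/seteqP; split => -[x w] //= -[].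
  transitivity (L ((fun x : I => (x, f x)) @^-1` C) * P setT)%E.
    exact: product_measure1E.
  have -> : P setT = 1%E by exact: probability_setT.
  by rewrite mule1 /graph_measure/= mtruncE.
- exact: transfer_disintegration.
- apply: transfer_disintegration => C mC.
  rewrite shift_fiberedE// -QE//.
  by rewrite -[X in measurable X]setTI; exact: measurable_shift.
- apply: aeW => x A mA; rewrite /torus_conv /pushforward /product_measure1.
  have mE : measurable ((fun z : K * K => z.1 + z.2) @^-1` A).
    rewrite -[X in measurable X]setTI.
    exact: (measurable_torus_add (measurable_fst) (measurable_snd)).
  rewrite (@integral_concentrated (transfer_kernel P mf2 x) (f x))//.
  + rewrite [LHS]/= [RHS]/=; congr (P _).
    by apply/seteqP; split => w; rewrite /xsection/= inE/= addrC.
  + exact: prob_kernel.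
  + rewrite -[RHS](measure0 P) [LHS]/=; congr (P _).
    by apply/seteqP; split => // w /=; apply.
  + exact: (measurable_fun_xsection (kernel_law (transfer_kernel P mQ) x)).
Qed.

Lemma fiberwise_conv_graph mu :
  fiberwise_conv (graph_measure L f) mu = shift_fibered mu.
Proof.
apply: fibered_ext => C mC; rewrite shift_fiberedE//.
apply: is_fiberwise_conv_graph => //; apply: xgetPex.
by exists (shift_fibered mu); exact: is_fiberwise_conv_shift.
Qed.

End FiberwiseTranslation.

(** * Continuous functions on the base times the torus *)

Section CompactMetrizable.
Context (R : realType) (J : topologicalType).
Hypothesis hJ : compact_metrizable R J.

(** The distances, cut off at 1, to the points of finite nets: the index [(n, m)]
stands for the m-th point of a net of mesh [n.+1%:R^-1]. *)
Lemma separating_family : exists phi : nat * nat -> J -> R,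
  [/\ forall p, continuous (phi p), forall p x, 0 <= phi p x <= 1,
      (forall x y, x != y -> exists p, phi p x != phi p y) &
      (forall (U : set J) x, open U -> U x -> exists p,
         phi p x < p.1.+1%:R^-1 /\
         forall y, phi p y < p.1.+1%:R^-1 -> U y)].
Proof.
have [cJ [M [h [ch [g [cg hK gK]]]]]] := hJ.
have cdist c : continuous (fun x => mdist (h x) (h c) : R).
  move=> x; apply/cvgrPdist_lt => e e0.
  have near_x : \forall t \near x, mdist (h x) (h t) < e.
    exact: ((metricType_numDomainType.cvgrPdist_lt h (h x)).1 (ch x) e e0).
  apply: filterS near_x => y xy; apply: le_lt_trans xy.
  have := metric_triangle (h x) (h y) (h c); have := metric_triangle (h y) (h x) (h c).
  by rewrite (metric_sym (h y) (h x)) ler_norml; lra.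
have net n : exists s : seq J, forall x, setT x ->
    exists2 c, c \in s & mdist (h x) (h c) < n.+1%:R^-1.
  apply: (@compact_local_global _ (fun S => exists s : seq J, forall x, S x ->
    exists2 c, c \in s & mdist (h x) (h c) < n.+1%:R^-1)) => //.
  - move=> A B BA [s sP]; exists s => x /BA; exact: sP.
  - by exists [::].
  - move=> A B [s sP] [t tP]; exists (s ++ t) => x [/sP|/tP] [c cs cx].
      by exists c => //; rewrite mem_cat cs.
    by exists c => //; rewrite mem_cat cs orbT.
  - move=> x; exists [set y | mdist (h y) (h x) < n.+1%:R^-1].
      have h0 : mdist (h x) (h x) < n.+1%:R^-1 :> R by rewrite mdistxx invr_gt0.
      exact: (cdist x x _ (open_nbhs_nbhs (conj (@open_lt _ _) h0))).
    by exists [:: x] => y /= yx; exists x => //; rewrite inE.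
have /choice[s sP] := net.
pose phi (p : nat * nat) (x : J) : R := if onth (s p.1) p.2 is Some c then
  Num.min 1 (mdist (h x) (h c)) else 0.
have phiP n x : exists p, exists c, [/\ p.1 = n, mdist (h x) (h c) < n.+1%:R^-1 :> R &
    phi p = fun y => Num.min 1 (mdist (h y) (h c))].
  have [c /onthP[m mc] xc] := sP n x Logic.I; exists (n, m), c; split => //.
  by apply/funext => y; rewrite /phi /= mc.
have inv_le1 n : n.+1%:R^-1 <= 1 :> R by rewrite invf_le1// ler1n.
exists phi; split.
- move=> p; rewrite /phi; case: onth => [c|]; last exact: cst_continuous.
  by apply: continuous_min; [exact: cst_continuous|exact: cdist].
- move=> p x; rewrite /phi; case: onth => [c|]; last by rewrite lexx ler01.
  by rewrite le_min ler01 mdist_ge0 ge_min lexx.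
- move=> x y xy.
  have r0 : 0 < mdist (h x) (h y) :> R.
    by rewrite mdist_gt0; apply: contra_neq xy; exact: (can_inj hK).
  pose r : R := Num.min 1 (mdist (h x) (h y)) / 2.
  have rgt0 : 0 < r by rewrite /r divr_gt0// lt_min ltr01.
  have [n _ nP] := near_infty_natSinv_lt (PosNum rgt0).
  have [p [c [_ xc phip]]] := phiP n x; exists p; rewrite phip.
  have := nP n (leqnn n); rewrite /= /r => nr.
  rewrite neq_lt; apply/orP; left; rewrite lt_min; apply/andP; split.
    by rewrite gt_min; apply/orP; right; rewrite (lt_le_trans xc).
  rewrite gt_min; apply/orP; right.
  have := metric_triangle (h x) (h c) (h y); rewrite (metric_sym (h c)).
  have : Num.min 1 (mdist (h x) (h y)) <= mdist (h x) (h y) :> R by rewrite ge_min lexx orbT.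
  by have h1 := lt_trans xc nr; lra.
- move=> U x oU Ux.
  have Ug : nbhs (h x) (g @^-1` U).
    by apply: cg; rewrite hK; exact: open_nbhs_nbhs.
  have /metricType_numDomainType.nbhs_mdistP[e /= e0 eU] := Ug.
  have e20 : 0 < e / 2 by rewrite divr_gt0.
  have [n _ nP] := near_infty_natSinv_lt (PosNum e20).
  have [p [c [pn xc phip]]] := phiP n x; exists p; rewrite phip pn; split.
    by rewrite gt_min xc orbT.
  move=> y; rewrite gt_min => /orP[|yc]; first by rewrite ltNge inv_le1.
  rewrite -(hK y); apply: eU => /=.
  have := metric_triangle (h x) (h c) (h y); rewrite (metric_sym (h c)).
  have := nP n (leqnn n); rewrite /= => nr.
  by have h1 := lt_trans xc nr; have h2 := lt_trans yc nr; lra.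
Qed.

End CompactMetrizable.

Section TrigonometricSums.
Context (R : realType) (J : topologicalType) (d : nat).
Local Notation K := (torus R d).
Local Notation twopi := (pi *+ 2 : R).
Variable phi : nat * nat -> J -> R.

Definition monomial (s : seq (nat * nat)) (x : J) : R := \prod_(p <- s) phi p x.

Definition trig_monomial s k th (z : J * K) : R :=
  monomial s z.1 * wave k th z.2.

(** An algebra of functions, generated as a linear span: linear statements need
only be checked on monomials. *)
Inductive trig_sum : (J * K -> R) -> Prop :=
| trig_sum_monomial s k th : trig_sum (trig_monomial s k th)
| trig_sum_scale c F : trig_sum F -> trig_sum (fun z => c * F z)
| trig_sum_add F G : trig_sum F -> trig_sum G -> trig_sum (fun z => F z + G z).

Lemma phaseDl k k' (y : K) : phase (fun i => k i + k' i) y = phase k y + phase k' y.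
Proof.
rewrite /phase -mulrDr -big_split/=; congr (_ * _).
by apply: eq_bigr => i _; rewrite intrD mulrDl.
Qed.

Lemma phaseNl k (y : K) : phase (fun i => - k i) y = - phase k y.
Proof.
rewrite /phase -mulrN; congr (_ * _); rewrite -sumrN.
by apply: eq_bigr => i _; rewrite mulrNz mulNr.
Qed.

Lemma phase0l (y : K) : phase (fun=> 0) y = 0.
Proof. by rewrite /phase big1 ?mulr0// => i _; rewrite mul0r. Qed.

Lemma waveM k th k' th' (y : K) : wave k th y * wave k' th' y =
  2^-1 * (wave (fun i => k i + k' i) (th + th') y +
          wave (fun i => k i - k' i) (th - th') y).
Proof.
rewrite /wave phaseDl (phaseDl k (fun i => - k' i)) phaseNl.
have -> : phase k y + phase k' y + (th + th') =
    (phase k y + th) + (phase k' y + th') by ring.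
have -> : phase k y - phase k' y + (th - th') =
    (phase k y + th) - (phase k' y + th') by ring.
by move: (phase k y + th) (phase k' y + th') => a b; rewrite cosD cosB; field.
Qed.

(** By the product-to-sum formula. *)
Lemma trig_sum_mul F G : trig_sum F -> trig_sum G ->
  trig_sum (fun z => F z * G z).
Proof.
elim=> {F} [s k th|c F tF IH|F1 F2 tF1 IH1 tF2 IH2] tG.
- elim: tG => {G} [s' k' th'|c G tG IH|G1 G2 tG1 IH1 tG2 IH2].
  + rewrite (_ : (fun z => _) = fun z =>
      2^-1 * (trig_monomial (s ++ s') (fun i => k i + k' i) (th + th') z +
              trig_monomial (s ++ s') (fun i => k i - k' i) (th - th') z)).
      by apply: trig_sum_scale; apply: trig_sum_add; exact: trig_sum_monomial.
    apply/funext => z; rewrite /trig_monomial mulrACA waveM /monomial big_cat/=.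
    by ring.
  + rewrite (_ : (fun z => _) = fun z => c * (trig_monomial s k th z * G z)).
      exact: trig_sum_scale.
    by apply/funext => z; rewrite mulrCA.
  + rewrite (_ : (fun z => _) = fun z => trig_monomial s k th z * G1 z +
      trig_monomial s k th z * G2 z); first exact: trig_sum_add.
    by apply/funext => z; rewrite mulrDr.
- rewrite (_ : (fun z => _) = fun z => c * (F z * G z)).
    by apply: trig_sum_scale; exact: IH.
  by apply/funext => z; rewrite mulrA.
- rewrite (_ : (fun z => _) = fun z => F1 z * G z + F2 z * G z).
    by apply: trig_sum_add; [exact: IH1|exact: IH2].
  by apply/funext => z; rewrite mulrDl.
Qed.

Lemma trig_sum_cst c : trig_sum (cst c).
Proof.
rewrite (_ : cst c = fun z => c * trig_monomial [::] (fun=> 0) 0 z).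
  by apply: trig_sum_scale; exact: trig_sum_monomial.
apply/funext => z; rewrite /trig_monomial /monomial big_nil /wave phase0l.
by rewrite addr0 cos0 !mulr1.
Qed.

Hypothesis cJ : compact [set: J].
Hypothesis phi_continuous : forall p, continuous (phi p).
Hypothesis phi_sep : forall x y, x != y -> exists p, phi p x != phi p y.

Lemma monomial_continuous s : continuous (monomial s).
Proof.
rewrite /monomial; elim: s => [|p s IH].
  by under eq_fun do rewrite big_nil; exact: cst_continuous.
by under eq_fun do rewrite big_cons; exact: continuous_mul.
Qed.

Lemma trig_sum_continuous F : trig_sum F -> continuous F.
Proof.
elim=> {F} [s k th|c F tF IH|F1 F2 tF1 IH1 tF2 IH2].
- apply: (@continuous_mul _ _ (fun z => monomial s z.1) (fun z => wave k th z.2)).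
    move=> z; apply: (@continuous_comp _ _ _ fst); first exact: cvg_fst.
    exact: monomial_continuous.
  move=> z; apply: (@continuous_comp _ _ _ snd); first exact: cvg_snd.
  exact: wave_continuous.
- by apply: continuous_mul => //; exact: cst_continuous.
- exact: continuous_add.
Qed.

Lemma trig_sum_separates z z' : z != z' -> exists2 F, trig_sum F & F z != F z'.
Proof.
case: z z' => [x y] [x' y'] zz'.
have [xx'|/phi_sep[p pxx']] := eqVneq x x'; last first.
  exists (trig_monomial [:: p] (fun=> 0) 0); first exact: trig_sum_monomial.
  by rewrite /trig_monomial /monomial !big_seq1 /wave !phase0l addr0 cos0 !mulr1.
have yy' : y - y' != 0.
  by rewrite subr_eq0; apply: contra_neq zz'; rewrite xx' => ->.
have [i yi] : exists i, cos (twopi * angle ((y - y') i)) != 1.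
  apply: contrapT => /forallNP h; move/eqP: yy'; apply; apply: gauge_eq0.
  by rewrite /gauge big1// => i _; have /negP/negPn/eqP -> := h i; rewrite subrr.
pose k j : int := (j == i)%:R.
have kE (w : K) : phase k w = twopi * angle (w i).
  rewrite /phase (bigD1 i)//= big1 ?addr0 ?/k ?eqxx ?mul1r// => j /negPf ->.
  by rewrite mul0r.
(* this wave is 1 at the second point but not at the first *)
exists (trig_monomial [::] k (- (twopi * angle (y' i)))).
  exact: trig_sum_monomial.
rewrite /trig_monomial /monomial !big_nil !mul1r /wave /= !kE subrr cos0.
suff <- : cos (twopi * angle ((y - y') i)) =
    cos (twopi * angle (y i) - twopi * angle (y' i)) by [].
have /to_circle_eqP[m ->] :
    to_circle (angle ((y - y') i)) = to_circle (angle (y i) - angle (y' i)).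
  by rewrite angleK (raddfB (@to_circle R))/= !angleK.
by rewrite mulrDr cosDint mulrBr.
Qed.

Lemma trig_sum_dense F e : continuous F -> 0 < e ->
  exists2 G, trig_sum G & forall z, `|G z - F z| < e.
Proof.
apply: stone_weierstrass.
- by rewrite -setXTT; apply: compact_setX => //; exact: compact_torus.
- exact: trig_sum_continuous.
- exact: trig_sum_cst.
- by move=> f g; exact: trig_sum_add.
- exact: trig_sum_mul.
- exact: trig_sum_separates.
Qed.

End TrigonometricSums.

(** * Means of bounded functions *)

Section BoundedMeasurable.
Context dX (X : measurableType dX) (R : realType).
Implicit Types f g : X -> R.

(** Such functions are integrable for every probability, so that the mean is
linear and monotone on them. *)
Definition bounded_measurable f :=
  measurable_fun setT f /\ exists B, forall x, `|f x| <= B.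

Lemma bounded_measurable_cst c : bounded_measurable (cst c).
Proof. by split; [exact: measurable_cst|exists `|c|]. Qed.

Lemma bounded_measurable_add f g : bounded_measurable f ->
  bounded_measurable g -> bounded_measurable (fun x => f x + g x).
Proof.
move=> [mf [B fB]] [mg [C gC]]; split; first exact: measurable_funD.
by exists (B + C) => x; rewrite (le_trans (ler_normD _ _))// lerD.
Qed.

Lemma bounded_measurable_mul f g : bounded_measurable f ->
  bounded_measurable g -> bounded_measurable (fun x => f x * g x).
Proof.
move=> [mf [B fB]] [mg [C gC]]; split; first exact: measurable_funM.
by exists (B * C) => x; rewrite normrM ler_pM.
Qed.

Lemma bounded_measurable_scale c f : bounded_measurable f ->
  bounded_measurable (fun x => c * f x).
Proof. by apply: bounded_measurable_mul; exact: bounded_measurable_cst. Qed.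

Lemma bounded_measurable_opp f : bounded_measurable f ->
  bounded_measurable (fun x => - f x).
Proof.
move=> [mf [B fB]]; split; first exact: measurable_funN.
by exists B => x; rewrite normrN.
Qed.

Lemma bounded_measurable_sub f g : bounded_measurable f ->
  bounded_measurable g -> bounded_measurable (fun x => f x - g x).
Proof.
by move=> bf bg; apply: bounded_measurable_add => //; exact: bounded_measurable_opp.
Qed.

Lemma bounded_measurable_indic (A : set X) :
  measurable A -> bounded_measurable (\1_A : X -> R).
Proof.
move=> mA; split; first exact: measurable_indic.
by exists 1 => x; rewrite indicE; case: (_ \in _); rewrite ?normr1 ?normr0.
Qed.

Section Mean.
Variable m : probability X R.

Definition mean f : R := \int[m]_x f x.

Lemma bounded_measurable_integrable f : bounded_measurable f ->
  m.-integrable setT (EFin \o f).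
Proof.
move=> [mf [B fB]].
apply: (@le_integrable _ _ _ m setT measurableT _ (EFin \o cst B)).
- exact/measurable_EFinP.
- move=> x _ /=; rewrite lee_fin [leRHS]ger0_norm//.
  exact: le_trans (fB x).
- exact: finite_measure_integrable_cst.
Qed.

Lemma mean_EFin f : bounded_measurable f ->
  (\int[m]_x (f x)%:E)%E = (mean f)%:E.
Proof.
move=> bf; rewrite /mean /Rintegral fineK//.
exact: integrable_fin_num (bounded_measurable_integrable bf).
Qed.

Lemma mean_cst c : mean (cst c) = c.
Proof.
have m1 : m setT = 1%E by exact: probability_setT.
transitivity (c * fine (m setT)); first exact: Rintegral_cst.
by rewrite m1 mulr1.
Qed.

Lemma meanD f g : bounded_measurable f -> bounded_measurable g ->
  mean (fun x => f x + g x) = mean f + mean g.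
Proof.
by move=> bf bg; rewrite /mean RintegralD//; exact: bounded_measurable_integrable.
Qed.

Lemma meanB f g : bounded_measurable f -> bounded_measurable g ->
  mean (fun x => f x - g x) = mean f - mean g.
Proof.
by move=> bf bg; rewrite /mean RintegralB//; exact: bounded_measurable_integrable.
Qed.

Lemma meanZ c f : bounded_measurable f -> mean (fun x => c * f x) = c * mean f.
Proof.
by move=> bf; rewrite /mean RintegralZl//; exact: bounded_measurable_integrable.
Qed.

Lemma mean_sum (J : Type) (r : seq J) (F : J -> X -> R) :
  (forall j, bounded_measurable (F j)) ->
  bounded_measurable (fun x => \sum_(j <- r) F j x) /\
  mean (fun x => \sum_(j <- r) F j x) = \sum_(j <- r) mean (F j).
Proof.
move=> bF; elim: r => [|j r [b IH]].
  rewrite big_nil; under eq_fun do rewrite big_nil.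
  by split; [exact: bounded_measurable_cst|exact: mean_cst].
rewrite big_cons -IH; under eq_fun do rewrite big_cons.
by split; [exact: bounded_measurable_add|rewrite -meanD].
Qed.

Lemma mean_le f g : bounded_measurable f -> bounded_measurable g ->
  (forall x, f x <= g x) -> mean f <= mean g.
Proof.
move=> bf bg fg; apply: le_Rintegral => //; exact: bounded_measurable_integrable.
Qed.

Lemma mean_norm f C : bounded_measurable f -> (forall x, `|f x| <= C) ->
  `|mean f| <= C.
Proof.
move=> bf fC; rewrite ler_norml -{1}(mean_cst (- C)) -{2}(mean_cst C).
apply/andP; split; apply: mean_le => //; (try exact: bounded_measurable_cst) => x;
  by have := fC x; rewrite ler_norml => /andP[].
Qed.

Lemma mean_close f g e : bounded_measurable f -> bounded_measurable g ->
  (forall x, `|f x - g x| <= e) -> `|mean f - mean g| <= e.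
Proof.
move=> bf bg fg; rewrite -meanB//; apply: mean_norm => //.
exact: bounded_measurable_sub.
Qed.

Lemma mean_indic (A : set X) : measurable A -> mean \1_A = fine (m A).
Proof.
by move=> mA; rewrite /mean /Rintegral integral_indic// setIT.
Qed.

Lemma mean_cvg (f_ : nat -> X -> R) f B :
  (forall n, measurable_fun setT (f_ n)) -> (forall n x, `|f_ n x| <= B) ->
  (forall x, f_ n x @[n --> \oo] --> f x) ->
  bounded_measurable f /\ mean (f_ n) @[n --> \oo] --> mean f.
Proof.
move=> mf_ f_B f_f.
have mf : measurable_fun setT f.
  by apply: (measurable_fun_cvg (h := f_)) => // x _; exact: f_f.
have bf : bounded_measurable f.
  split => //; exists B => x.
  have c : `|f_ n x| @[n --> \oo] --> `|f x| by exact: (cvg_norm (f_f x)).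
  rewrite -(cvg_lim _ c)//; apply: limr_le; first by apply/cvg_ex; eexists; exact: c.
  by apply: nearW => n; exact: f_B.
split => //.
have bf_ n : bounded_measurable (f_ n) by split => //; exists B.
have := @dominated_cvg _ _ _ m setT measurableT (fun n => EFin \o f_ n)
  (EFin \o f) (EFin \o cst B).
rewrite mean_EFin// => h.
suff : (mean (f_ n))%:E @[n --> \oo] --> (mean f)%:E by move/fine_cvgP => [].
rewrite (_ : (fun n => _) = fun n => (\int[m]_x (f_ n x)%:E)%E); last first.
  by apply/funext => n; rewrite mean_EFin.
apply: h => //.
- by move=> n; exact/measurable_EFinP.
- by move=> x _; apply: cvg_EFin; [exact: nearW|exact: f_f].
- exact: finite_measure_integrable_cst.
- by move=> n x _ /=; rewrite lee_fin.
Qed.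

End Mean.

Lemma eq_mean (m1 m2 : probability X R) f :
  (forall A, measurable A -> m1 A = m2 A) -> mean m1 f = mean m2 f.
Proof.
move=> m12; rewrite /mean /Rintegral; congr fine.
exact: eq_law_integral.
Qed.

End BoundedMeasurable.

Lemma mean_distribution dX (X : measurableType dX) dY (Y : measurableType dY)
    (R : realType) (m : probability X R) (g : {mfun X >-> Y}) (f : Y -> R) :
  bounded_measurable f -> mean (distribution m g) f = mean m (f \o g).
Proof.
move=> bf; have bfg : bounded_measurable (f \o g).
  case: bf => mf [B fB]; split; first exact: measurableT_comp.
  by exists B => x; exact: fB.
rewrite /mean /Rintegral; congr fine.
rewrite integral_pushforward//; last 2 first.
- by apply/measurable_EFinP; case: bf.
- exact: (bounded_measurable_integrable m bfg).
Qed.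

(** * The Borel structure of the base times the torus *)

Section ProductBorel.
Context (R : realType) dI (I : measurableType dI) (tau : topology_on I)
  (d : nat).
Local Notation K := (torus R d).
Local Notation J := (topologized tau).
Hypothesis htau : compact_metrizable R J.
Hypothesis htauB : borel_topology tau.

Lemma open_base_measurable (U : set J) : open U -> measurable (U : set I).
Proof. by move=> oU; rewrite htauB; exact: sub_sigma_algebra. Qed.

Lemma continuous_base_measurable (g : J -> R) :
  continuous g -> measurable_fun setT (g : I -> R).
Proof.
move=> cg; apply: measurable_fun_lower => t; apply: open_base_measurable.
apply: (@open_comp _ _ g [set s : R | t < s]) => [y _|]; [exact: cg|exact: open_gt].
Qed.

(** Continuous functions on the product are uniform limits of trigonometric
sums, hence measurable for the product sigma-algebra. *)
Lemma continuous_bounded_measurable (F : J * K -> R) :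
  continuous F -> bounded_measurable (F : I * K -> R).
Proof.
move=> cF; have [phi [phic phi01 phisep _]] := separating_family htau.
have [cJ _] := htau.
have btrig G : trig_sum phi G -> bounded_measurable (G : I * K -> R).
  elim=> {G} [s k th|c G _ bG|G1 G2 _ b1 _ b2].
  - have bm : bounded_measurable (monomial phi s : I -> R).
      split; first by apply: continuous_base_measurable; exact: monomial_continuous.
      have cm : continuous (monomial phi s) by exact: monomial_continuous.
      have [B mB] := compact_bounded_fun cJ cm.
      by exists B => x; exact: mB.
    have bw : bounded_measurable (@wave R d k th).
      split; first exact: measurable_wave.
      by exists 1 => y; exact: cos_max.
    apply: (@bounded_measurable_mul _ _ _ (fun z : I * K => monomial phi s z.1)
      (fun z : I * K => wave k th z.2)).
      case: bm => mm [B mB]; split; last by exists B => z; exact: mB.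
      exact: (measurableT_comp mm measurable_fst).
    case: bw => mm [B mB]; split; last by exists B => z; exact: mB.
    exact: (measurableT_comp mm measurable_snd).
  - exact: bounded_measurable_scale.
  - exact: bounded_measurable_add.
have bF : exists B, forall z : J * K, `|F z| <= B.
  apply: compact_bounded_fun cF; rewrite -setXTT.
  by apply: compact_setX => //; exact: compact_torus.
split => //.
have /choice[G GP] n : exists G, trig_sum phi G /\ forall z, `|G z - F z| < n.+1%:R^-1.
  have n0 : 0 < n.+1%:R^-1 :> R by rewrite invr_gt0.
  by have [G tG GF] := trig_sum_dense cJ phic phisep cF n0; exists G.
apply: (measurable_fun_cvg (h := (G : nat -> I * K -> R))).
- by move=> n; have [/btrig[]] := GP n.
- move=> z _; apply/cvgrPdist_lt => e e0.
  have := near_infty_natSinv_lt (PosNum e0); apply: filterS => n ne.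
  by rewrite distrC (lt_trans _ ne)//; exact: (GP n).2.
Qed.

Definition cozero (F : J * K -> R) : set (I * K) := [set z | 0 < F z].

(** Stable under intersection and generating the sigma-algebra, with indicators
that are limits of continuous functions: these sets pass from the means of
continuous functions to measures. *)
Definition cozero_sets : set (set (I * K)) :=
  [set cozero F | F in [set F : J * K -> R | continuous F]].

Lemma cozero_setsI : setI_closed cozero_sets.
Proof.
move=> _ _ [F cF <-] [G cG <-].
exists (fun z => Num.min (F z) (G z)); first exact: continuous_min.
by apply/seteqP; split => z; rewrite /cozero/= lt_min => /andP.
Qed.

(** The sigma-algebra of the base comes from the sublevel sets of a separating
family, that of the torus from gauge balls, countably many in both cases. *)
Lemma cozero_setsE : @measurable _ (I * K)%type = <<s cozero_sets >>.
Proof.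
apply/seteqP; split; last first.
  apply: smallest_sub; first exact: sigma_algebra_measurable.
  move=> _ [F cF <-]; have [mF _] := continuous_bounded_measurable cF.
  have := mF measurableT `]0, +oo[%classic (measurable_itv _).
  rewrite setTI; congr measurable; apply/seteqP; split => z;
  by rewrite /cozero/= in_itv/= andbT.
pose T := g_sigma_algebraType cozero_sets.
have [phi [phic phi01 _ phibase]] := separating_family htau.
have mfst : @measurable_fun _ _ T I setT fst.
  apply: (@measurability _ _ T I setT fst (@open J : set (set I))); first exact: htauB.
  move=> _ [U oU <-]; rewrite setTI.
  rewrite (_ : _ @^-1` U = \bigcup_(p in [set p |
      [set y | phi p y < p.1.+1%:R^-1] `<=` U])
      cozero (fun z => p.1.+1%:R^-1 - phi p z.1)).
    apply: measurable_bigcup_countable => p _; apply: sub_sigma_algebra.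
    eexists; last by [].
    apply: continuous_add; first exact: cst_continuous.
    apply: continuous_opp => z; apply: (@continuous_comp _ _ _ fst); first exact: cvg_fst.
    exact: phic.
  apply/seteqP; split => [z /= Uz|z [p /= pU]]; rewrite /cozero/= ?subr_gt0; last exact: pU.
  by have [p [pz pU]] := phibase U z.1 oU Uz; exists p => //=; rewrite subr_gt0.
have msnd : @measurable_fun _ _ T K setT snd.
  apply: (@measurability _ _ T K setT snd (@open K)) => //.
  move=> _ [V oV <-]; rewrite setTI (open_torusE oV) preimage_bigcup.
  apply: measurable_bigcup_countable => p _; apply: sub_sigma_algebra.
  exists (fun z => p.2.+1%:R^-1 - gauge (z.2 - rational_point R p.1)).
    apply: continuous_add; first exact: cst_continuous.
    apply: continuous_opp => z; apply: (@continuous_comp _ _ _ snd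
      (fun y => gauge (y - rational_point R p.1))); first exact: cvg_snd.
    exact: gauge_continuous.
  by apply/seteqP; split => z; rewrite /cozero/= subr_gt0.
rewrite measurable_prod_measurableType.
apply: smallest_sub; first exact: smallest_sigma_algebra.
move=> _ [A mA [B mB <-]]; rewrite setX_preimage.
apply: (@measurableI _ T).
  by rewrite -[X in measurable X]setTI; exact: mfst.
by rewrite -[X in measurable X]setTI; exact: msnd.
Qed.

Let bump (F : J * K -> R) (n : nat) (z : J * K) : R :=
  Num.min 1 (n%:R * - Num.min 0 (- F z)).

Let bump_continuous F n : continuous F -> continuous (bump F n).
Proof.
move=> cF; apply: continuous_min; first exact: cst_continuous.
apply: continuous_mul; first exact: cst_continuous.
apply: continuous_opp; apply: continuous_min; first exact: cst_continuous.
exact: continuous_opp.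
Qed.

(** Positive multiples of the positive part, truncated at 1, increase to the
indicator of the cozero set. *)
Lemma cozero_limit F : continuous F -> exists F_ : nat -> J * K -> R,
  [/\ forall n, continuous (F_ n), forall n z, `|F_ n z| <= 1 &
      forall z, F_ n z @[n --> \oo] --> (\1_(cozero F) z : R)].
Proof.
move=> cF; exists (bump F); split; first by move=> n; exact: bump_continuous.
  move=> n z; have p0 : 0 <= - Num.min 0 (- F z) by rewrite oppr_ge0 ge_min lexx.
  by rewrite /bump ger0_norm ?ge_min ?lexx// le_min ler01/= mulr_ge0.
move=> z; apply/cvgrPdist_lt => e e0.
have [Fz|Fz] := ltP 0 (F z); last first.
  apply: nearW => n; rewrite indicE memNset; last first.
    by rewrite /cozero/=; apply/negP; rewrite -leNgt.
  have h : Num.min 0 (- F z) = 0 by rewrite min_l// oppr_ge0.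
  by rewrite /bump h oppr0 mulr0 min_r// subrr normr0.
exists (Num.bound (F z)^-1) => // n /= nb.
have h : Num.min 0 (- F z) = - F z by rewrite min_r// oppr_le0 ltW.
rewrite indicE mem_set// /bump h opprK min_l ?subrr ?normr0//.
rewrite -ler_pdivrMr// mul1r; apply: (@le_trans _ _ (Num.bound (F z)^-1)%:R).
  by apply: ltW; apply: archi_boundP; rewrite invr_ge0 ltW.
by rewrite ler_nat.
Qed.

Lemma cozero_measurable F : continuous F -> measurable (cozero F).
Proof. by move=> cF; rewrite cozero_setsE; apply: sub_sigma_algebra; exists F. Qed.

Lemma eq_continuous_mean (m1 m2 : probability (I * K)%type R) :
  (forall F : J * K -> R, continuous F -> mean m1 F = mean m2 F) ->
  forall C, measurable C -> m1 C = m2 C.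
Proof.
move=> m12; apply: (measure_unique cozero_sets (fun=> setT)).
- exact: cozero_setsE.
- exact: cozero_setsI.
- move=> _; exists (cst 1); first exact: cst_continuous.
  by apply/seteqP; split => // z _; rewrite /cozero/=.
- by rewrite bigcup_const.
- move=> _ [F cF <-]; have [F_ [cF_ F_1 F_lim]] := cozero_limit cF.
  have mcoz := cozero_measurable cF.
  have F_F (m : probability (I * K)%type R) :
      mean m (F_ n : I * K -> R) @[n --> \oo] --> fine (m (cozero F)).
    rewrite -mean_indic//; apply: (@mean_cvg _ _ _ m F_ \1_(cozero F) 1 _ _ _).2 => // n.
    by have [] := continuous_bounded_measurable (cF_ n).
  have E : fine (m1 (cozero F)) = fine (m2 (cozero F)).
    apply: cvg_unique (F_F m1) _ => //.
    rewrite (_ : (fun n => _) = fun n => mean m2 (F_ n)); first exact: F_F.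
    by apply/funext => n; exact: m12.
  have h1 := fineK (fin_num_measure m1 _ mcoz).
  have h2 := fineK (fin_num_measure m2 _ mcoz).
  exact: etrans (esym h1) (etrans (congr1 EFin E) h2).
- by move=> _; rewrite (le_lt_trans (probability_le1 _ _))// ltry.
Qed.

End ProductBorel.

(** * The weak topology on fibered measures *)

Section ComplexContinuity.
Variable R : realType.

Lemma normc_ge_Im (z : R[i]) : `|complex.Im z|%:C%C <= `|z|.
Proof.
by rewrite normc_def lecR -sqrtr_sqr ler_wsqrtr// lerDr sqr_ge0.
Qed.

Lemma normc_le_ReIm (z : R[i]) :
  `|z| <= (`|complex.Re z| + `|complex.Im z|)%:C%C.
Proof.
rewrite normc_def lecR -[leRHS]ger0_norm ?addr_ge0// -sqrtr_sqr ler_wsqrtr//.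
rewrite -(real_normK (num_real (complex.Re z))).
rewrite -(real_normK (num_real (complex.Im z))).
have := normr_ge0 (complex.Re z); have := normr_ge0 (complex.Im z); nra.
Qed.

Lemma Re_continuous : continuous (fun z : R[i]^o => complex.Re z : R).
Proof.
move=> z U /nbhs_ballP[e /= e0 eU]; apply/nbhs_ballP.
exists e%:C%C => /=; first by rewrite ltcR.
move=> w zw; apply: eU; rewrite /ball/= -ltcR.
apply: le_lt_trans zw; apply: le_trans (normc_ge_Re (z - w)).
by case: z w => [a b] [a' b'].
Qed.

Lemma Im_continuous : continuous (fun z : R[i]^o => complex.Im z : R).
Proof.
move=> z U /nbhs_ballP[e /= e0 eU]; apply/nbhs_ballP.
exists e%:C%C => /=; first by rewrite ltcR.
move=> w zw; apply: eU; rewrite /ball/= -ltcR.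
apply: le_lt_trans zw; apply: le_trans (normc_ge_Im (z - w)).
by case: z w => [a b] [a' b'].
Qed.

Lemma cvg_complex (T : Type) (Fi : set_system T) (FF : Filter Fi)
    (a b : T -> R) (u v : R) :
  a t @[t --> Fi] --> u -> b t @[t --> Fi] --> v ->
  ((a t +i* b t)%C : R[i]^o) @[t --> Fi] --> ((u +i* v)%C : R[i]^o).
Proof.
move=> au bv U /nbhs_ballP[e /= e0 eU].
have [r r0 re] : exists2 r : R, 0 < r & e = r%:C%C.
  exists (complex.Re e); move: e0; rewrite ltcE => /andP[]//.
  by case: e {eU} => x y /= /eqP ->.
have r20 : 0 < r / 2 by rewrite divr_gt0.
move/cvgrPdist_lt : au => /(_ _ r20) au; move/cvgrPdist_lt : bv => /(_ _ r20) bv.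
have : \forall t \near Fi, `|u - a t| < r / 2 /\ `|v - b t| < r / 2 by exact: filterI.
apply: filterS => t [ut vt]; apply: eU; rewrite /ball/= re.
apply: le_lt_trans (normc_le_ReIm _) _; rewrite ltcR/=.
by rewrite [ltRHS](splitr r) ltrD.
Qed.

End ComplexContinuity.

Section WeakTopology.
Context (R : realType) dI (I : measurableType dI) (L : probability I R)
  (tau : topology_on I) (d : nat).
Local Notation K := (torus R d).
Local Notation J := (topologized tau).
Local Notation M := (weak_fibered L d tau).
Local Notation WE := (@weak_eval R dI I L d tau).

Definition mean_fibered (mu : M) (F : I * K -> R) : R :=
  mean (mu : fibered L d) F.

Lemma mean_fibered_continuous (F : J * K -> R) : continuous F ->
  continuous (fun mu : M => mean_fibered mu F).
Proof.
move=> cF.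
have cFC : continuous (fun z : J * K => (F z +i* 0)%C : R[i]^o).
  move=> z; apply: cvg_complex; first exact: cF.
  exact: cvg_cst.
pose G : continuousType (J * K)%type R[i]^o :=
  HB.pack (fun z : J * K => (F z +i* 0)%C : R[i]^o) (isContinuous.Build _ _ _ cFC).
have c1 : continuous (WE : M -> _) by exact: initial_continuous.
have c2 : continuous (fun mu : M => WE mu G).
  move=> mu; apply: (@continuous_comp _ _ _ (WE : M -> _)
     (fun u => u G)); first exact: c1.
  exact: (@proj_continuous _
    (fun _ : continuousType (J * K)%type R[i]^o => R[i]^o) G).
have c3 : continuous (fun mu : M => complex.Re (WE mu G)).
  move=> mu; apply: (@continuous_comp _ _ _ (fun mu : M => WE mu G)
    (fun z : R[i]^o => complex.Re z) mu); first exact: c2.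
  exact: Re_continuous.
exact: c3.
Qed.

(** A complex test function is handled through its real and imaginary parts. *)
Lemma cvg_weak (T : Type) (Fi : set_system T) (FF : Filter Fi) (u : T -> M)
    (l : M) :
  (forall F : J * K -> R, continuous F ->
     mean_fibered (u t) F @[t --> Fi] --> mean_fibered l F) ->
  u t @[t --> Fi] --> l.
Proof.
move=> ul.
have uw : WE (u t) @[t --> Fi] --> WE l.
  apply/cvg_sup => G U.
  rewrite [X in X _ -> _](@nbhsE (initial_topology (fun y : prod_topology
    (fun _ : continuousType (J * K)%type R[i]^o => R[i]^o) => y G))).
  case=> B [[V oV <-] /= Vx] /filterS; apply.
  have cG : continuous (G : J * K -> R[i]^o) by exact: cts_fun.
  have h : WE (u t) G @[t --> Fi] --> WE l G.
    apply: cvg_complex; apply: ul => z.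
      apply: (@continuous_comp _ _ _ G (fun w : R[i]^o => complex.Re w)).
        exact: cG.
      exact: Re_continuous.
    apply: (@continuous_comp _ _ _ G (fun w : R[i]^o => complex.Im w)).
      exact: cG.
    exact: Im_continuous.
  by apply: h; exact: open_nbhs_nbhs.
move=> U; rewrite nbhsE => -[B [[V oV VB] Bl] BU].
apply: (filterS BU); rewrite -VB.
apply: uw; apply: open_nbhs_nbhs; split => //.
by move: Bl; rewrite -VB.
Qed.

Lemma continuous_measurable_weak (g : M -> R) :
  continuous g -> measurable_fun setT g.
Proof.
move=> cg; apply: measurable_fun_lower => t; apply: sub_sigma_algebra.
apply: (@open_comp _ _ g [set s : R | t < s]) => [y _|]; [exact: cg|exact: open_gt].
Qed.

End WeakTopology.

(** * Wiener's lemma *)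

Section Dirichlet.
Variable R : realType.
Implicit Types a b : R.

Lemma sin_half_neq0 a : cos a != 1 -> sin (a / 2) != 0.
Proof.
apply: contra => /eqP s0; apply/eqP.
have ca : cos a = cos (a / 2 + a / 2) by congr cos; field.
by have := cos2Dsin2 (a / 2); rewrite ca cosD s0 expr0n/= addr0 mulr0 subr0 expr2.
Qed.

(** The factor in front turns each cosine into a difference of consecutive
sines. *)
Lemma dirichlet_telescope a b N :
  2 * sin (a / 2) * (\sum_(0 <= n < N) cos (b + n%:R * a)) =
  sin (b + N%:R * a - a / 2) - sin (b - a / 2).
Proof.
elim: N => [|N IH]; first by rewrite big_geq// mulr0 mul0r addr0 subrr.
rewrite big_nat_recr//= mulrDr IH.
have -> : b + N.+1%:R * a - a / 2 = (b + N%:R * a) + a / 2.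
  by rewrite -natr1; field.
rewrite !sinD !sinN !cosN; set s := b + _; ring.
Qed.

Lemma dirichlet_bound a b N :
  `|sin (a / 2)| * `|\sum_(0 <= n < N) cos (b + n%:R * a)| <= 1.
Proof.
have h := dirichlet_telescope a b N.
have h1 := sin_max (b + N%:R * a - a / 2); have h2 := sin_max (b - a / 2).
have : `|2 * (sin (a / 2) * \sum_(0 <= n < N) cos (b + n%:R * a))| <= 2.
  rewrite mulrA h; apply: le_trans (ler_normB _ _) _.
  by rewrite -[leRHS]/(1 + 1) lerD.
by rewrite !normrM ger0_norm// -[leRHS]mulr1 ler_pM2l.
Qed.

Lemma dirichlet_average a b : cos a != 1 ->
  N.+1%:R^-1 * \sum_(0 <= n < N.+1) cos (b + n%:R * a) @[N --> \oo] --> (0 : R).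
Proof.
move=> /sin_half_neq0 s0.
have s1 : 0 < `|sin (a / 2)| by rewrite normr_gt0.
apply/cvgrPdist_lt => e e0.
have es : 0 < e * `|sin (a / 2)| by rewrite mulr_gt0.
have := near_infty_natSinv_lt (PosNum es); apply: filterS => N /= Ne.
rewrite sub0r normrN normrM ger0_norm ?invr_ge0//.
rewrite -(ltr_pM2r s1); apply: le_lt_trans Ne.
rewrite -mulrA -[leRHS]mulr1 ler_wpM2l ?invr_ge0// mulrC.
exact: dirichlet_bound.
Qed.

End Dirichlet.

Section ProductMean.
Context dX (X : measurableType dX) dY (Y : measurableType dY) (R : realType).
Variables (m1 : probability X R) (m2 : probability Y R).

Lemma mean_prod (f : X -> R) (g : Y -> R) : bounded_measurable f -> bounded_measurable g ->
  mean (m1 \x m2)%E (fun z => f z.1 * g z.2) = mean m1 f * mean m2 g.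
Proof.
move=> bf bg.
have bfg : bounded_measurable (fun z : X * Y => f z.1 * g z.2).
  apply: (@bounded_measurable_mul _ _ _ (f \o fst) (g \o snd)).
    case: bf => mf [B fB]; split; last by exists B => z; exact: fB.
    exact: measurableT_comp.
  case: bg => mf [B fB]; split; last by exists B => z; exact: fB.
  exact: measurableT_comp.
apply: EFin_inj; rewrite -mean_EFin//.
rewrite -integral12_prod_meas1; last exact: bounded_measurable_integrable.
rewrite mulrC -meanZ// -mean_EFin; last exact: bounded_measurable_scale.
apply: eq_integral => x _; rewrite /fubini_F/= mean_EFin; last exact: bounded_measurable_scale.
by rewrite meanZ// mulrC.
Qed.

End ProductMean.

Lemma ae_eq_mean dX (X : measurableType dX) (R : realType)
    (m : probability X R) (f g : X -> R) : bounded_measurable f -> bounded_measurable g ->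
  {ae m, forall x, f x = g x} -> mean m f = mean m g.
Proof.
move=> bf bg fg; rewrite /mean /Rintegral; congr fine.
apply: ae_eq_integral => //.
- by apply/measurable_EFinP; case: bf.
- by apply/measurable_EFinP; case: bg.
by apply: filterS fg => x -> _.
Qed.

Lemma measurable_cos dX (X : measurableType dX) (R : realType) (g : X -> R) :
  measurable_fun setT g -> measurable_fun setT (fun x => cos (g x)).
Proof.
move=> mg; apply: (measurableT_comp _ mg).
by apply: continuous_measurable_fun => x; exact: continuous_cos.
Qed.

Section Wiener.
Context dX (X : measurableType dX) (R : realType).
Variable m : probability X R.
Variables (u a b : X -> R).
Hypothesis (mu_ : measurable_fun setT u) (ma : measurable_fun setT a)
  (mb : measurable_fun setT b).
Hypothesis u1 : forall x, `|u x| <= 1.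
Hypothesis a_nonatomic : forall c, m [set x | cos (a x - c) = 1] = 0%E.

Definition twisted_mean (n : nat) :=
  mean m (fun x => u x * cos (b x + n%:R * a x)).

Let term n (s : bool) (z : X * X) : R :=
  cos ((b z.1 + (-1) ^+ s * b z.2) + n%:R * (a z.1 + (-1) ^+ s * a z.2)).

Lemma bounded_measurable_twisted n :
  bounded_measurable (fun x => u x * cos (b x + n%:R * a x)).
Proof.
split.
  apply: measurable_funM => //; apply: measurable_cos.
  by apply: measurable_funD => //; apply: measurable_funM.
exists 1 => x; rewrite normrM -[leRHS]mulr1 ler_pM//; exact: cos_max.
Qed.

Lemma twisted_mean_sqr n : twisted_mean n ^+ 2 =
  mean (m \x m)%E (fun z => u z.1 * u z.2 * (2^-1 * (term n false z + term n true z))).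
Proof.
rewrite expr2 -mean_prod; try exact: bounded_measurable_twisted.
congr mean; apply/funext => z; rewrite /term !expr0 !expr1.
set p := b z.1 + _; set q := b z.2 + _.
rewrite (_ : b z.1 + _ + _ = p + q); last by rewrite /p /q; ring.
rewrite (_ : b z.1 + -1 * _ + _ = p - q); last by rewrite /p /q; ring.
by rewrite cosD cosB; field.
Qed.

(** The pairs of points whose frequencies agree up to sign, modulo a turn. *)
Let resonant (z : X * X) : Prop :=
  cos (a z.1 + a z.2) = 1 \/ cos (a z.1 - a z.2) = 1.

Lemma measurable_resonant : measurable resonant.
Proof.
have h (s : R) : measurable [set z : X * X | cos (a z.1 + s * a z.2) = 1].
  have mf : measurable_fun setT (fun z : X * X => cos (a z.1 + s * a z.2)).
    apply: measurable_cos; apply: measurable_funD.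
      exact: measurableT_comp.
    by apply: measurable_funM => //; exact: measurableT_comp.
  have := mf measurableT [set 1] (measurable_set1 1).
  by rewrite setTI.
rewrite (_ : (resonant : set _) = [set z : X * X | cos (a z.1 + 1 * a z.2) = 1] `|`
  [set z : X * X | cos (a z.1 + (-1) * a z.2) = 1]); first exact: measurableU.
by apply/seteqP; split => z; rewrite /resonant/= mul1r mulN1r.
Qed.

Lemma resonant_null : (m \x m)%E resonant = 0%E.
Proof.
rewrite /product_measure1.
rewrite (_ : (fun x => _) = cst 0%E) ?integral0//.
apply/funext => x.
have h c : measurable [set y | cos (a y - c) = 1].
  have mf : measurable_fun setT (fun y => cos (a y - c)).
    by apply: measurable_cos; apply: measurable_funB.
  have := mf measurableT [set 1] (measurable_set1 1).
  by rewrite setTI.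
have mU := measurableU _ _ (h (- a x)) (h (a x)).
have U0 : m ([set y | cos (a y - - a x) = 1] `|` [set y | cos (a y - a x) = 1]) = 0%E.
  apply/eqP; rewrite eq_le measure_ge0 andbT.
  have mU2 := measureU2 m (h (- a x)) (h (a x)).
  rewrite -[0%E]adde0; apply: (le_trans mU2).
  by apply: leeD; rewrite le_eqVlt; apply/orP; left; apply/eqP; exact: a_nonatomic.
apply: (subset_measure0 _ mU _ U0).
  by apply: measurable_xsection; exact: measurable_resonant.
move=> y; rewrite /xsection/= inE => -[/= <-|/= <-]; [left|right] => /=.
  by rewrite opprK addrC.
by rewrite -cosN opprB.
Qed.

(** Squaring turns the means into an integral over pairs of points, and the
frequencies that do not average out form a null set, the phase having a law
without atoms modulo a turn. *)
Lemma wiener :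
  N.+1%:R^-1 * \sum_(0 <= n < N.+1) twisted_mean n ^+ 2 @[N --> \oo] --> (0 : R).
Proof.
pose S (s : bool) N z := N.+1%:R^-1 * \sum_(0 <= n < N.+1) term n s z.
pose w z := u z.1 * u z.2 / 2.
pose F N z := w z * (S false N z + S true N z).
have bt n s : bounded_measurable (term n s).
  split; last by exists 1 => z; exact: cos_max.
  apply: measurable_cos; apply: measurable_funD.
    apply: measurable_funD; first exact: measurableT_comp.
    by apply: measurable_funM => //; exact: measurableT_comp.
  apply: measurable_funM => //; apply: measurable_funD; first exact: measurableT_comp.
  by apply: measurable_funM => //; exact: measurableT_comp.
have bw : bounded_measurable w.
  split.
    apply: measurable_funM => //; apply: measurable_funM; exact: measurableT_comp.
  exists (1 * 1 * `|2^-1|) => z; rewrite /w !normrM.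
  by rewrite ler_wpM2r// ler_pM.
have bS s N : bounded_measurable (S s N).
  by apply: bounded_measurable_scale; have [] := mean_sum (m \x m)%E
    (index_iota 0 N.+1) (fun n => bt n s).
have bF N : bounded_measurable (F N).
  by apply: bounded_measurable_mul => //; exact: bounded_measurable_add.
have S1 s N z : `|S s N z| <= 1.
  rewrite /S normrM ger0_norm ?invr_ge0// mulrC ler_pdivrMr// mul1r.
  apply: le_trans (ler_norm_sum _ _ _) _.
  apply: le_trans (_ : \sum_(0 <= n < N.+1) (1 : R) <= _).
    by apply: ler_sum => n _; exact: cos_max.
  by rewrite big_const_nat iter_addr_0 subn0.
have FE N : N.+1%:R^-1 * \sum_(0 <= n < N.+1) twisted_mean n ^+ 2 =
    mean (m \x m)%E (F N).
  rewrite (_ : F N = fun z => N.+1%:R^-1 * \sum_(0 <= n < N.+1)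
      u z.1 * u z.2 * (2^-1 * (term n false z + term n true z))).
    have bG n : bounded_measurable (fun z : X * X =>
        u z.1 * u z.2 * (2^-1 * (term n false z + term n true z))).
      rewrite (_ : (fun z => _) = fun z => w z * (term n false z + term n true z)).
        by apply: bounded_measurable_mul => //; exact: bounded_measurable_add.
      by apply/funext => z; rewrite /w !mulrA.
    have [bs ms] := mean_sum (m \x m)%E (index_iota 0 N.+1) bG.
    rewrite meanZ// ms; congr (_ * _); apply: eq_bigr => n _.
    exact: twisted_mean_sqr.
  apply/funext => z; rewrite /F /S /w -mulrDr -big_split/= mulrCA; congr (_ * _).
  by rewrite mulr_sumr; apply: eq_bigr => n _; rewrite !mulrA.
have mNr : measurable (~` resonant) by apply: measurableC; exact: measurable_resonant.
have bI : bounded_measurable (\1_(~` resonant) : X * X -> R).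
  exact: bounded_measurable_indic.
rewrite (_ : (fun N => _) =
    fun N => mean (m \x m)%E (fun z => F N z * \1_(~` resonant) z)); last first.
  apply/funext => N; rewrite FE; apply: ae_eq_mean => //.
    exact: bounded_measurable_mul.
  exists resonant; split; [exact: measurable_resonant|exact: resonant_null|].
  move=> z /=; apply: contra_notP => nz.
  by rewrite indicE mem_set// mulr1.
have [w1 wB] := bw; have [B {}wB] := wB.
rewrite -[X in _ --> X](mean_cst (m \x m)%E).
apply: (@mean_cvg _ _ _ (m \x m)%E _ (cst 0) (B * (1 + 1)) _ _ _).2.
- by move=> N; have [] := bounded_measurable_mul (bF N) bI.
- move=> N z; apply: (@le_trans _ _ `|F N z|).
    rewrite normrM -[leRHS]mulr1 ler_wpM2l// indicE.
    by case: (_ \in _); rewrite ?normr1 ?normr0.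
  rewrite /F normrM ler_pM//.
  by apply: le_trans (ler_normD _ _) _; rewrite lerD.
- move=> z; have [rz|nz] := pselect (resonant z).
    rewrite (_ : (fun N => _) = cst 0); first exact: cvg_cst.
    by apply/funext => N; rewrite indicE memNset ?mulr0//; exact.
  rewrite (_ : (fun N => _) = F^~ z).
    rewrite [X in _ --> X](_ : _ = w z * (0 + 0)); last by rewrite addr0 mulr0.
    apply: cvgMr; apply: cvgD; apply: dirichlet_average; rewrite ?expr0 ?expr1 ?mul1r ?mulN1r.
      by apply/eqP => h; apply: nz; left.
    by apply/eqP => h; apply: nz; right.
  by apply/funext => N; rewrite indicE mem_set// mulr1.
Qed.

End Wiener.

(** * Characters of the torus *)

Section Characters.
Variables (R : realType) (d : nat).
Local Notation twopi := (pi *+ 2 : R).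
Local Notation K := (torus R d).
Implicit Types (x y a : K) (k : 'I_d -> int).

Lemma phase_half_turn k : (exists i, k i != 0) -> exists a, eq2pi (phase k a) pi.
Proof.
move=> [i ki].
pose t (j : 'I_d) : R := if j == i then (2 * (k i)%:~R)^-1 else 0.
exists (fun j => to_circle (t j)).
have [z ->] := phase_to_circle k t.
exists z; rewrite /t; congr (_ + _).
rewrite (bigD1 i)//= eqxx big1 => [|j /negPf ->]; last by rewrite mulr0.
by rewrite addr0; field; rewrite intr_eq0.
Qed.

Lemma cos_phaseB k x y : cos (phase k (x - y)) = cos (phase k x - phase k y).
Proof.
have [z h] := phaseD k (x - y) y; rewrite subrK in h.
by rewrite h -[LHS](cosDint _ z); congr cos; ring.
Qed.

Definition character_kernel k : set K := [set y | cos (phase k y) = 1].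

Lemma closed_character_kernel k : closed (character_kernel k).
Proof.
rewrite (_ : character_kernel k = wave k 0 @^-1` [set 1]).
  apply: closed_comp; last exact: closed_eq.
  by move=> y _; exact: wave_continuous.
by apply/seteqP; split => y; rewrite /wave/= addr0.
Qed.

Lemma cosB_eq1 (s t : R) : cos s = 1 -> cos t = 1 -> cos (s - t) = 1.
Proof.
move=> s1 t1; rewrite cosB s1 t1.
have : sin s ^+ 2 = 0 by have := cos2Dsin2 s; rewrite s1 expr1n; lra.
by move=> /eqP; rewrite sqrf_eq0 => /eqP ->; rewrite mul0r mulr1 addr0.
Qed.

Lemma subgroup_character_kernel k : subgroup (character_kernel k).
Proof.
split=> [|x y]; rewrite /character_kernel/=.
  by rewrite -[in LHS](subrr (0 : K)) cos_phaseB subrr cos0.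
by rewrite cos_phaseB; exact: cosB_eq1.
Qed.

Lemma character_kernel_proper k : (exists i, k i != 0) -> character_kernel k != setT.
Proof.
move=> /phase_half_turn[a [z az]]; apply/eqP => kT.
have : character_kernel k a by rewrite kT.
rewrite /character_kernel/= az cosDint cospi; lra.
Qed.

(** The level sets of a character are the cosets of its kernel, which is a proper
closed subgroup. *)
Lemma asynchronous_phase dI (I : measurableType dI) (L : probability I R)
    (f : I -> K) k c : asynchronous L f -> (exists i, k i != 0) ->
  L [set x | cos (phase k (f x) - c) = 1] = 0%E.
Proof.
move=> af k0; have [[a ac]|nc] := pselect (exists a, cos (phase k a - c) = 1).
  rewrite -[RHS](af _ (@closed_character_kernel k) (@subgroup_character_kernel k)
    (character_kernel_proper k0) a).
  rewrite /pushforward; congr (L _); apply/seteqP; split => x /=.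
    move=> xc; exists (f x - a); last by rewrite addrC subrK.
    rewrite /character_kernel/= cos_phaseB.
    rewrite -(cosB_eq1 xc ac); congr cos; ring.
  move=> [h hk <-].
  rewrite /character_kernel/= in hk.
  have := cosB_eq1 ac (_ : cos (- phase k h) = 1); rewrite cosN => /(_ hk) <-.
  by rewrite (cos_eq2pi _ (phaseD k a h)); congr cos; ring.
rewrite (_ : [set x | _] = set0) ?measure0//.
by apply/seteqP; split => // x /= xc; apply: nc; exists (f x).
Qed.

End Characters.

Section HaarMean.
Variables (R : realType) (d : nat).
Local Notation K := (torus R d).
Variable haar : probability K R.
Hypothesis hhaar : is_haar haar.

Lemma translate_preimage (a : K) (A : set K) :
  translate a A = (fun y => - a + y) @^-1` A.
Proof.
apply/seteqP; split => [_ [y Ay <-]|y Ay] /=; first by rewrite addKr.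
by exists (- a + y) => //; rewrite addNKr.
Qed.

Lemma measurable_torus_addl (a : K) : measurable_fun setT (fun y : K => a + y).
Proof. by apply: measurable_torus_add => //; exact: measurable_id. Qed.

Lemma haar_translate (a : K) (A : set K) : measurable A ->
  haar ((fun y => a + y) @^-1` A) = haar A.
Proof. by move=> mA; rewrite -[in LHS](opprK a) -translate_preimage; exact: hhaar. Qed.

Lemma mean_haar_translate (a : K) (g : K -> R) : bounded_measurable g ->
  mean haar (fun y => g (a + y)) = mean haar g.
Proof.
move=> bg; rewrite -[LHS](@mean_distribution _ _ _ _ _ haar
  (mfun_of (measurable_torus_addl a)))//.
by apply: eq_mean => A mA; exact: haar_translate.
Qed.

Lemma bounded_measurable_wave k th : bounded_measurable (@wave R d k th).
Proof. by split; [exact: measurable_wave|exists 1 => y; exact: cos_max]. Qed.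

(** Translation by a point where the character is -1 changes the sign of the
wave. *)
Lemma mean_haar_wave (k : 'I_d -> int) th : (exists i, k i != 0) -> mean haar (wave k th) = 0.
Proof.
move=> k0; have [a [z az]] := @phase_half_turn R d k k0.
have h := mean_haar_translate a (bounded_measurable_wave k th).
suff E : (fun y => wave k th (a + y)) = (fun y => -1 * wave k th y).
  by move: h; rewrite E meanZ; [lra|exact: bounded_measurable_wave].
apply/funext => y; rewrite waveD /wave az mulN1r -cosDpi.
by rewrite -[RHS](cosDint _ z); congr cos; ring.
Qed.

End HaarMean.

(** * Density of the continuous functions in mean *)

Section MeanDensity.
Context (R : realType) dI (I : measurableType dI) (tau : topology_on I)
  (d : nat).
Local Notation K := (torus R d).
Local Notation J := (topologized tau).
Hypothesis htau : compact_metrizable R J.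
Hypothesis htauB : borel_topology tau.
Variable m : probability (I * K)%type R.

Definition mean_approximable (g : I * K -> R) :=
  bounded_measurable g /\ forall e : R, 0 < e ->
    exists2 F : J * K -> R, continuous F & mean m (fun z => `|g z - F z|) < e.

Lemma bounded_measurable_norm dX (X : measurableType dX) (g : X -> R) :
  bounded_measurable g -> bounded_measurable (fun x => `|g x|).
Proof.
move=> [mg [B gB]]; split; first exact: measurableT_comp.
by exists B => x; rewrite normr_id.
Qed.

Let bmF (F : J * K -> R) : continuous F -> bounded_measurable (F : I * K -> R).
Proof. exact: continuous_bounded_measurable. Qed.

Lemma mean_dist_triangle (f g h : I * K -> R) : bounded_measurable f ->
  bounded_measurable g -> bounded_measurable h ->
  mean m (fun z => `|f z - h z|) <=
  mean m (fun z => `|f z - g z|) + mean m (fun z => `|g z - h z|).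
Proof.
move=> bf bg bh.
have bfg := bounded_measurable_norm (bounded_measurable_sub bf bg).
have bgh := bounded_measurable_norm (bounded_measurable_sub bg bh).
have bfh := bounded_measurable_norm (bounded_measurable_sub bf bh).
rewrite -meanD//; apply: mean_le => //; first exact: bounded_measurable_add.
by move=> z; exact: ler_distD.
Qed.

Lemma mean_approximable_limit g : bounded_measurable g ->
  (forall e : R, 0 < e -> exists2 h, mean_approximable h &
     mean m (fun z => `|g z - h z|) < e) -> mean_approximable g.
Proof.
move=> bg gh; split => // e e0.
have e20 : 0 < e / 2 by rewrite divr_gt0.
have [h [bh hF] hg] := gh _ e20; have [F cF Fh] := hF _ e20.
exists F => //; apply: le_lt_trans (mean_dist_triangle bg bh (bmF cF)) _.
by rewrite [ltRHS]splitr ltrD.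
Qed.

Lemma mean_approximable_cvg g (h : nat -> I * K -> R) B :
  (forall n, mean_approximable (h n)) -> (forall n z, `|h n z| <= B) ->
  (forall z, h n z @[n --> \oo] --> g z) -> mean_approximable g.
Proof.
move=> ah hB hg.
have [bg _] := @mean_cvg _ _ _ m h g B (fun n => (ah n).1.1) hB hg.
apply: mean_approximable_limit => // e e0.
have [mg [C gC]] := bg.
have [|n z|z|_] := @mean_cvg _ _ _ m (fun n z => `|g z - h n z|) (cst 0) (C + B).
- move=> n; have [] := bounded_measurable_norm (bounded_measurable_sub bg (ah n).1).
  by [].
- by rewrite normr_id; apply: le_trans (ler_normB _ _) _; rewrite lerD.
- rewrite -[X in _ --> X](@normr0 _ R) -(subrr (g z)).
  by apply: cvg_norm; apply: cvgB => //; exact: cvg_cst.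
rewrite mean_cst => /cvgrPdist_lt/(_ _ e0)[N _ NP].
exists (h N) => //; have := NP N (leqnn N).
by rewrite sub0r normrN; apply: le_lt_trans; exact: ler_norm.
Qed.

Lemma mean_approximable_continuous (F : J * K -> R) :
  continuous F -> mean_approximable F.
Proof.
move=> cF; split; first exact: bmF.
move=> e e0; exists F => //; rewrite [X in mean m X](_ : _ = cst 0) ?mean_cst//.
by apply/funext => z; rewrite subrr normr0.
Qed.

Lemma mean_approximable_add g h : mean_approximable g -> mean_approximable h ->
  mean_approximable (fun z => g z + h z).
Proof.
move=> [bg ag] [bh ah]; have bgh := bounded_measurable_add bg bh.
split => // e e0; have e20 : 0 < e / 2 by rewrite divr_gt0.
have [F cF Fg] := ag _ e20; have [G cG Gh] := ah _ e20.
exists (fun z => F z + G z); first exact: continuous_add.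
have bgF := bounded_measurable_norm (bounded_measurable_sub bg (bmF cF)).
have bhG := bounded_measurable_norm (bounded_measurable_sub bh (bmF cG)).
apply: (@le_lt_trans _ _ (mean m (fun z => `|g z - F z| + `|h z - G z|))).
  apply: mean_le; last by move=> z; rewrite opprD addrACA; exact: ler_normD.
    apply: bounded_measurable_norm; apply: bounded_measurable_sub => //.
    by apply: bounded_measurable_add; exact: bmF.
  exact: bounded_measurable_add.
by rewrite meanD// [ltRHS]splitr ltrD.
Qed.

Lemma mean_approximable_scale c g : mean_approximable g ->
  mean_approximable (fun z => c * g z).
Proof.
move=> [bg ag]; split; first exact: bounded_measurable_scale.
move=> e e0; have c0 : 0 < `|c| + 1 by rewrite ltr_wpDl.
have ec0 : 0 < e / (`|c| + 1) by rewrite divr_gt0.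
have [F cF Fg] := ag _ ec0.
exists (fun z => c * F z); first by apply: continuous_mul => //; exact: cst_continuous.
rewrite (_ : (fun z => _) = fun z => `|c| * `|g z - F z|); last first.
  by apply/funext => z; rewrite -mulrBr normrM.
have bgF := bounded_measurable_norm (bounded_measurable_sub bg (bmF cF)).
rewrite meanZ//; apply: (@le_lt_trans _ _ (`|c| * (e / (`|c| + 1)))).
  by rewrite ler_wpM2l// ltW.
by rewrite mulrCA gtr_pMr// ltr_pdivrMr// mul1r ltrDl.
Qed.

Lemma mean_approximable_sum (T : Type) (r : seq T) (g : T -> I * K -> R) :
  (forall t, mean_approximable (g t)) ->
  mean_approximable (fun z => \sum_(t <- r) g t z).
Proof.
move=> ag; elim: r => [|t r IH].
  rewrite (_ : (fun z => _) = cst 0).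
    by apply: (@mean_approximable_continuous (cst 0)); exact: cst_continuous.
  by apply/funext => z; rewrite big_nil.
rewrite (_ : (fun z => _) = fun z => g t z + \sum_(j <- r) g j z).
  exact: mean_approximable_add.
by apply/funext => z; rewrite big_cons.
Qed.

(** By the pi-lambda theorem, starting from cozero sets. *)
Lemma mean_approximable_indic (C : set (I * K)) :
  measurable C -> mean_approximable \1_C.
Proof.
move=> mC; have gen := @cozero_setsE R dI I tau d htau htauB.
rewrite gen in mC; move: C mC.
apply: (dynkin_induction gen).
- exact: cozero_setsI.
- rewrite indicT; apply: (@mean_approximable_continuous (cst 1)).
  exact: cst_continuous.
- move=> _ [F cF <-]; have [F_ [cF_ F_1 F_F]] := cozero_limit cF.
  by apply: (mean_approximable_cvg _ F_1 F_F) => n; exact: mean_approximable_continuous.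
- move=> C mC aC.
  rewrite (_ : \1_(~` C) = fun z => 1 + -1 * \1_C z).
    apply: mean_approximable_add; last exact: mean_approximable_scale.
    apply: (@mean_approximable_continuous (cst 1)); exact: cst_continuous.
  by apply/funext => z; rewrite indicC mulN1r indicE; case: (_ \in _);
     rewrite ?subrr ?subr0.
- move=> C mC tC aC.
  have E n z : \sum_(0 <= i < n) \1_(C i) z = \1_(\big[setU/set0]_(i < n) C i) z :> R.
    elim: n => [|n IH]; first by rewrite big_geq// big_ord0 indic0.
    rewrite big_nat_recr//= IH big_ord_recr/= !indicE in_setU.
    have [Cn|] := boolP (z \in C n); last by rewrite orbF addr0.
    rewrite (_ : (z \in _) = false) ?add0r ?orbT//.
    apply/negbTE/negP; rewrite inE -bigcup_mkord => -[i /= iN Ci].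
    move: Cn; rewrite inE => Cn.
    have in_ : i = n by apply: (tC i n Logic.I Logic.I); exists z.
    by move: iN; rewrite in_ ltnn.
  apply: (@mean_approximable_cvg _ (fun n z => \sum_(0 <= i < n) \1_(C i) z) 1).
  + by move=> n; exact: mean_approximable_sum.
  + by move=> n z; rewrite E indicE; case: (_ \in _); rewrite ?normr1 ?normr0.
  + move=> z; under eq_fun do rewrite E.
    apply/cvgrPdist_lt => e e0.
    have [[k _ Ck]|nC] := pselect ((\bigcup_k C k) z).
      exists k.+1 => // n /= kn.
      have Uz : (\bigcup_k C k) z by exists k.
      have Vz : (\big[setU/set0]_(i < n) C i) z by rewrite -bigcup_mkord; exists k.
      by rewrite !indicE !mem_set// subrr normr0.
    apply: nearW => n; rewrite !indicE !memNset ?subrr ?normr0//.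
    by rewrite -bigcup_mkord => -[k _ Ck]; apply: nC; exists k.
Qed.

Import HBNNSimple.

(** Through simple functions; the function is first made nonnegative. *)
Lemma bounded_measurable_approximable g :
  bounded_measurable g -> mean_approximable g.
Proof.
move=> bg; have [mg [B gB]] := bg.
pose gp z := g z + B.
have gp0 z : 0 <= gp z by rewrite /gp; have := gB z; rewrite ler_norml; lra.
have mgp : measurable_fun setT (EFin \o gp).
  by apply/measurable_EFinP; apply: measurable_funD.
pose h := nnsfun_approx measurableT mgp.
have hgp z : h n z @[n --> \oo] --> gp z.
  have := @cvg_nnsfun_approx _ _ _ _ measurableT _ mgp (fun z _ => gp0 z) z Logic.I.
  by move/fine_cvgP => [].
have hle n z : h n z <= gp z.
  rewrite -(cvg_lim _ (hgp z))//.
  apply: nondecreasing_cvgn_le; last by apply/cvg_ex; exists (gp z).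
  by move=> i j ij; have /lefP := nd_nnsfun_approx measurableT mgp ij; exact.
have agp : mean_approximable gp.
  apply: (@mean_approximable_cvg _ h (B + B)) => //.
    move=> n; have -> : (h n : _ -> _) = _ := funext (fimfunEord (h n)).
    apply: mean_approximable_sum => i; apply: mean_approximable_scale.
    exact: mean_approximable_indic.
  move=> n z; rewrite ger0_norm; last exact: fun_ge0.
  apply: le_trans (hle n z) _; rewrite /gp.
  by have := gB z; rewrite ler_norml; lra.
rewrite (_ : g = fun z => gp z + - B).
  apply: mean_approximable_add => //.
  by apply: (@mean_approximable_continuous (cst (- B))); exact: cst_continuous.
by apply/funext => z; rewrite /gp addrK.
Qed.

End MeanDensity.

(** * Continuity of the fiberwise translation *)

Lemma continuous_close (X : topologicalType) (R : realType) (g : X -> R) :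
  (forall x e, 0 < e -> \forall y \near x, `|g x - g y| < e) -> continuous g.
Proof. by move=> h x; apply/cvgrPdist_lt => e e0; exact: h. Qed.

Section FiberedMeans.
Context (R : realType) dI (I : measurableType dI) (L : probability I R)
  (d : nat).
Local Notation K := (torus R d).
Implicit Types (mu : fibered L d) (F : I * K -> R).

Lemma mean_fibered_of (m : probability (I * K)%type R)
    (mL : forall A, measurable A -> pushforward m fst A = L A) F :
  mean (fibered_of mL) F = mean m F.
Proof. by apply: eq_mean => C mC; rewrite /fibered_of/= mtruncE. Qed.

Lemma bounded_measurable_comp dX (X : measurableType dX) dY
    (Y : measurableType dY) (h : X -> Y) (g : Y -> R) :
  measurable_fun setT h -> bounded_measurable g ->
  bounded_measurable (fun x => g (h x)).
Proof.
move=> mh [mg [B gB]]; split; first exact: measurableT_comp.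
by exists B => x; exact: gB.
Qed.

Lemma mean_marginal mu (g : I -> R) : bounded_measurable g ->
  mean mu (fun z => g z.1) = mean L g.
Proof.
move=> bg; have := @mean_distribution _ _ _ _ _ mu
  (mfun_of (@measurable_fst _ _ I K)) _ bg.
move=> /= <-; apply: eq_mean => A mA; exact: fibered_marginal.
Qed.

Lemma mean_graph (g : {mfun I >-> K}) F : bounded_measurable F ->
  mean (graph_measure L g) F = mean L (fun x => F (x, g x)).
Proof. by move=> bF; rewrite mean_fibered_of mean_distribution. Qed.

Lemma mean_shift (f : {mfun I >-> K}) mu F : bounded_measurable F ->
  mean (shift_fibered f mu) F = mean mu (fun z => F (shift f z)).
Proof. by move=> bF; rewrite mean_fibered_of mean_distribution. Qed.

Lemma mean_product (m : probability K R) (g : I -> R) (h : K -> R) :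
  bounded_measurable g -> bounded_measurable h ->
  mean (product_fibered L m) (fun z => g z.1 * h z.2) = mean L g * mean m h.
Proof. by move=> bg bh; rewrite mean_fibered_of mean_prod. Qed.

Lemma bounded_measurable_base_wave (g : I -> R) k th : bounded_measurable g ->
  bounded_measurable (fun z : I * K => g z.1 * wave k th z.2).
Proof.
move=> bg; apply: bounded_measurable_mul.
  exact: bounded_measurable_comp bg.
by apply: bounded_measurable_comp => //; exact: bounded_measurable_wave.
Qed.

Lemma measurable_phase k : measurable_fun setT (@phase R d k).
Proof.
apply: measurable_funM => //; apply: measurable_sum => i.
by apply: measurable_funM => //; exact: measurable_angle.
Qed.

Lemma wave_split k th (y : K) :
  wave k th y = cos th * wave k 0 y + - sin th * wave k (- (pi / 2)) y.
Proof. by rewrite /wave cosD addr0 cosBpihalf; ring. Qed.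

End FiberedMeans.

Section TrigonometricConvergence.
Context (R : realType) dI (I : measurableType dI) (L : probability I R)
  (tau : topology_on I) (d : nat).
Local Notation K := (torus R d).
Local Notation J := (topologized tau).
Local Notation M := (weak_fibered L d tau).
Hypothesis htau : compact_metrizable R J.
Hypothesis htauB : borel_topology tau.
Variable phi : nat * nat -> J -> R.
Hypothesis phic : forall p, continuous (phi p).
Hypothesis phi01 : forall p x, 0 <= phi p x <= 1.
Hypothesis phisep : forall x y, x != y -> exists p, phi p x != phi p y.

Lemma trig_sum_bounded_measurable F :
  trig_sum phi F -> bounded_measurable (F : I * K -> R).
Proof.
by move=> tF; apply: continuous_bounded_measurable => //; exact: trig_sum_continuous tF.
Qed.

Lemma monomial_bounded_measurable s : bounded_measurable (monomial phi s : I -> R).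
Proof.
have cm : continuous (monomial phi s) by exact: monomial_continuous.
split; first exact: continuous_base_measurable.
have [B mB] := compact_bounded_fun htau.1 cm.
by exists B => x; exact: mB.
Qed.

Lemma monomial_le1 s x : `|monomial phi s x| <= 1.
Proof.
rewrite /monomial; elim: s => [|p s IH]; first by rewrite big_nil normr1.
rewrite big_cons normrM -[leRHS]mulr1 ler_pM// ger0_norm.
  by have /andP[] := phi01 p x.
by have /andP[] := phi01 p x.
Qed.

(** Trigonometric sums are uniformly dense, so convergence of the Fourier
coefficients is enough. *)
Lemma trig_cvg_weak (T : Type) (Fi : set_system T) (FF : Filter Fi)
    (u : T -> M) (l : M) :
  (forall s k th, mean_fibered (u t) (trig_monomial phi s k th) @[t --> Fi] -->
     mean_fibered l (trig_monomial phi s k th)) ->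
  u t @[t --> Fi] --> l.
Proof.
move=> ul; apply: cvg_weak => F cF; apply/cvgrPdist_lt => e e0.
have e30 : 0 < e / 3 by rewrite divr_gt0.
have [G tG GF] := trig_sum_dense htau.1 phic phisep cF e30.
have : mean_fibered (u t) G @[t --> Fi] --> mean_fibered l G.
  elim: tG {GF} => {G} [s k th|c G tG IH|G1 G2 t1 IH1 t2 IH2].
  - exact: ul.
  - rewrite /mean_fibered meanZ; last exact: trig_sum_bounded_measurable.
    under eq_fun => t do rewrite (meanZ (u t) c (trig_sum_bounded_measurable tG)).
    exact: cvgMr IH.
  - have b1 := trig_sum_bounded_measurable t1; have b2 := trig_sum_bounded_measurable t2.
    rewrite /mean_fibered meanD//.
    under eq_fun do rewrite meanD//.
    exact: cvgD IH1 IH2.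
move=> /cvgrPdist_lt/(_ _ e30); apply: filterS => t ut.
have bF : bounded_measurable (F : I * K -> R) by exact: continuous_bounded_measurable.
have bG := trig_sum_bounded_measurable tG.
have close (m : probability (I * K)%type R) : `|mean m G - mean m F| <= e / 3.
  by apply: mean_close => // z; exact: ltW (GF z).
have h1 := close (u t); have h2 := close l.
rewrite /mean_fibered in ut *.
rewrite !ler_norml in h1 h2; rewrite !ltr_norml in ut *; lra.
Qed.

Lemma trig_fibered_ext (mu nu : M) :
  (forall s k th, mean_fibered mu (trig_monomial phi s k th) =
     mean_fibered nu (trig_monomial phi s k th)) -> mu = nu.
Proof.
move=> mn; apply: fibered_ext.
apply: (eq_continuous_mean htau htauB) => F cF.
have cmu : (fun=> mu : M) n @[n --> \oo] --> nu.
  apply: trig_cvg_weak => s k th.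
  by rewrite -mn; exact: cvg_cst.
have := @continuous_cvg _ _ _ _ _ _ (fun mu : M => mean_fibered mu F) nu
  (@mean_fibered_continuous R dI I L tau d F cF nu) cmu.
move=> h; apply: (cvg_unique (@Rhausdorff R) (cvg_cst _) (h _)).
Qed.

(** A continuous function on the base approximates the bounded one in mean, with
an error that does not depend on the fibered measure, the marginal being
prescribed. *)
Lemma base_wave_continuous (g : I -> R) k th : bounded_measurable g ->
  continuous (fun mu : M => mean_fibered mu (fun z => g z.1 * wave k th z.2)).
Proof.
move=> bg; apply: continuous_close => mu e e0.
have e30 : 0 < e / 3 by rewrite divr_gt0.
have [h ch gh] : exists2 h : J -> R, continuous h &
    mean L (fun x => `|g x - h x|) < e / 3.
  have bg1 : bounded_measurable (fun z : I * K => g z.1) by exact: bounded_measurable_comp.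
  have [_ /(_ _ e30)[F cF Fg]] :=
    bounded_measurable_approximable htau htauB (graph_measure L (cst 0)) bg1.
  exists (fun x => F (x, 0)).
    move=> x; apply: (@continuous_comp _ _ _ (fun x : J => (x, 0 : K)) F); last exact: cF.
    by apply: (@cvg_pair _ _ _ (nbhs x) (nbhs x) (nbhs (0 : K))); [exact: cvg_id|exact: cvg_cst].
  rewrite mean_graph in Fg => //.
  by apply: bounded_measurable_norm; apply: bounded_measurable_sub => //;
     exact: continuous_bounded_measurable.
have bh : bounded_measurable (h : I -> R).
  split; first exact: continuous_base_measurable.
  have [B mB] := compact_bounded_fun htau.1 ch.
  by exists B => x; exact: mB.
have close (nu : M) : `|mean_fibered nu (fun z => g z.1 * wave k th z.2) -
    mean_fibered nu (fun z => h z.1 * wave k th z.2)| <= e / 3.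
  rewrite /mean_fibered -meanB; try exact: bounded_measurable_base_wave.
  have bgh : bounded_measurable (fun x => `|g x - h x|).
    by apply: bounded_measurable_norm; exact: bounded_measurable_sub.
  apply: le_trans (ltW gh); rewrite -(mean_marginal nu bgh).
  rewrite ler_norml -mulN1r -meanZ; last exact: bounded_measurable_comp bgh.
  have bgw : bounded_measurable (fun z : I * K => g z.1 * wave k th z.2 - h z.1 * wave k th z.2).
    by apply: bounded_measurable_sub; exact: bounded_measurable_base_wave.
  have bgh1 : bounded_measurable (fun z : I * K => `|g z.1 - h z.1|).
    exact: bounded_measurable_comp bgh.
  have wl (z : I * K) : `|g z.1 * wave k th z.2 - h z.1 * wave k th z.2| <= `|g z.1 - h z.1|.
    by rewrite -mulrBl normrM -[leRHS]mulr1 ler_pM//; exact: cos_max.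
  apply/andP; split; apply: mean_le => //.
  - exact: bounded_measurable_scale.
  - by move=> z; have := wl z; rewrite ler_norml mulN1r => /andP[].
  - by move=> z; have := wl z; rewrite ler_norml => /andP[].
have chw : continuous (fun z : J * K => h z.1 * wave k th z.2).
  apply: continuous_mul => z.
    by apply: (@continuous_comp _ _ _ fst h); [exact: cvg_fst|exact: ch].
  by apply: (@continuous_comp _ _ _ snd (wave k th)); [exact: cvg_snd|exact: wave_continuous].
have hw := @mean_fibered_continuous R dI I L tau d _ chw mu.
have H : \forall nu \near mu, `|mean_fibered mu (fun z => h z.1 * wave k th z.2) -
    mean_fibered nu (fun z => h z.1 * wave k th z.2)| < e / 3.
  exact: ((cvgrPdist_lt _ _).1 hw _ e30).
move: H; apply: filterS => nu hnu; have h1 := close mu; have h2 := close nu.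
rewrite !ler_norml in h1 h2; rewrite !ltr_norml in hnu *; lra.
Qed.

(** The function [f] is only measurable, but once the wave is expanded it occurs
in factors that depend on the base point alone. *)
Lemma shift_continuous (f : {mfun I >-> K}) :
  continuous ((fun mu : M => shift_fibered f mu) : M -> M).
Proof.
move=> mu; apply: (trig_cvg_weak (nbhs_filter mu)) => s k th.
pose g1 x : R := monomial phi s x * cos (phase k (f x) + th).
pose g2 x : R := monomial phi s x * - sin (phase k (f x) + th).
have mp : measurable_fun setT (fun x => phase k (f x) + th).
  by apply: measurable_funD => //; apply: measurableT_comp => //; exact: measurable_phase.
have bg1 : bounded_measurable g1.
  apply: bounded_measurable_mul; first exact: monomial_bounded_measurable.
  split; first exact: measurable_cos.
  by exists 1 => x; exact: cos_max.
have bg2 : bounded_measurable g2.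
  apply: bounded_measurable_mul; first exact: monomial_bounded_measurable.
  split; last by exists 1 => x; rewrite normrN; exact: sin_max.
  apply: measurable_funN; under eq_fun do rewrite -cosBpihalf.
  by apply: measurable_cos; apply: measurable_funB.
have bm : bounded_measurable (trig_monomial phi s k th : I * K -> R).
  by apply: trig_sum_bounded_measurable; exact: trig_sum_monomial.
have E (nu : M) : mean_fibered (shift_fibered f nu : M) (trig_monomial phi s k th) =
    mean_fibered nu (fun z => g1 z.1 * wave k 0 z.2) +
    mean_fibered nu (fun z => g2 z.1 * wave k (- (pi / 2)) z.2).
  rewrite /mean_fibered mean_shift// -meanD; try exact: bounded_measurable_base_wave.
  congr mean; apply/funext => z; rewrite /trig_monomial/= addrC waveD wave_split /g1 /g2.
  by ring.
rewrite E; under eq_fun do rewrite E.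
by apply: cvgD; exact: base_wave_continuous.
Qed.

End TrigonometricConvergence.

(** * Convergence along sets of density one *)

Section DensityOne.
Variable R : realType.
Implicit Types (S : set nat) (c : nat -> R).

Definition average c (N : nat) : R := N.+1%:R^-1 * \sum_(0 <= n < N.+1) c n.

Lemma average_ge0 c N : (forall n, 0 <= c n) -> 0 <= average c N.
Proof. by move=> c0; rewrite mulr_ge0 ?invr_ge0// sumr_ge0. Qed.

Lemma le_average c c' N : (forall n, c n <= c' n) -> average c N <= average c' N.
Proof. by move=> cc'; rewrite ler_wpM2l ?invr_ge0// ler_sum. Qed.

Lemma average_cst (a : R) N : average (cst a) N = a.
Proof.
by rewrite /average sumr_const_nat subn0 -(mulr_natl a) mulKf// pnatr_eq0.
Qed.

Lemma average_squeeze c c' : (forall n, 0 <= c n <= c' n) ->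
  average c' N @[N --> \oo] --> (0 : R) -> average c N @[N --> \oo] --> (0 : R).
Proof.
move=> cc' c'0; apply: (squeeze_cvgr _ (cvg_cst 0) c'0).
apply: nearW => N; rewrite average_ge0 => [|n]; last by case/andP: (cc' n).
by apply: le_average => n; case/andP: (cc' n).
Qed.

(** The Fourier coefficients of the multiples of a function may fail to converge
along all integers; quadratic mean convergence is convergence along the filter
of the sets of density one. *)
Definition density_one : set_system nat :=
  [set S | average \1_(~` S) N @[N --> \oo] --> (0 : R)].

Lemma indic_ge0_le1 (A : set nat) n : 0 <= (\1_A n : R) <= 1.
Proof. by rewrite indicE; case: (_ \in _); rewrite lexx ler01. Qed.

Global Instance density_one_filter : ProperFilter density_one.
Proof.
split.
  rewrite /density_one/= setC0 indicT.
  rewrite (_ : average _ = cst 1); last by apply/funext => N; rewrite average_cst.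
  move=> h; have E : (0 : R) = 1.
    by apply: (cvg_unique (@Rhausdorff R) h); exact: cvg_cst.
  by move/eqP: E; rewrite eq_sym oner_eq0.
split.
- rewrite /density_one/= setCT indic0 (_ : average (cst 0) = cst 0); first exact: cvg_cst.
  by apply/funext => N; rewrite average_cst.
- move=> P Q hP hQ.
  apply: (@average_squeeze _ (fun n => \1_(~` P) n + \1_(~` Q) n)).
    move=> n; have /andP[-> _] := indic_ge0_le1 (~` (P `&` Q)) n.
    rewrite setCI !indicE in_setU; do 2 case: (_ \in _) => /=;
      by rewrite ?addr0 ?add0r ?lexx// lerDl.
  rewrite (_ : average _ = fun N => average \1_(~` P) N + average \1_(~` Q) N).
    by rewrite -[X in _ --> X]addr0; exact: cvgD.
  by apply/funext => N; rewrite /average -mulrDr big_split.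
- move=> P Q PQ hP; apply: average_squeeze hP => n.
  have /andP[-> _] := indic_ge0_le1 (~` Q) n.
  rewrite !indicE ler_nat; case: (boolP (n \in ~` Q)) => //.
  rewrite inE => nQ; rewrite mem_set// => nP; exact/nQ/PQ.
Qed.

(** By Chebyshev's inequality. *)
Lemma density_one_cvg c : average (fun n => c n ^+ 2) N @[N --> \oo] --> (0 : R) ->
  c n @[n --> density_one] --> (0 : R).
Proof.
move=> c0; apply/cvgrPdist_lt => e e0; rewrite /prop_near1 /nbhs/= /density_one/=.
apply: (@average_squeeze _ (fun n => (e ^+ 2)^-1 * c n ^+ 2)).
  move=> n; have /andP[-> _] := indic_ge0_le1 (~` [set n | `|0 - c n| < e]) n.
  rewrite indicE; case: (boolP (n \in _)) => [|_]; last first.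
    by rewrite mulr_ge0 ?invr_ge0 ?sqr_ge0.
  rewrite inE/= sub0r normrN => /negP; rewrite -leNgt => ec.
  rewrite mulrC ler_pdivlMr ?exprn_gt0// mul1r -[leRHS]real_normK ?num_real//.
  by rewrite ler_pXn2r ?nnegrE// ltW.
rewrite (_ : average _ = fun N => (e ^+ 2)^-1 * average (fun n => c n ^+ 2) N).
  by rewrite -[X in _ --> X](mulr0 (e ^+ 2)^-1); exact: cvgMr.
by apply/funext => N; rewrite /average mulrCA [in RHS]mulr_sumr.
Qed.

End DensityOne.

Lemma mean_sqr_eq0 dX (X : measurableType dX) (R : realType)
    (P : probability X R) (g : X -> R) : measurable_fun setT g ->
  bounded_measurable (fun x => g x ^+ 2) -> mean P (fun x => g x ^+ 2) = 0 ->
  P [set x | g x != 0] = 0%E.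
Proof.
move=> mg bg g0.
have mg2 : measurable_fun setT (fun x => (g x ^+ 2)%:E).
  by apply/measurable_EFinP; have [] := bg.
have : (\int[P]_x `|(g x ^+ 2)%:E| = 0)%E.
  rewrite (_ : (fun x => _) = fun x => (g x ^+ 2)%:E).
    by rewrite mean_EFin// g0.
  by apply/funext => x; rewrite gee0_abs// lee_fin sqr_ge0.
move=> /(ae_eq_integral_abs _ measurableT mg2)[N [mN N0 NP]].
apply: (subset_measure0 _ mN _ N0).
  have := mg measurableT (~` [set 0]) (measurableC (measurable_set1 _)).
  by rewrite setTI; congr measurable; apply/seteqP; split => x /=; [move/eqP|move=> /eqP].
move=> x /= gx; apply: NP => /= h; move: gx.
by have [/eqP] := h Logic.I; rewrite sqrf_eq0 => ->.
Qed.

(** * Asynchronous functions *)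

Section Asynchronous.
Context (R : realType) dI (I : measurableType dI) (L : probability I R)
  (tau : topology_on I) (d : nat).
Local Notation K := (torus R d).
Local Notation J := (topologized tau).
Local Notation M := (weak_fibered L d tau).
Hypothesis htau : compact_metrizable R J.
Hypothesis htauB : borel_topology tau.
Variable haar : probability K R.
Hypothesis hhaar : is_haar haar.
Variable f : {mfun I >-> K}.
Hypothesis af : asynchronous L f.
Variable phi : nat * nat -> J -> R.
Hypothesis phic : forall p, continuous (phi p).
Hypothesis phi01 : forall p x, 0 <= phi p x <= 1.
Hypothesis phisep : forall x y, x != y -> exists p, phi p x != phi p y.
Implicit Types (mu : M) (k : 'I_d -> int).
Local Notation lambda := (product_fibered L haar : M).

Lemma wave_mulrn k th (x y : K) n :
  wave k th (y + x *+ n) = cos (phase k y + th + n%:R * phase k x).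
Proof.
elim: n th => [|n IH] th; first by rewrite mulr0n addr0 mul0r addr0.
by rewrite mulrS addrCA waveD IH -natr1; congr cos; ring.
Qed.

(** A Fourier coefficient of the image of [mu] under the n-th iterate of the
fiberwise translation. *)
Definition fourier s k th (n : nat) mu : R := mean_fibered mu
  (fun z => monomial phi s z.1 * wave k th (z.2 + f z.1 *+ n)).

Let measurable_multiple n : measurable_fun setT (fun z : I * K => z.2 + f z.1 *+ n).
Proof.
apply: measurable_torus_add => //; elim: n => [|n IH].
  rewrite (_ : (fun z => _) = cst 0); first exact: measurable_cst.
  by apply/funext => z; rewrite mulr0n.
rewrite (_ : (fun z => _) = fun z : I * K => f z.1 + f z.1 *+ n).
  apply: measurable_torus_add => //.
  exact: measurableT_comp (measurable_funPT f) measurable_fst.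
by apply/funext => z; rewrite mulrS.
Qed.

Lemma bounded_measurable_fourier s k th n : bounded_measurable
  (fun z : I * K => monomial phi s z.1 * wave k th (z.2 + f z.1 *+ n)).
Proof.
apply: bounded_measurable_mul.
  by apply: bounded_measurable_comp => //; exact: monomial_bounded_measurable.
apply: (bounded_measurable_comp (measurable_multiple n)).
exact: bounded_measurable_wave.
Qed.

Lemma fourier_le1 s k th n mu : `|fourier s k th n mu| <= 1.
Proof.
apply: mean_norm; first exact: bounded_measurable_fourier.
move=> z; rewrite normrM -[leRHS]mulr1 ler_pM//; first exact: monomial_le1.
exact: cos_max.
Qed.

Lemma fourier_average s k th mu : (exists i, k i != 0) ->
  average (fun n => fourier s k th n mu ^+ 2) N @[N --> \oo] --> (0 : R).
Proof.
move=> k0; have mp := @measurable_phase R d k.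
have mf1 : measurable_fun setT (fun z : I * K => phase k (f z.1)).
  by apply: (measurableT_comp mp); exact: measurableT_comp (measurable_funPT f) measurable_fst.
have W := @wiener _ (I * K)%type R (mu : fibered L d)
  (fun z => monomial phi s z.1) (fun z => phase k (f z.1)) (fun z => phase k z.2 + th).
rewrite (_ : average _ = fun N => N.+1%:R^-1 * \sum_(0 <= n < N.+1)
  twisted_mean (mu : fibered L d) (fun z => monomial phi s z.1)
    (fun z => phase k (f z.1)) (fun z => phase k z.2 + th) n ^+ 2).
  apply: W => //.
  - have [mm _] := monomial_bounded_measurable htau htauB phic s.
    exact: measurableT_comp.
  - apply: measurable_funD => //; exact: measurableT_comp.
  - by move=> z; exact: monomial_le1.
  - move=> c; rewrite -[RHS](asynchronous_phase c af k0).
    apply: (fibered_marginal (mu : fibered L d) (A := [set x | cos (phase k (f x) - c) = 1])).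
    have mc : measurable_fun setT (fun x => cos (phase k (f x) - c)).
      apply: measurable_cos; apply: measurable_funB => //.
      exact: measurableT_comp (measurable_funPT f).
    by have := mc measurableT [set 1] (measurable_set1 1); rewrite setTI.
apply/funext => N; congr (_ * _); apply: eq_bigr => n _; congr (_ ^+ 2).
by congr mean; apply/funext => z; rewrite wave_mulrn.
Qed.

Lemma mean_lambda s k th : (exists i, k i != 0) ->
  mean_fibered lambda (trig_monomial phi s k th) = 0.
Proof.
move=> k0; rewrite /mean_fibered mean_product ?mean_haar_wave ?mulr0//.
  exact: monomial_bounded_measurable.
exact: bounded_measurable_wave.
Qed.

Lemma mean_trig_monomial0 mu s th :
  mean_fibered mu (trig_monomial phi s (fun=> 0) th) =
  cos th * mean L (monomial phi s).
Proof.
have bm := monomial_bounded_measurable htau htauB phic s.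
rewrite -(mean_marginal mu bm) -meanZ; last exact: bounded_measurable_comp bm.
congr mean; apply/funext => z.
by rewrite /trig_monomial /wave phase0l add0r mulrC.
Qed.

Lemma frequency_dec k : (exists i, k i != 0) \/ k = (fun=> 0).
Proof.
have [h|h] := pselect (exists i, k i != 0); first by left.
right; apply/funext => i; apply: contrapT => /eqP ki; apply: h; by exists i.
Qed.

(** The graph measures of the multiples of [f] are the successive translates of
the graph of 0. *)
Lemma asynchronous_closure : closure
  [set (graph_measure L (torus_mulz n f) : M) | n in [set: int]] lambda.
Proof.
have h : (graph_measure L (torus_mulz (n : nat)%:Z f) : M) @[n --> density_one R]
    --> lambda.
  apply: (trig_cvg_weak htau htauB phic phisep) => s k th.
  have [k0|->] := frequency_dec k; last first.
    rewrite (_ : (fun n => _) =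
      cst (mean_fibered lambda (trig_monomial phi s (fun=> 0) th))).
      exact: cvg_cst.
    by apply/funext => n; rewrite !mean_trig_monomial0.
  rewrite mean_lambda//.
  have := density_one_cvg (fourier_average s th (graph_measure L (cst 0) : M) k0).
  apply: cvg_trans; apply: near_eq_cvg; apply: nearW => n.
  rewrite /fourier /mean_fibered mean_graph; last exact: bounded_measurable_fourier.
  rewrite mean_graph; last first.
    by apply: (trig_sum_bounded_measurable htau htauB phic); exact: trig_sum_monomial.
  congr mean; apply/funext => x; rewrite /trig_monomial/= add0r.
  by rewrite /torus_mulz -pmulrn.
move=> B nB; have hB : \forall n \near density_one R,
    B (graph_measure L (torus_mulz (n : nat)%:Z f) : M) := h B nB.
have [n Bn] := filter_ex hB.
by exists (graph_measure L (torus_mulz n%:Z f) : M); split => //; exists n%:Z.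
Qed.

Lemma measurable_shift_weak :
  measurable_fun setT ((fun mu : M => shift_fibered f mu) : M -> M).
Proof.
apply: (@measurability _ _ _ _ setT _ (@open M)) => //.
move=> _ [B oB <-]; rewrite setTI; apply: sub_sigma_algebra.
apply: open_comp oB => mu _.
exact: (shift_continuous htau htauB phic phisep).
Qed.

Lemma fourier_shift s k th n mu :
  fourier s k th n (shift_fibered f mu : M) = fourier s k th n.+1 mu.
Proof.
rewrite /fourier /mean_fibered mean_shift; last exact: bounded_measurable_fourier.
by congr mean; apply/funext => z /=; rewrite -addrA -mulrS.
Qed.

Lemma measurable_fourier s k th n : measurable_fun setT (fourier s k th n).
Proof.
elim: n => [|n IH].
  apply: continuous_measurable_weak; apply: mean_fibered_continuous.
  rewrite (_ : (fun z => _) = trig_monomial phi s k th).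
    by apply: trig_sum_continuous => //; exact: trig_sum_monomial.
  by apply/funext => z; rewrite mulr0n addr0.
rewrite (_ : fourier s k th n.+1 = fun mu => fourier s k th n (shift_fibered f mu : M)).
  exact: measurableT_comp IH measurable_shift_weak.
by apply/funext => mu; rewrite fourier_shift.
Qed.

(** The law of the squared coefficient of order n under an invariant probability
does not depend on n, and its average over n tends to 0. *)
Lemma invariant_fourier (P : probability M R) s k th :
  invariant_probability (fun mu : M => shift_fibered f mu : M) P ->
  (exists i, k i != 0) ->
  P [set mu : M | fourier s k th 0 mu != 0] = 0%E.
Proof.
move=> invP k0; pose c n := fourier s k th n.
have mc n : measurable_fun setT (c n) := measurable_fourier s k th n.
have cS n mu : c n (shift_fibered f mu : M) = c n.+1 mu by exact: fourier_shift.
have bc n : bounded_measurable (fun mu => c n mu ^+ 2).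
  split; first by apply: measurable_funX.
  exists 1 => mu; rewrite normrX -(expr1n _ 2) ler_pXn2r ?nnegrE//.
  exact: fourier_le1.
have step n : mean P (fun mu => c n.+1 mu ^+ 2) = mean P (fun mu => c n mu ^+ 2).
  under eq_fun do rewrite -cS.
  rewrite -(mean_distribution P (mfun_of measurable_shift_weak) (bc n)).
  by apply: eq_mean => A mA; exact: invP.
have steps (v : nat -> R) : (forall n, v n.+1 = v n) -> forall n, v n = v 0%N.
  by move=> vS; elim=> // n <-.
have const n : mean P (fun mu => c n mu ^+ 2) = mean P (fun mu => c 0%N mu ^+ 2).
  exact: (steps _ step).
pose a N mu := average (fun n => c n mu ^+ 2) N.
have aE N : bounded_measurable (a N) /\ mean P (a N) = mean P (fun mu => c 0%N mu ^+ 2).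
  have [b1 b2] := mean_sum P (index_iota 0 N.+1) bc.
  split; first exact: bounded_measurable_scale.
  transitivity (average (fun n => mean P (fun mu => c n mu ^+ 2)) N).
    by rewrite /a /average meanZ// b2.
  by rewrite (funext const) average_cst.
have c00 : mean P (fun mu => c 0%N mu ^+ 2) = 0.
  have [|N mu|mu|_] := @mean_cvg _ _ _ P a (cst 0) 1.
  - by move=> N; have [[]] := aE N.
  - rewrite ger0_norm; last by apply: average_ge0 => n; rewrite sqr_ge0.
    rewrite -(average_cst 1 N); apply: le_average => n.
    rewrite -[leLHS]ger0_norm ?sqr_ge0// normrX -(expr1n _ 2) ler_pXn2r ?nnegrE//.
    exact: fourier_le1.
  - exact: fourier_average.
  rewrite mean_cst (_ : (fun N => _) = cst (mean P (fun mu => c 0%N mu ^+ 2))).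
    by move=> h; exact: (cvg_unique (@Rhausdorff R) (cvg_cst _) h).
  by apply/funext => N; have [] := aE N.
exact: mean_sqr_eq0.
Qed.

End Asynchronous.

Lemma null_bigcup_countable (J : countType) dX (X : measurableType dX)
    (R : realType) (P : probability X R) (D : set J) (F : J -> set X) :
  (forall j, D j -> measurable (F j)) -> (forall j, D j -> P (F j) = 0%E) ->
  P (\bigcup_(j in D) F j) = 0%E.
Proof.
move=> mF F0; apply/negligibleP; first exact: measurable_bigcup_countable.
apply: (@negligibleS _ _ _ _ (\bigcup_(n : nat)
    (if unpickle n is Some j then (if j \in D then F j else set0) else set0))).
  by move=> x [j Dj Fjx]; exists (pickle j) => //; rewrite pickleK mem_set.
apply: negligible_bigcup => n; case: unpickle => [j|]; last exact: negligible_set0.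
case: ifPn => [|_]; last exact: negligible_set0.
by rewrite inE => Dj; apply/negligibleP; [exact: mF|exact: F0].
Qed.

Section HaarFibered.
Context (R : realType) dI (I : measurableType dI) (L : probability I R)
  (d : nat).
Local Notation K := (torus R d).
Variable haar : probability K R.
Hypothesis hhaar : is_haar haar.

Lemma shift_haar (f : {mfun I >-> K}) :
  shift_fibered f (product_fibered L haar) = product_fibered L haar.
Proof.
apply: fibered_ext => C mC; rewrite shift_fiberedE//.
have mS : measurable (shift f @^-1` C).
  by rewrite -[X in measurable X]setTI; exact: measurable_shift.
rewrite /product_fibered/= !mtruncE// /product_measure1.
apply: eq_integral => x _ /=.
rewrite -(haar_translate hhaar (f x) (measurable_xsection x mC)); congr (haar _).
by apply/seteqP; split => y; rewrite /xsection/= !inE/= /xsection/= ?inE addrC.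
Qed.

End HaarFibered.

Section AsynchronousErgodic.
Context (R : realType) dI (I : measurableType dI) (L : probability I R)
  (tau : topology_on I) (d : nat).
Local Notation K := (torus R d).
Local Notation J := (topologized tau).
Local Notation M := (weak_fibered L d tau).
Hypothesis htau : compact_metrizable R J.
Hypothesis htauB : borel_topology tau.
Variable haar : probability K R.
Hypothesis hhaar : is_haar haar.
Variable f : {mfun I >-> K}.
Local Notation lambda := (product_fibered L haar : M).
Local Notation T := ((fun mu : M => shift_fibered f mu) : M -> M).

(** Countably many Fourier coefficients determine a fibered measure, and almost
surely they are those of the product measure. *)
Lemma asynchronous_invariant (P : probability M R) : asynchronous L f ->
  invariant_probability T P ->
  forall A : set M, measurable A -> P A = \d_lambda A.
Proof.
move=> af invP.
have [phi [phic phi01 phisep _]] := separating_family htau.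
pose th (b : bool) : R := if b then 0 else - (pi / 2).
pose F (j : seq (nat * nat) * {ffun 'I_d -> int} * bool) : set M :=
  [set mu : M | fourier f phi j.1.1 j.1.2 (th j.2) 0 mu != 0].
pose D : set (seq (nat * nat) * {ffun 'I_d -> int} * bool) :=
  fun j => exists i, j.1.2 i != 0.
have mF j : measurable (F j).
  have mj := measurable_fourier (L := L) htau htauB f phic phisep j.1.1 j.1.2 (th j.2) 0.
  have := mj measurableT (~` [set 0]) (measurableC (measurable_set1 _)).
  by rewrite setTI; congr measurable; apply/seteqP; split => mu /=; [move/eqP|move=> /eqP].
pose N := \bigcup_(j in D) F j.
have mN : measurable N by exact: measurable_bigcup_countable.
have N0 : P N = 0%E.
  apply: null_bigcup_countable => // j Dj.
  exact: (invariant_fourier htau htauB af phic phi01 phisep).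
have eqN (mu : M) : ~ N mu -> mu = lambda.
  move=> nN; apply: (trig_fibered_ext htau htauB phic phisep) => s k t.
  have [k0|->] := frequency_dec k; last by rewrite !mean_trig_monomial0.
  rewrite mean_lambda//.
  have z b : mean_fibered mu (trig_monomial phi s k (th b)) = 0.
    have : ~ F (s, [ffun i => k i], b) mu.
      move=> Fmu; apply: nN; exists (s, [ffun i => k i], b) => //.
      by have [i ki] := k0; exists i; rewrite ffunE.
    move/negP; rewrite negbK => /eqP <-; rewrite /fourier; congr mean.
    apply/funext => z; rewrite mulr0n addr0 /trig_monomial.
    by congr (_ * wave _ _ _); apply/funext => i; rewrite /= ffunE.
  have zt b : bounded_measurable (trig_monomial phi s k (th b) : I * K -> R).
    by apply: (trig_sum_bounded_measurable htau htauB phic); exact: trig_sum_monomial.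
  rewrite (_ : trig_monomial phi s k t = fun w =>
     cos t * trig_monomial phi s k (th true) w +
     - sin t * trig_monomial phi s k (th false) w).
    rewrite /mean_fibered meanD; try exact: bounded_measurable_scale.
    rewrite !meanZ//; have := z true; have := z false.
    by rewrite /mean_fibered => -> ->; rewrite !mulr0 addr0.
  by apply/funext => w; rewrite /trig_monomial wave_split; ring.
move=> A mA; rewrite diracE.
have null B : measurable B -> ~ B lambda -> P B = 0%E.
  move=> mB Bl; apply: (subset_measure0 mB mN _ N0) => mu Bmu.
  by apply: contrapT => /eqN E; apply: Bl; rewrite -E.
have [Al|nAl] := boolP (lambda \in A); last first.
  by apply: null => // Al; move: nAl; rewrite mem_set.
have nA : P (~` A) = 0%E.
  apply: null; first exact: measurableC.
  by apply; move: Al; rewrite inE.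
have mA' : measurable (~` A) by exact: measurableC.
have E : P (~` ~` A) = (1 - P (~` A))%E by exact: probability_setC.
by rewrite setCK nA sube0 in E.
Qed.

Lemma invariant_dirac_haar (P : probability M R) :
  (forall A : set M, measurable A -> P A = \d_lambda A) ->
  invariant_probability T P.
Proof.
move=> Pd A mA; rewrite /pushforward.
have [phi [phic phi01 phisep _]] := separating_family htau.
have mT := measurable_shift_weak (L := L) htau htauB f phic phisep.
have mTA : measurable (T @^-1` A).
  by rewrite -[X in measurable X]setTI; exact: mT.
rewrite !Pd// /dirac !indicE; congr ((nat_of_bool _)%:R%:E).
by apply/idP/idP; rewrite !inE/= shift_haar.
Qed.

Lemma asynchronous_uniquely_ergodic : asynchronous L f -> uniquely_ergodic R T.
Proof.
move=> af; exists (\d_lambda : probability M R); split.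
  exact: (@invariant_dirac_haar (\d_lambda : probability M R)).
by move=> Q invQ A mA; exact: asynchronous_invariant.
Qed.

End AsynchronousErgodic.

(** * Haar measure and closed subgroups *)

Section HaarOpen.
Variables (R : realType) (d : nat).
Local Notation K := (torus R d).
Variable haar : probability K R.
Hypothesis hhaar : is_haar haar.

(** Countably many translates of a ball cover the torus. *)
Lemma haar_open_gt0 (U : set K) : open U -> U !=set0 -> (0 < haar U)%E.
Proof.
move=> oU [z Uz]; have /nbhs_torusP[e e0 eU] : nbhs z U by exact: open_nbhs_nbhs.
have mB y : measurable [set x : K | gauge (x - y) < e].
  by apply: open_measurable_torus; exact: open_gauge_lt.
rewrite lt_neqAle measure_ge0 andbT eq_sym; apply/eqP => U0.
have B0 y : haar [set x | gauge (x - y) < e] = 0%E.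
  rewrite (_ : [set x | _] = (fun x => (z - y) + x) @^-1` [set x | gauge (x - z) < e]).
    rewrite haar_translate//; apply: (subset_measure0 (mB z) _ _ U0).
      exact: open_measurable_torus.
    by move=> x /eU.
  by apply/seteqP; split => x /=; rewrite addrAC addrAC (addrC (z - y)) addrA addrAC addrK.
have : haar setT = 0%E.
  rewrite (_ : setT = \bigcup_(q in [set: {ffun 'I_d -> rat}])
      [set x | gauge (x - rational_point R q) < e]).
    by apply: null_bigcup_countable => q _; [exact: mB|exact: B0].
  apply/seteqP; split => // x _.
  by have [q qx] := rational_point_dense x e0; exists q.
have -> : haar setT = 1%E by exact: probability_setT.
by move/eqP; rewrite onee_eq0.
Qed.

End HaarOpen.

Section Cosets.
Variables (R : realType) (d : nat).
Local Notation K := (torus R d).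
Variable H : set K.
Hypotheses (cH : closed H) (sH : subgroup H).

Lemma subgroupN h : H h -> H (- h).
Proof. by move=> Hh; rewrite -sub0r; apply: sH.2 => //; exact: sH.1. Qed.

Lemma subgroupD h h' : H h -> H h' -> H (h + h').
Proof. by move=> Hh Hh'; rewrite -[h']opprK; apply: sH.2 => //; exact: subgroupN. Qed.

Lemma measurable_coset a : measurable (translate a H).
Proof.
rewrite translate_preimage -[X in measurable X]setTI.
by apply: measurable_torus_addl => //; exact: closed_measurable_torus.
Qed.

Lemma coset_multiple a y (n : int) : translate a H y -> H (y *~ n - a *~ n).
Proof.
move=> [h Hh <-]; rewrite mulrzDl addrC addKr.
have Hn (m : nat) : H (h *+ m).
  by elim: m => [|m IH]; [rewrite mulr0n; exact: sH.1|rewrite mulrS; exact: subgroupD].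
by case: n => m; rewrite ?NegzE ?mulrNz -pmulrn//; exact: subgroupN.
Qed.

Lemma coset_sub a y y' : translate a H y -> translate a H y' -> H (y - y').
Proof.
move=> [h Hh <-] [h' Hh' <-]; rewrite opprD addrACA subrr add0r; exact: sH.2.
Qed.

Definition fattening (e : R) : set K := [set y | exists2 h, H h & gauge (y - h) < e].

Lemma fattening_invariant e h y : H h -> fattening e (y + h) <-> fattening e y.
Proof.
move=> Hh; split=> [[h' Hh' yh]|[h' Hh' yh]].
  by exists (h' - h); [exact: sH.2|rewrite opprB addrA].
by exists (h' + h); [exact: subgroupD|rewrite opprD addrACA subrr addr0].
Qed.

Lemma open_fattening e : open (fattening e).
Proof.
rewrite (_ : fattening e = \bigcup_(h in H) [set y | gauge (y - h) < e]).
  by apply: bigcup_open => h _; exact: open_gauge_lt.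
by apply/seteqP; split => y [h Hh yh]; exists h.
Qed.

Lemma subgroup_gap : H != setT -> exists z e, 0 < e /\
  forall h, H h -> e <= gauge (h - z).
Proof.
move=> HT; have [z nz] : exists z, ~ H z.
  apply: contrapT => h; move/eqP: HT; apply; apply/seteqP; split => // z _.
  by apply: contrapT => nz; apply: h; exists z.
have : nbhs z (~` H) by apply: open_nbhs_nbhs; split => //; exact: closed_openC.
move=> /nbhs_torusP[e e0 eH]; exists z, e; split => // h Hh.
by rewrite leNgt; apply/negP => /eH.
Qed.

End Cosets.

(** * Accumulation at the product measure forces asynchrony *)

Section PairMean.
Context (R : realType) dI (I : measurableType dI) (L : probability I R)
  (tau : topology_on I) (d : nat).
Local Notation K := (torus R d).
Local Notation J := (topologized tau).
Local Notation M := (weak_fibered L d tau).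
Hypothesis htau : compact_metrizable R J.
Hypothesis htauB : borel_topology tau.
Variable A : set I.
Hypothesis mA : measurable A.

(** It detects fibers above [A] that lie in cosets of one subgroup: it is then 0
if [chi] vanishes on the subgroup. *)
Definition pair_mean (chi : K -> R) (mu : M) : R :=
  mean ((mu : fibered L d) \x (mu : fibered L d))%E
    (fun w => \1_A w.1.1 * \1_A w.2.1 * chi (w.1.2 - w.2.2)).

Lemma bounded_measurable_pair (chi : K -> R) : bounded_measurable chi ->
  bounded_measurable (fun w : (I * K) * (I * K) =>
    \1_A w.1.1 * \1_A w.2.1 * chi (w.1.2 - w.2.2)).
Proof.
move=> bc; apply: bounded_measurable_mul; first apply: bounded_measurable_mul.
- apply: (bounded_measurable_comp (h := fun w : (I * K) * (I * K) => w.1.1)).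
    exact: measurableT_comp.
  exact: bounded_measurable_indic.
- apply: (bounded_measurable_comp (h := fun w : (I * K) * (I * K) => w.2.1)).
    exact: measurableT_comp.
  exact: bounded_measurable_indic.
apply: (bounded_measurable_comp (h := fun w : (I * K) * (I * K) => w.1.2 - w.2.2)) bc.
apply: measurable_torus_add; first exact: measurableT_comp.
by apply: measurable_torus_opp; exact: measurableT_comp.
Qed.

Lemma wave_sub k th (y y' : K) : wave k th (y - y') =
  wave k th y * wave k 0 y' + wave k (th - pi / 2) y * wave k (- (pi / 2)) y'.
Proof.
rewrite /wave !addr0 !addrA !cosBpihalf -cosB.
have [z h] := phaseD k (y - y') y'; rewrite subrK in h.
by rewrite h -[LHS](cosDint _ z); congr cos; ring.
Qed.

(** The addition formula separates the two points. *)
Lemma pair_mean_wave k th (mu : M) : pair_mean (wave k th) mu =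
  mean_fibered mu (fun z => \1_A z.1 * wave k th z.2) *
  mean_fibered mu (fun z => \1_A z.1 * wave k 0 z.2) +
  mean_fibered mu (fun z => \1_A z.1 * wave k (th - pi / 2) z.2) *
  mean_fibered mu (fun z => \1_A z.1 * wave k (- (pi / 2)) z.2).
Proof.
have bA := @bounded_measurable_indic _ _ R _ mA.
have bw th' := bounded_measurable_base_wave k th' bA.
have bp th1 th2 : bounded_measurable (fun w : (I * K) * (I * K) =>
    (\1_A w.1.1 * wave k th1 w.1.2) * (\1_A w.2.1 * wave k th2 w.2.2)).
  apply: bounded_measurable_mul.
    exact: (bounded_measurable_comp (h := fst) _ (bw th1)).
  exact: (bounded_measurable_comp (h := snd) _ (bw th2)).
rewrite /mean_fibered -!mean_prod// -meanD//.
by congr mean; apply/funext => w; rewrite wave_sub; ring.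
Qed.

Lemma continuous_bounded_measurable_torus (chi : K -> R) :
  continuous chi -> bounded_measurable chi.
Proof.
move=> cchi; split; first exact: continuous_measurable_torus.
by have [B chiB] := compact_bounded_fun (@compact_torus R d) cchi; exists B => y; exact: chiB.
Qed.

Lemma slice_continuous (G : J * K -> R) (x0 : J) :
  continuous G -> continuous (fun y => G (x0, y)).
Proof.
move=> cG y; apply: (@continuous_comp _ _ _ (fun y : K => (x0, y)) G); last exact: cG.
by apply: (@cvg_pair _ _ _ (nbhs y) (nbhs x0) (nbhs y)); [exact: cvg_cst|exact: cvg_id].
Qed.

Lemma pair_mean_continuous (phi : nat * nat -> J -> R) G (x0 : J) :
  (forall p, continuous (phi p)) ->
  trig_sum phi G -> continuous (pair_mean (fun y => G (x0, y))).
Proof.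
move=> phic.
have bs (F : J * K -> R) : trig_sum phi F -> bounded_measurable (fun y : K => F (x0, y)).
  move=> tF; apply: continuous_bounded_measurable_torus.
  by apply: slice_continuous; exact: trig_sum_continuous tF.
elim=> {G} [s k th|c G tG IH|G1 G2 t1 IH1 t2 IH2].
- rewrite (_ : pair_mean _ = fun mu => monomial phi s x0 * pair_mean (wave k th) mu).
    apply: continuous_mul; first exact: cst_continuous.
    rewrite (funext (pair_mean_wave k th)).
    have bA := @bounded_measurable_indic _ _ R _ mA.
    by apply: continuous_add; apply: continuous_mul; exact: base_wave_continuous.
  apply/funext => mu; rewrite /pair_mean -meanZ.
    by congr mean; apply/funext => w; rewrite /trig_monomial/= mulrCA.
  by apply: bounded_measurable_pair; exact: bounded_measurable_wave.
- rewrite (_ : pair_mean _ = fun mu => c * pair_mean (fun y => G (x0, y)) mu).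
    by apply: continuous_mul => //; exact: cst_continuous.
  apply/funext => mu; rewrite /pair_mean -meanZ.
    by congr mean; apply/funext => w; rewrite mulrCA.
  exact: (@bounded_measurable_pair (fun y => G (x0, y)) (bs _ tG)).
- rewrite (_ : pair_mean _ = fun mu =>
      pair_mean (fun y => G1 (x0, y)) mu + pair_mean (fun y => G2 (x0, y)) mu).
    exact: continuous_add.
  apply/funext => mu; rewrite /pair_mean -meanD.
  + by congr mean; apply/funext => w; rewrite mulrDr.
  + exact: (@bounded_measurable_pair (fun y => G1 (x0, y)) (bs _ t1)).
  + exact: (@bounded_measurable_pair (fun y => G2 (x0, y)) (bs _ t2)).
Qed.

Lemma pair_mean_close (chi chi' : K -> R) e mu : bounded_measurable chi ->
  bounded_measurable chi' -> (forall y, `|chi y - chi' y| <= e) ->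
  `|pair_mean chi mu - pair_mean chi' mu| <= e.
Proof.
move=> bc bc' cc'; apply: mean_close; try exact: bounded_measurable_pair.
move=> w; rewrite -mulrBr normrM -[leRHS]mul1r ler_pM//.
rewrite !indicE; case: (_ \in _); case: (_ \in _);
  by rewrite ?mulr0 ?mul0r ?mulr1 ?normr1 ?normr0.
Qed.

(** Trigonometric sums on the product, restricted to the fiber of a point, are
uniformly dense on the torus. *)
Lemma pair_mean_continuous_fun (chi : K -> R) :
  continuous chi -> continuous (pair_mean chi).
Proof.
move=> cchi.
have [[x0 _]|nI] := pselect (exists x : I, True); last first.
  rewrite (_ : pair_mean chi = cst 0); first exact: cst_continuous.
  apply/funext => mu; rewrite /pair_mean (_ : (fun w => _) = cst 0) ?mean_cst//.
  by apply/funext => -[[x y] w]; exfalso; apply: nI; exists x.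
have [phi [phic _ phisep _]] := separating_family htau.
apply: continuous_close => mu e e0.
have e30 : 0 < e / 3 by rewrite divr_gt0.
have cF : continuous (fun z : J * K => chi z.2).
  by move=> z; apply: (@continuous_comp _ _ _ snd chi); [exact: cvg_snd|exact: cchi].
have [G tG GF] := trig_sum_dense htau.1 phic phisep cF e30.
have bchi := continuous_bounded_measurable_torus cchi.
have bG : bounded_measurable (fun y => G (x0, y)).
  apply: continuous_bounded_measurable_torus.
  by apply: slice_continuous; exact: trig_sum_continuous tG.
have close nu : `|pair_mean (fun y => G (x0, y)) nu - pair_mean chi nu| <= e / 3.
  by apply: pair_mean_close => // y; exact: ltW (GF (x0, y)).
have cG := @pair_mean_continuous phi G x0 phic tG mu.
have h : \forall nu \near mu, `|pair_mean (fun y => G (x0, y)) mu -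
    pair_mean (fun y => G (x0, y)) nu| < e / 3.
  exact: ((cvgrPdist_lt _ _).1 cG _ e30).
move: h; apply: filterS => nu hnu; have h1 := close mu; have h2 := close nu.
rewrite !ler_norml in h1 h2; rewrite !ltr_norml in hnu *; lra.
Qed.

Lemma pair_mean_rectangle_le (chi : K -> R) (B B' : set K) c mu :
  measurable B -> measurable B' ->
  bounded_measurable chi -> 0 <= c -> (forall y, 0 <= chi y) ->
  (forall y y', B y -> B' y' -> c <= chi (y - y')) ->
  c * (fine ((mu : fibered L d) (A `*` B)) * fine ((mu : fibered L d) (A `*` B')))
    <= pair_mean chi mu.
Proof.
move=> mB mB' bchi c0 chi0 cBB'.
have mAB := measurableX mA mB; have mAB' := measurableX mA mB'.
have b1 := @bounded_measurable_indic _ _ R _ mAB.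
have b2 := @bounded_measurable_indic _ _ R _ mAB'.
have b12 : bounded_measurable (fun w : (I * K) * (I * K) =>
    (\1_(A `*` B) w.1 : R) * \1_(A `*` B') w.2).
  by apply: bounded_measurable_mul;
    [exact: (bounded_measurable_comp (h := fst) _ b1)|
     exact: (bounded_measurable_comp (h := snd) _ b2)].
rewrite -!mean_indic// -mean_prod// -meanZ//.
apply: mean_le; [exact: bounded_measurable_scale|exact: bounded_measurable_pair|].
move=> [[x y] [x' y']]; rewrite !indicE !in_setX/=.
case: (x \in A); case: (x' \in A); case: (boolP (y \in B)) => [|_];
  case: (boolP (y' \in B')) => [|_]; rewrite /= ?(mul0r, mulr0, mul1r, mulr1)//.
by rewrite !inE; move=> By' By; exact: cBB'.
Qed.

End PairMean.

Section ClosureAsynchronous.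
Context (R : realType) dI (I : measurableType dI) (L : probability I R)
  (tau : topology_on I) (d : nat).
Local Notation K := (torus R d).
Local Notation J := (topologized tau).
Local Notation M := (weak_fibered L d tau).
Hypothesis htau : compact_metrizable R J.
Hypothesis htauB : borel_topology tau.
Variable haar : probability K R.
Hypothesis hhaar : is_haar haar.
Variable f : {mfun I >-> K}.
Local Notation lambda := (product_fibered L haar : M).

Lemma haar_rectangle (A : set I) (B : set K) : measurable A -> measurable B ->
  (lambda : fibered L d) (A `*` B) = (L A * haar B)%E.
Proof.
move=> mA mB; rewrite /product_fibered/= mtruncE; last exact: measurableX.
exact: product_measure1E.
Qed.

(** Above a set that [f] maps to a coset of [H], the graph of each multiple of
[f] lies in a coset of [H], so a pair mean with a bump function off [H] keeps
the graph measures away from the product measure. *)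
Lemma closure_asynchronous : closure
  [set (graph_measure L (torus_mulz n f) : M) | n in [set: int]] lambda ->
  asynchronous L f.
Proof.
move=> cl H cH sH HT a; apply: contrapT => LA0.
have [z0 [e [e0 He]]] := subgroup_gap cH HT.
pose A := f @^-1` translate a H.
have mA : measurable A.
  rewrite -[X in measurable X]setTI; apply: (measurable_funPT f) => //.
  exact: measurable_coset.
pose chi (y : K) := Num.max 0 (e - gauge (y - z0)).
have cchi : continuous chi.
  rewrite (_ : chi = fun y => - Num.min 0 (- (e - gauge (y - z0)))).
    apply: continuous_opp; apply: continuous_min; first exact: cst_continuous.
    apply: continuous_opp; apply: continuous_add; first exact: cst_continuous.
    by apply: continuous_opp; exact: gauge_continuous.
  by apply/funext => y; rewrite oppr_min oppr0 opprK.
have bchi := continuous_bounded_measurable_torus cchi.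
have chi0 y : 0 <= chi y by rewrite /chi le_max lexx.
have chiH h : H h -> chi h = 0 by move=> Hh; rewrite /chi max_l// subr_le0 He.
pose B z : set K := [set y | gauge (y - z) < e / 8].
have mB z : measurable (B z) by apply: open_measurable_torus; exact: open_gauge_lt.
have B0 z : 0 < fine (haar (B z)).
  have := haar_open_gt0 hhaar (open_gauge_lt z (e / 8)) _.
  rewrite -lte_fin fineK; last exact: fin_num_measure.
  by apply; exists z; rewrite /= subrr gauge0 divr_gt0.
have LA : 0 < fine (L A).
  rewrite -lte_fin fineK; last exact: fin_num_measure.
  by rewrite lt_neqAle measure_ge0 andbT eq_sym; apply/eqP.
have := pair_mean_rectangle_le tau mA lambda (mB z0) (mB 0) bchi.
move=> /(_ (e / 2) (divr_ge0 (ltW e0) _) chi0) lb.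
have {}lb : 0 < pair_mean A chi lambda.
  apply: lt_le_trans (lb _ _) => //; last first.
    move=> y y' By By'; rewrite /chi le_max; apply/orP; right.
    rewrite /B/= subr0 in By By'.
    have : gauge (y - y' - z0) <= 2 * gauge (y - z0) + 2 * gauge y'.
      by rewrite addrAC -[gauge y']gaugeN; exact: gaugeD.
    lra.
  rewrite !haar_rectangle// !fineM ?fin_num_measure//.
  by rewrite !mulr_gt0// divr_gt0.
have cP := pair_mean_continuous_fun htau htauB mA cchi.
have nP : nbhs lambda [set mu : M | 0 < pair_mean A chi mu].
  apply: open_nbhs_nbhs; split => //.
  apply: (@open_comp _ _ (pair_mean A chi : M -> R) [set s : R | 0 < s]).
    by move=> mu _; exact: cP.
  exact: open_gt.
have [_ [[n _ <-]]] := cl _ nP.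
suff P0 : pair_mean A chi (graph_measure L (torus_mulz n f) : M) = 0.
  by rewrite /= P0 ltxx.
pose D := graph_measure L (torus_mulz n f).
pose E : set (I * K) := A `*` ~` translate (a *~ n) H.
have mE : measurable E.
  by apply: measurableX => //; apply: measurableC; exact: measurable_coset.
have DE : D E = 0%E.
  rewrite /D /graph_measure/= mtruncE// /distribution /pushforward.
  rewrite (_ : _ @^-1` E = set0) ?measure0//.
  apply/seteqP; split => // x [/= Ax]; apply.
  exists (f x *~ n - a *~ n); first exact: coset_multiple.
  by rewrite addrC subrK.
rewrite -[RHS](mean_cst (D \x D)%E); apply: ae_eq_mean.
- exact: bounded_measurable_pair.
- exact: bounded_measurable_cst.
exists ((E `*` setT) `|` (setT `*` E)); split.
- by apply: measurableU; exact: measurableX.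
- have mE1 : measurable (E `*` [set: I * K]) by exact: measurableX.
  have mE2 : measurable ([set: I * K] `*` E) by exact: measurableX.
  have z1 : (D \x D)%E (E `*` setT) = 0%E.
    by rewrite product_measure1E// [X in (X * _)%E](_ : _ = 0%E) ?mul0e.
  have z2 : (D \x D)%E (setT `*` E) = 0%E.
    by rewrite product_measure1E// [X in (_ * X)%E](_ : _ = 0%E) ?mule0.
  apply/negligibleP; first exact: measurableU.
  by apply: negligibleU; apply/negligibleP.
move=> [[x y] [x' y']] /=; apply: contra_notP => nN.
rewrite !indicE; have [Ax|] := boolP (x \in A); last by rewrite !mul0r.
have [Ax'|] := boolP (x' \in A); last by rewrite mulr0 mul0r.
rewrite chiH ?mulr0//; move: Ax Ax'; rewrite !inE => Ax Ax'.
apply: (coset_sub sH (a := a *~ n)); apply: contrapT => ny; apply: nN; [left|right] => //.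
Qed.

End ClosureAsynchronous.

(** * Unique ergodicity forces asynchrony *)

Section Conditional.
Context dX (X : measurableType dX) (R : realType).
Variables (P : probability X R) (V : set X).
Hypothesis mV : measurable V.

Let inv_mass_ge0 : 0 <= (fine (P V))^-1.
Proof. by rewrite invr_ge0 fine_ge0. Qed.

(** The proof argument lets the probability structure be inferred. *)
Definition conditional of (0 < P V)%E : set X -> \bar R :=
  mscale (NngNum inv_mass_ge0) (mrestr P mV).

Variable PV : (0 < P V)%E.

HB.instance Definition _ := Measure.on (conditional PV).

Let conditional_setT : conditional PV setT = 1%E.
Proof.
rewrite /conditional /mscale/= /mrestr setTI.
have fV : P V \is a fin_num by exact: fin_num_measure.
rewrite -[X in (_ * X)%E](fineK fV) -EFinM mulVf//.
by rewrite gt_eqF// -lte_fin fineK.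
Qed.

HB.instance Definition _ := Measure_isProbability.Build _ _ _ (conditional PV)
  conditional_setT.

Lemma conditionalE B : conditional PV B = ((fine (P V))^-1%:E * P (B `&` V))%E.
Proof. by []. Qed.

End Conditional.

Lemma xsection_shift (R : realType) dI (I : measurableType dI) (d : nat)
    (g : {mfun I >-> torus R d}) (C : set (I * torus R d)) x :
  xsection (shift g @^-1` C) x = (fun y => g x + y) @^-1` xsection C x.
Proof.
by apply/seteqP; split => y; rewrite /xsection/= !inE /shift/= addrC.
Qed.

Section Switch.
Context (R : realType) dI (I : measurableType dI) (L : probability I R)
  (d : nat).
Local Notation K := (torus R d).
Variables (A : set I) (m1 m2 : probability K R).
Hypothesis mA : measurable A.

Let pair_law : probability (K * K)%type R := (m1 \x m2)%E.

Let pick_fiber (w : I * (K * K)) : I * K :=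
  (w.1, if w.1 \in A then w.2.1 else w.2.2).

Let measurable_pick_fiber : measurable_fun setT pick_fiber.
Proof.
apply: measurable_fun_pair => //; apply: measurable_fun_ifT.
- apply: (@measurable_fun_bool _ _ _ _ true).
  rewrite setTI (_ : _ @^-1` _ = fst @^-1` A); first exact: measurable_fst_preimage.
  by apply/seteqP; split => w /=; [move/set_mem|move/mem_set].
- exact: measurableT_comp.
- exact: measurableT_comp.
Qed.

Let switch_marginal (B : set I) : measurable B ->
  pushforward (distribution (L \x pair_law) (mfun_of measurable_pick_fiber))%E fst B =
  L B.
Proof.
move=> mB; transitivity ((L \x pair_law)%E (B `*` setT)).
  rewrite /distribution /pushforward; congr ((L \x pair_law)%E _).
  by apply/seteqP; split => -[x w] //= -[].
transitivity (L B * pair_law setT)%E; first exact: product_measure1E.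
have -> : pair_law setT = 1%E by exact: probability_setT.
by rewrite mule1.
Qed.

(** The fiber is [m1] above [A] and [m2] elsewhere; both are drawn, and the base
point decides which one is kept. *)
Definition switch_fibered : fibered L d := fibered_of switch_marginal.

Lemma switch_fiberedE (C : set (I * K)) : measurable C -> switch_fibered C =
  (\int[L]_x (if x \in A then m1 (xsection C x) else m2 (xsection C x)))%E.
Proof.
move=> mC; rewrite /switch_fibered/= mtruncE// /distribution /pushforward.
rewrite /product_measure1; apply: eq_integral => x _ /=.
have mCx := measurable_xsection x mC.
have [Ax|Ax] := boolP (x \in A).
  transitivity ((m1 \x m2)%E (xsection C x `*` setT)).
    congr (_ _); apply/seteqP; split => -[y y']; rewrite /xsection/= !inE /pick_fiber/= Ax //.
    by case.
  transitivity (m1 (xsection C x) * m2 setT)%E; first exact: product_measure1E.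
  have -> : m2 setT = 1%E by exact: probability_setT.
  by rewrite mule1.
transitivity ((m1 \x m2)%E (setT `*` xsection C x)).
  congr (_ _); apply/seteqP; split => -[y y']; rewrite /xsection/= !inE /pick_fiber/= (negPf Ax) //.
  by case.
transitivity (m1 setT * m2 (xsection C x))%E; first exact: product_measure1E.
have -> : m1 setT = 1%E by exact: probability_setT.
by rewrite mul1e.
Qed.

Lemma measurable_step (Z : K) : measurable_fun setT (fun x => if x \in A then Z else 0).
Proof.
apply: measurable_fun_ifT.
- apply: (@measurable_fun_bool _ _ _ _ true).
  rewrite setTI (_ : _ @^-1` _ = A)//.
  by apply/seteqP; split => x /=; [move/set_mem|move/mem_set].
- exact: measurable_cst.
- exact: measurable_cst.
Qed.

Definition step_fun (Z : K) : {mfun I >-> K} := mfun_of (measurable_step Z).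

Lemma step_shiftE (Z : K) (C : set (I * K)) : measurable C ->
  shift_fibered (step_fun Z) switch_fibered C =
  (\int[L]_x (if x \in A then m1 ((fun y : K => (Z + y)%R) @^-1` xsection C x)
              else m2 (xsection C x)))%E.
Proof.
move=> mC; rewrite shift_fiberedE// switch_fiberedE; last first.
  by rewrite -[X in measurable X]setTI; exact: measurable_shift.
apply: eq_integral => x _; rewrite !xsection_shift /step_fun/=.
case: (boolP (x \in A)) => // Ax; congr (m2 _); apply/seteqP; split => y /=; by rewrite add0r.
Qed.

End Switch.

Section ErgodicAsynchronous.
Context (R : realType) dI (I : measurableType dI) (L : probability I R)
  (tau : topology_on I) (d : nat).
Local Notation K := (torus R d).
Local Notation J := (topologized tau).
Local Notation M := (weak_fibered L d tau).
Hypothesis htau : compact_metrizable R J.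
Hypothesis htauB : borel_topology tau.
Variable haar : probability K R.
Hypothesis hhaar : is_haar haar.
Local Notation lambda := (product_fibered L haar : M).

(** The Fourier coefficients depend on the translation through waves. *)
Lemma step_shift_continuous (A : set I) (mA : measurable A) (mu : M) :
  continuous ((fun Z : K => shift_fibered (step_fun mA Z) mu) : K -> M).
Proof.
have [phi [phic phi01 phisep _]] := separating_family htau.
move=> Z0; apply: (trig_cvg_weak htau htauB phic phisep (nbhs_filter Z0)) => s k th.
have bm := monomial_bounded_measurable htau htauB phic s.
have bAm := bounded_measurable_mul (@bounded_measurable_indic _ _ R _ mA) bm.
have bCm := bounded_measurable_mul
  (@bounded_measurable_indic _ _ R _ (measurableC mA)) bm.
pose c1 := mean_fibered mu (fun z => \1_A z.1 * monomial phi s z.1 * wave k 0 z.2).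
pose c2 := mean_fibered mu
  (fun z => \1_A z.1 * monomial phi s z.1 * wave k (- (pi / 2)) z.2).
pose c3 := mean_fibered mu (fun z => \1_(~` A) z.1 * monomial phi s z.1 * wave k th z.2).
have E Z : mean_fibered (shift_fibered (step_fun mA Z) mu : M) (trig_monomial phi s k th) =
    c1 * wave k th Z + c2 * wave k (th + pi / 2) Z + c3.
  rewrite /mean_fibered mean_shift; last first.
    by apply: (trig_sum_bounded_measurable htau htauB phic); exact: trig_sum_monomial.
  have b1 := bounded_measurable_base_wave k 0 bAm.
  have b2 := bounded_measurable_base_wave k (- (pi / 2)) bAm.
  have b3 := bounded_measurable_base_wave k th bCm.
  rewrite [c1 * _]mulrC [c2 * _]mulrC -!meanZ// -!meanD//; last 3 first.
  - by apply: bounded_measurable_add; exact: bounded_measurable_scale.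
  - exact: bounded_measurable_scale.
  - exact: bounded_measurable_scale.
  congr mean; apply/funext => z; rewrite /trig_monomial /shift /step_fun/=.
  rewrite indicC !indicE; case: (z.1 \in A) => /=; last first.
    by rewrite addr0 !mul0r !mulr0 !add0r mul1r.
  rewrite addrC waveD wave_split !mul1r !mul0r addr0.
  by rewrite /wave addrA cosDpihalf; ring.
rewrite E; under eq_fun do rewrite E.
have cw k' th' : continuous (@wave R d k' th') by exact: wave_continuous.
by apply: cvgD; [apply: cvgD; apply: cvgMr; exact: cw|exact: cvg_cst].
Qed.

Variable f : {mfun I >-> K}.
Local Notation T := ((fun mu : M => shift_fibered f mu) : M -> M).

(** Above a set that [f] maps to a coset of [H], fibers carrying a law that is
invariant under [H] are only translated, all by the same amount. *)
Lemma shift_switch (H : set K) (a Z : K) (A : set I) (mA : measurable A)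
    (nu : probability K R) C : (forall x, A x -> translate a H (f x)) ->
  (forall h B, H h -> measurable B -> nu ((fun y => h + y) @^-1` B) = nu B) ->
  measurable C ->
  shift_fibered f (shift_fibered (step_fun mA Z) (switch_fibered L nu haar mA)) C =
  shift_fibered (step_fun mA (Z + a)) (switch_fibered L nu haar mA) C.
Proof.
move=> fA nuH mC; have mfC : measurable (shift f @^-1` C).
  by rewrite -[X in measurable X]setTI; exact: measurable_shift.
have E1 := step_shiftE L nu haar mA Z mfC.
have E2 := step_shiftE L nu haar mA (Z + a) mC.
apply: etrans (shift_fiberedE f _ mC) (etrans E1 (etrans _ (esym E2))).
apply: eq_integral => x _; rewrite xsection_shift.
have mCx := measurable_xsection x mC.
case: (boolP (x \in A)) => Ax; last exact: haar_translate.
have [h Hh fx] := fA _ (set_mem Ax).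
have mCa : measurable ((fun y : K => Z + a + y) @^-1` xsection C x).
  by rewrite -[X in measurable X]setTI; exact: measurable_torus_addl.
rewrite -(nuH h _ Hh mCa); congr (nu _).
have E y : a + h + (Z + y) = Z + a + (h + y) by rewrite addrACA (addrC a).
by apply/seteqP; split => y /=; rewrite -fx E.
Qed.

(** The law to be transported is Haar measure conditioned on a neighbourhood of
[H] that is invariant under [H]; a Haar distributed translation [Z] above the
synchronous set makes the law of the resulting random fibered measure
invariant. *)
Lemma uniquely_ergodic_asynchronous : uniquely_ergodic R T -> asynchronous L f.
Proof.
move=> [P0 [_ uniq]] H cH sH HT a; apply: contrapT => LA0.
have [z0 [e [e0 He]]] := subgroup_gap cH HT.
pose A := f @^-1` translate a H.
have mA : measurable A.
  rewrite -[X in measurable X]setTI; apply: (measurable_funPT f) => //.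
  exact: measurable_coset.
have LA : (0 < L A)%E by rewrite lt_neqAle measure_ge0 andbT eq_sym; apply/eqP.
pose V := fattening H (e / 4).
have oV : open V by exact: open_fattening.
have mV : measurable V by exact: open_measurable_torus.
have haarV : (0 < haar V)%E.
  apply: haar_open_gt0 => //; exists 0, 0; first exact: sH.1.
  by rewrite subrr gauge0 divr_gt0.
have haarVC : (0 < haar (~` V))%E.
  have oB := open_gauge_lt z0 (e / 4).
  apply: lt_le_trans (haar_open_gt0 hhaar oB _) _.
    by exists z0; rewrite /= subrr gauge0 divr_gt0.
  apply: le_measure; rewrite ?inE; first exact: open_measurable_torus.
    exact: measurableC.
  move=> y /= yz [h Hh yh]; have := He _ Hh.
  have := gaugeD (h - y) (y - z0); rewrite subrKA -[gauge (h - y)]gaugeN opprB.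
  by lra.
pose nu : probability K R := conditional mV haarV.
have nuE B : nu B = ((fine (haar V))^-1%:E * haar (B `&` V))%E.
  exact: conditionalE.
have nuH h B : H h -> measurable B -> nu ((fun y => h + y) @^-1` B) = nu B.
  move=> Hh mB; rewrite !nuE; congr (_ * _)%E.
  rewrite -(haar_translate hhaar h (measurableI _ _ mB mV)); congr (haar _).
  apply/seteqP; split => y [/= hB Vy]; split => //.
    by rewrite addrC; apply/fattening_invariant.
  by apply/(fattening_invariant sH (e / 4) y Hh); rewrite addrC.
pose mu Z : M := shift_fibered (step_fun mA Z) (switch_fibered L nu haar mA).
have cmu : continuous (mu : K -> M) by exact: step_shift_continuous.
have mmu : measurable_fun setT (mu : K -> M).
  apply: (@measurability _ _ _ _ setT _ (@open M)) => //.
  move=> _ [B oB <-]; rewrite setTI; apply: sub_sigma_algebra.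
  by apply: open_comp oB => Z _; exact: cmu.
have mmuP (B : set M) : measurable B -> measurable (mu @^-1` B).
  by move=> mB; rewrite -[X in measurable X]setTI; exact: mmu.
pose P : probability M R := distribution haar (mfun_of mmu).
have invP : invariant_probability T P.
  move=> B mB; rewrite /pushforward/= /P /distribution /pushforward/=.
  have muB := mmuP _ mB.
  rewrite -[RHS](haar_translate hhaar a muB); congr (haar _).
  suff E Z : shift_fibered f (mu Z) = mu (a + Z).
    by apply/seteqP; split => Z /=; rewrite E.
  apply: fibered_ext => C mC; rewrite /mu (addrC a).
  exact: (shift_switch (H := H)).
have invd : invariant_probability T (\d_lambda : probability M R).
  apply: (invariant_dirac_haar htau htauB hhaar); first by [].
have [F cF Fmu] : exists2 F : J * K -> R, continuous F &
    mean_fibered (mu 0) F != mean_fibered lambda F.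
  apply: contrapT => nF.
  have mVC : measurable (~` V) by exact: measurableC.
  have E : (mu 0 : fibered L d) (A `*` ~` V) = (lambda : fibered L d) (A `*` ~` V).
    apply: (eq_continuous_mean htau htauB); last exact: measurableX.
    by move=> F cF; apply: contrapT => /eqP Fne; apply: nF; exists F.
  move: E; rewrite haar_rectangle// /mu step_shiftE//; last exact: measurableX.
  rewrite (_ : (fun x => _) = cst 0%E).
    rewrite integral0 => /esym/eqP; rewrite mule_eq0.
    by rewrite !gt_eqF.
  apply/funext => x /=; have [Ax|Ax] := boolP (x \in A).
    rewrite (_ : _ @^-1` _ = ~` V).
      by rewrite nuE setICl measure0 mule0.
    apply/seteqP; split => y /=; rewrite add0r /xsection/= inE/=; first by case.
    by move=> nVy; split => //; exact: set_mem.
  rewrite (_ : xsection _ _ = set0) ?measure0//.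
  apply/seteqP; split => // y; rewrite /xsection/= inE/= => -[Ax' _].
  by move: Ax; rewrite mem_set.
pose U : set M := [set nu' : M | mean_fibered nu' F != mean_fibered lambda F].
have oU : open U.
  apply: (@open_comp _ _ (fun nu' : M => mean_fibered nu' F)
    [set t : R | t != mean_fibered lambda F]).
    by move=> nu' _; exact: mean_fibered_continuous.
  exact: open_neq.
have mU : measurable U by exact: sub_sigma_algebra.
have PU : P U = \d_lambda U by rewrite (uniq P invP U mU) (uniq _ invd U mU).
have : (0 < P U)%E.
  rewrite /P /distribution /pushforward/=; apply: haar_open_gt0 => //.
    by apply: open_comp oU => Z _; exact: cmu.
  by exists 0.
by rewrite PU diracE memNset ?ltxx// /U/= eqxx.
Qed.

End ErgodicAsynchronous.

Theorem theorem1 (R : realType)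
  (dI : measure_display) (I : measurableType dI) (L : probability I R)
  (hI : standard_borel R I) (hL : atomless L)
  (tau : topology_on I) (htau : compact_metrizable R (topologized tau))
  (htauB : borel_topology tau)
  (d : nat) (hd : (1 <= d)%N) (f : {mfun I >-> torus R d})
  (haar : probability (torus R d) R) (hhaar : is_haar haar) :
  let M := weak_fibered L d tau in
  let D (g : {mfun I >-> torus R d}) : M := graph_measure L g in
  let lambda : M := product_fibered L haar in
  let T : M -> M := fiberwise_conv (D f) in
  (asynchronous L f <->
     closure [set D (torus_mulz n f) | n in [set: int]] lambda) /\
  (asynchronous L f <-> uniquely_ergodic R T) /\
  (asynchronous L f ->
     forall P : probability M R,
       invariant_probability T P <->
       forall A : set M, measurable A -> P A = \d_lambda A).
Proof.
move=> M D lambda T.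
have -> : T = (fun mu : M => shift_fibered f mu : M).
  by apply/funext => mu; exact: fiberwise_conv_graph.
have [phi [phic phi01 phisep _]] := separating_family htau.
split; [split|split; [split|]].
- by move=> af; exact: (asynchronous_closure htau htauB hhaar af phic phi01 phisep).
- exact: (closure_asynchronous htau htauB hhaar).
- exact: (asynchronous_uniquely_ergodic htau htauB hhaar).
- exact: (uniquely_ergodic_asynchronous htau htauB hhaar).
- move=> af P; split; first exact: (asynchronous_invariant htau htauB hhaar).
  exact: (invariant_dirac_haar htau htauB hhaar).
Qed.
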